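(* Let $q\equiv 3\pmod 4$. (1) For $|u|<1/q$, we have, for each choice of sign (the upper, respectively lower, sign being taken throughout), the generating function $$\sum_{n\ge 0}\frac{i(\Omega^{\pm}(2n,q))}{|\mathrm{O}^{\pm}(2n,q)|}q^{n^2}u^n=\frac14\left[\frac{\prod_{i\ge 1}(1+u/q^{2(i-1)})^2}{\prod_{i\ge 1}(1-u^2/q^{2(i-2)})}+\frac{\prod_{i\ge 1}(1+(-1)^{i-1}u/q^{i-1})}{\prod_{i\ge 1}(1+u^2/q^{2i-3})}\pm\frac{\prod_{i\ge 1}(1-(-1)^{i-1}u/q^{i-1})}{\prod_{i\ge 1}(1+u^2/q^{2i-3})}\pm\frac{\prod_{i\ge 1}(1+u/q^{2i-1})^2}{\prod_{i\ge 1}(1-u^2/q^{2(i-1)})}\right].$$ (2) For $|u|<1$, we have the generating function $$\sum_{n\ge 0}\frac{i(\Omega(2n+1,q))}{|\mathrm{O}(2n+1,q)|}q^{n^2}u^n=\frac14\left[\frac{(1+u)\prod_{i\ge 1}(1+u/q^{2i})^2}{\prod_{i\ge 1}(1-u^2/q^{2(i-1)})}+\frac{\prod_{i\ge 1}(1+(-1)^{i}u/q^{i})}{\prod_{i\ge 1}(1+u^2/q^{2i-1})}\right].$$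
   Context: For $q$ an odd prime power and $\delta$ a fixed nonsquare in $\mathbb{F}_q^{\times}$: $\mathrm{O}^{+}(2n,q)$ is the isometry group on $\mathbb{F}_q^{2n}$ of the quadratic form $x_1x_2+x_3x_4+\cdots+x_{2n-1}x_{2n}$; for $n\ge1$, $\mathrm{O}^{-}(2n,q)$ is that of $x_1x_2+\cdots+x_{2n-3}x_{2n-2}+x_{2n-1}^2-\delta x_{2n}^2$; $\mathrm{O}(2n+1,q)$ is that of $x_1x_2+\cdots+x_{2n-1}x_{2n}+x_{2n+1}^2$ on $\mathbb{F}_q^{2n+1}$ (replacing $x_{2n+1}^2$ by $\delta x_{2n+1}^2$ gives an isomorphic group). $\mathrm{SO}$ denotes the subgroup of determinant $1$ elements. $\Omega^{\pm}(N,q)$ (or $\Omega(N,q)$ for $N$ odd) is the derived subgroup of the corresponding special orthogonal group, which has index $2$ for $N\ge 3$; for $N=2$, $\Omega^{\pm}(2,q)$ denotes the unique index $2$ subgroup of the cyclic group $\mathrm{SO}^{\pm}(2,q)$ of order $q\mp1$; $\Omega(1,q)$ and $\Omega^{+}(0,q)$ are trivial. $i(X)$ denotes the number of $g\in X$ with $g^2=1$ (the identity is counted). Conventions: $|\mathrm{O}^{+}(0,q)|=1$, and $1/|\mathrm{O}^{-}(0,q)|=0$, so the $n=0$ term in (1) with sign $-$ is $0$. *)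

(* Defs.v *)
From HB Require Import structures.
From mathcomp Require Import all_boot all_order all_algebra all_fingroup.
From mathcomp Require Import all_solvable.
From mathcomp Require Import complex.
From mathcomp Require Import all_classical all_reals all_analysis.

Set Implicit Arguments.
Unset Strict Implicit.
Unset Printing Implicit Defensive.

Import Order.TTheory GRing.Theory Num.Theory.
Import numFieldNormedType.Exports.

Local Open Scope ring_scope.

Section Orthogonal.
Variable F : finFieldType.

(* 0-based coordinates: the paper's x_j is [coord_at x j.-1].  The coordinates
   used below are all in range, so [inord] never takes its default value. *)
Definition coord_at (k : nat) (x : 'cV[F]_k.+1) (j : nat) : F := x (inord j) 0.

(* x_1 x_2 + x_3 x_4 + ... + x_{2n-1} x_{2n} *)
Definition hyperbolic (k : nat) (n : nat) (x : 'cV[F]_k.+1) : F :=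
  \sum_(i < n) coord_at x i.*2 * coord_at x i.*2.+1.

(* The forms on F^{2n} with n = m + 1. *)
Definition qform_plus (m : nat) (x : 'cV[F]_(m.*2.+2)) : F :=
  hyperbolic m.+1 x.

Definition qform_minus (delta : F) (m : nat) (x : 'cV[F]_(m.*2.+2)) : F :=
  hyperbolic m x + coord_at x m.*2 ^+ 2 - delta * coord_at x m.*2.+1 ^+ 2.

(* The form on F^{2n+1}. *)
Definition qform_odd (n : nat) (x : 'cV[F]_(n.*2.+1)) : F :=
  hyperbolic n x + coord_at x n.*2 ^+ 2.

Section IsometryGroup.
Variables (k : nat) (Q : 'cV[F]_k.+1 -> F).

Definition isometries : {set {'GL_k.+1[F]}} :=
  [set g : {'GL_k.+1[F]} |
    [forall x : 'cV[F]_k.+1, Q (GLval g *m x) == Q x]].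

Lemma isometries_group_set : group_set isometries.
Proof.
apply/group_setP; split.
  by rewrite inE; apply/forallP => x; rewrite GL_1E mul1mx.
move=> g h; rewrite !inE => /forallP Hg /forallP Hh; apply/forallP => x.
by rewrite GL_ME -mulmxA (eqP (Hg _)) (eqP (Hh _)).
Qed.
Canonical isometries_group := Group isometries_group_set.

Definition special_isometries : {set {'GL_k.+1[F]}} :=
  [set g : {'GL_k.+1[F]} in isometries | \det (GLval g) == 1].

Lemma special_isometries_group_set : group_set special_isometries.
Proof.
apply/group_setP; split; first by apply/setIdP; rewrite group1 GL_1E det1 eqxx.
move=> g h /setIdP[Og /eqP dg] /setIdP[Oh /eqP dh]; apply/setIdP.
by split; rewrite ?groupM // GL_ME det_mulmx dg dh mul1r.
Qed.
Canonical special_isometries_group := Group special_isometries_group_set.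

End IsometryGroup.

(* The index 2 subgroup of G, for G having exactly one. *)
Definition index2_subgroup (gT : finGroupType) (G : {group gT}) : {group gT} :=
  odflt 1%G [pick H : {group gT} | (H \subset G) && (#|G : H|%g == 2%N)].

(* Dimension 2n with n = m + 1; the derived subgroup is not the right
   definition in dimension 2, where SO is abelian. *)
Definition Omega_even (m : nat) (Q : 'cV[F]_(m.*2.+2) -> F) :
    {group {'GL_(m.*2.+2)[F]}} :=
  if m == 0%N then index2_subgroup (special_isometries_group Q)
  else ((special_isometries Q)^`(1))%G.

(* For n = 0 this is trivial, as is SO(1,q). *)
Definition Omega_odd (n : nat) : {group {'GL_(n.*2.+1)[F]}} :=
  ((special_isometries (@qform_odd n))^`(1))%G.

End Orthogonal.

(* i(X); the identity is counted. *)
Definition num_invol (gT : finGroupType) (X : {set gT}) : nat :=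
  #|[set g in X | (g ^+ 2 == 1)%g]|.

Section GeneratingFunctions.
Variables (C : numFieldType) (F : finFieldType).

(* i(Omega)/|O| in dimension 2n.  At n = 0, O^+ and Omega^+ are the trivial
   group and 1/|O^-| is 0 by convention. *)
Definition ratio_plus (n : nat) : C :=
  if n is m.+1 then
    (num_invol (Omega_even (@qform_plus F m)))%:R
      / (#|isometries (@qform_plus F m)|)%:R
  else 1.

Definition ratio_minus (delta : F) (n : nat) : C :=
  if n is m.+1 then
    (num_invol (Omega_even (@qform_minus F delta m)))%:R
      / (#|isometries (@qform_minus F delta m)|)%:R
  else 0.

Definition ratio_odd (n : nat) : C :=
  (num_invol (Omega_odd F n))%:R / (#|isometries (@qform_odd F n)|)%:R.

End GeneratingFunctions.

Section InfiniteProduct.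
Variable C : numFieldType.

(* Partial products of \prod_{i >= 1} f i. *)
Definition partial_infprod (f : nat -> C) : nat -> C^o :=
  fun n => \prod_(1 <= i < n.+1) f i.

Definition infprod_cvg (f : nat -> C) : Prop := cvgn (partial_infprod f).

(* Meaningful only under [infprod_cvg f]. *)
Definition infprod (f : nat -> C) : C := limn (partial_infprod f).

Definition sum_to (a : nat -> C) (l : C) : Prop :=
  (series (a : nat -> C^o) @ \oo --> (l : C^o))%classic.

End InfiniteProduct.

(* Main.v *)
(* An involution g of the special orthogonal group splits the space V orthogonally
   into its eigenspaces V- and V+, and V- has even dimension.  Since -1 is not a
   square, it lies in Omega iff V- has an orthonormal basis.  If it has one, then g
   is a product of plane reflections -1_P with P spanned by two orthonormal vectors,
   and each of them is a commutator in SO(V) as soon as dim V > 2 (in dimension 2, SO(V)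
   is abelian with -1 as its only involution).  Otherwise g is
   such a product times -1_P with P spanned by orthogonal vectors of norms 1 and -1,
   and is detected by the sign of the permutation that g induces on the vectors v
   with Q v = 1: this sign is a morphism, and the reflection in a basis vector e of
   norm 1 or -1 is odd iff Q e = 1.

   Writing V- and its complement in orthonormal frames and counting frames gives
     i(Omega(V)) / |O(V)| = \sum_k 1 / (|O(V-_k)| |O(V+_k)|),
   with dim V-_k = 2k.  With x = q^-2, the orders of the orthogonal groups turn the
   generating functions into combinations of
     S(a, b) = \sum_(k, l) a^k b^l x^((k-l)^2/2) / ((x;x)_k (x;x)_l),
   which equals (-a x^(1/2); x)_oo (-b x^(1/2); x)_oo / (ab; x)_oo because
   S(a, b) (1 - ab) = (1 + a x^(1/2)) S(a x, b) and S(a x^n, b x^n) tends to 1. *)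
Require Import Defs.
From HB Require Import structures.
From mathcomp Require Import all_boot all_order all_algebra all_fingroup.
From mathcomp Require Import commutator cyclic pgroup.
From mathcomp Require Import finfield complex.
From mathcomp Require Import all_classical all_reals all_analysis.
From mathcomp Require Import ring lra zify.

Import Order.TTheory GRing.Theory Num.Theory.
Local Open Scope ring_scope.

Set Implicit Arguments.
Unset Strict Implicit.
Unset Printing Implicit Defensive.

(** * Fields with q = 3 mod 4 *)

(** When q is 3 mod 4, every nonzero scalar is plus or minus a square, with a unique sign, so a
    nondegenerate form is determined by its dimension and the sign s of its determinant. This is the
    parameter of the whole proof: a form enters as a symmetric M with det M = (-1)^s t^2, and the
    three families are treated at once. A hyperbolic plane has determinant minus a square, so the
    forms of type + and - in dimension 2n have s = odd n and s = ~~ odd n. An orthonormal space of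
    dimension 2k is therefore of type + exactly for even k, and this parity is the source of the
    factors (-1)^k that lead to sums S(a, b) with signed arguments.

    Membership in Omega is used only through -1_P for planes P spanned by orthogonal vectors of
    norms (1, 1) or (1, -1). The count is therefore made for any multiplicatively closed set W of
    special isometries that contains the former and none of the latter. This covers both the derived
    subgroup and the index 2 subgroup in dimension 2, where there are no nontrivial commutators. *)

Section FiniteField.
Variable F : finFieldType.
Hypothesis q_mod4 : #|F| = 3 %[mod 4].

Lemma card_field_mod4 : #|F| = ((#|F| %/ 4) * 4 + 3)%N.
Proof. by rewrite {1}(divn_eq #|F| 4) q_mod4. Qed.

(** Otherwise 1 would have order 2 in the additive group, whose order is odd. *)
Lemma two_neq0 : 2%:R != 0 :> F.
Proof.
apply/negP => /eqP two0.
pose e : F := 1; have o1 : #[e]%g = 2%N.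
  by apply: nt_prime_order; rewrite // ?FinRing.zmodXgE // FinRing.zmod1gE oner_neq0.
have : (#[e]%g %| #|[set: F]|)%N by apply: order_dvdG; rewrite inE.
rewrite o1.
by rewrite cardsT card_field_mod4; lia.
Qed.

(** With q = 4m + 3, a square root x of -1 would give x^(q-1) = (-1)^(2m+1) = -1, against x^(q-1) =
    1. *)
Lemma sqr_neqN1 (x : F) : x ^+ 2 != -1.
Proof.
apply/eqP => x2.
have x0 : x != 0.
  by apply: contra_eq_neq x2 => ->; rewrite expr0n /= eq_sym oppr_eq0 oner_eq0.
have := expf_card x; rewrite card_field_mod4 addn3 exprS.
rewrite -[RHS]mulr1 => /(mulfI x0).
rewrite (_ : (_ * 4).+2 = (2 * ((#|F| %/ 4) * 2 + 1))%N); last by lia.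
rewrite exprM x2 exprD mulnC exprM sqrrN !expr1n mul1r expr1 => /eqP.
by rewrite eq_sym -subr_eq0 opprK (negbTE two_neq0).
Qed.

(* For odd (q-1)/2 every unit a satisfies a^((q+1)/2) = a or -a, and (q+1)/2 is even. *)
Lemma sqr_or_opp_sqr (a : F) : a != 0 -> exists (s : bool) (t : F),
  t != 0 /\ a = (-1) ^+ s * t ^+ 2.
Proof.
move=> a0; set m := (#|F| %/ 4)%N.
have am : (a ^+ (2 * m + 1)) ^+ 2 = 1.
  apply: (mulfI a0); rewrite mulr1 -exprM -exprS -[RHS]expf_card.
  by congr (_ ^+ _); rewrite card_field_mod4 -/m; lia.
have t0 : a ^+ m.+1 != 0 by rewrite expf_neq0.
have E : a * a ^+ (2 * m + 1) = (a ^+ m.+1) ^+ 2.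
  by rewrite -exprS -exprM; congr (_ ^+ _); lia.
case/eqP: am; rewrite sqrf_eq1 => /orP[] /eqP am.
  by exists false, (a ^+ m.+1); rewrite -E am mulr1 mul1r.
by exists true, (a ^+ m.+1); rewrite -E am mulrN1 expr1 mulN1r opprK.
Qed.

(** Two different signs would make a quotient of [x] and [y] a square root of -1. *)
Lemma signF_inj (s t : bool) (x y : F) : x != 0 ->
  (-1) ^+ s * x ^+ 2 = (-1) ^+ t * y ^+ 2 -> s = t.
Proof.
move=> x0; case: s; case: t => //=; rewrite ?expr1 expr0 mulN1r mul1r => E.
- suff /eqP : (y / x) ^+ 2 = -1 by rewrite (negbTE (sqr_neqN1 _)).
  by rewrite exprMn -E exprVn mulNr mulfV // expf_neq0.
- have y0 : y != 0.
    by apply: contraNneq x0 => y0; move/eqP: E; rewrite y0 expr0n oppr0 sqrf_eq0.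
  suff /eqP : (x / y) ^+ 2 = -1 by rewrite (negbTE (sqr_neqN1 _)).
  by rewrite exprMn E exprVn mulNr mulfV // expf_neq0.
Qed.

(* Otherwise the squares would be closed under addition, and -1, which is a
   multiple of 1, would be a square. *)
Lemma N1_sum_sqr : exists a b : F, a ^+ 2 + b ^+ 2 = -1.
Proof.
have [/existsP[a /existsP[b /eqP ab]] | no] :=
  boolP [exists a : F, exists b : F, a ^+ 2 + b ^+ 2 == -1]; first by exists a, b.
have sq n : exists t : F, n%:R = t ^+ 2.
  elim: n => [|n [t nt]]; first by exists 0; rewrite expr0n.
  rewrite -addn1 natrD nt; have [->|z] := eqVneq (t ^+ 2 + 1%:R) 0.
    by exists 0; rewrite expr0n.
  have [[] [s [s0]]] := sqr_or_opp_sqr z; last by rewrite mul1r => ->; exists s.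
  rewrite expr1 mulN1r => E; case/negP: no; apply/existsP; exists (t / s).
  apply/existsP; exists s^-1; apply/eqP; rewrite exprMn -[in X in _ + X](mul1r s^-1).
  rewrite exprMn expr1n -mulrDl E exprVn mulNr mulfV ?expf_neq0 //.
have [p pp pF] := finPcharP F.
have [t] := sq p.-1; rewrite -subn1 natrB ?prime_gt0 // (pcharf0 pF) sub0r => E.
by have := sqr_neqN1 t; rewrite E eqxx.
Qed.

End FiniteField.

(** * Classification of quadratic forms *)

Section Forms.
Variable F : fieldType.

Definition qf n (M : 'M[F]_n) (v : 'cV[F]_n) : F := (v^T *m M *m v) 0 0.

Lemma qfE n (M : 'M[F]_n) v : v^T *m M *m v = (qf M v)%:M.
Proof. by rewrite [LHS]mx11_scalar. Qed.

Lemma qfM n (M P : 'M[F]_n) v : qf M (P *m v) = qf (P^T *m M *m P) v.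
Proof. by rewrite /qf trmx_mul !mulmxA. Qed.

Lemma congr_mxM n (M P T : 'M[F]_n) :
  (P *m T)^T *m M *m (P *m T) = T^T *m (P^T *m M *m P) *m T.
Proof. by rewrite trmx_mul !mulmxA. Qed.

Lemma qfZ n (M : 'M[F]_n) a v : qf M (a *: v) = a ^+ 2 * qf M v.
Proof.
have tZ : (a *: v)^T = a *: v^T by apply/matrixP => i j; rewrite !mxE.
by rewrite /qf tZ -!scalemxAl -scalemxAr mxE [X in _ * X]mxE mulrA.
Qed.

Lemma qfN n (M : 'M[F]_n) v : qf M (- v) = qf M v.
Proof. by rewrite -scaleN1r qfZ sqrrN expr1n mul1r. Qed.

Lemma qf_block n m (A : 'M[F]_n) (B : 'M[F]_m) u v :
  qf (block_mx A 0 0 B) (col_mx u v) = qf A u + qf B v.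
Proof.
by rewrite /qf tr_col_mx mul_row_block !mulmx0 addr0 add0r mul_row_col mxE.
Qed.

Lemma qf_scalar (c : F) (v : 'cV_1) : qf c%:M v = c * (v 0 0) ^+ 2.
Proof.
rewrite /qf !mxE big_ord1 !mxE big_ord1 !mxE eqxx mulr1n; ring.
Qed.

Lemma qf_diag n (d : 'rV[F]_n) v : qf (diag_mx d) v = \sum_i d 0 i * v i 0 ^+ 2.
Proof.
rewrite /qf mxE; apply: eq_bigr => i _.
rewrite mxE (bigD1 i) //= big1 => [|j ji]; rewrite !mxE.
  by rewrite eqxx mulr1n addr0; ring.
by rewrite (negbTE ji) mulr0n mulr0.
Qed.

(** Elimination gives [v^T = C *m pid_mx 1 *m R] with [C] and [R] invertible; absorbing the 1 x 1
    matrix [C] into the first row of [R] makes that row [v^T]. *)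
Lemma complete_col n (v : 'cV[F]_(1 + n)) : v != 0 ->
  exists2 E : 'M[F]_(1 + n), E \in unitmx & lsubmx E = v.
Proof.
move=> v0; have rk : \rank v^T = 1%N.
  by rewrite rank_rV -trmx0 (inj_eq trmx_inj) v0.
have := mulmx_ebase v^T; rewrite rk; set R := row_ebase _; set C := col_ebase _ => E.
exists (block_mx C 0 0 1%:M *m R)^T.
  rewrite unitmx_tr unitmx_mul row_ebase_unit andbT unitmxE det_ublock det1 mulr1.
  by rewrite -unitmxE col_ebase_unit.
have pidE : pid_mx 1 = row_mx 1%:M 0 :> 'M[F]_(1, 1 + n).
  apply/matrixP => i j; rewrite !ord1 !mxE; case: splitP => k kE; rewrite mxE kE //=.
  by rewrite [k]ord1.
rewrite -[RHS]trmxK -E -trmx_usub; congr (_^T).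
have RE := vsubmxK R; rewrite -RE pidE mul_block_col !mul0mx addr0 col_mxKu.
by rewrite -mulmxA mul_row_col mul1mx mul0mx addr0.
Qed.

(** A Gram-Schmidt step: once [v] is completed to a basis, [L] subtracts from the other basis
    vectors their projections on [v], and [K'] is the Schur complement. *)
Lemma split_off n (M : 'M[F]_(1 + n)) v : M^T = M -> M \in unitmx -> qf M v != 0 ->
  exists P M', [/\ P \in unitmx, lsubmx P = v,
    P^T *m M *m P = block_mx (qf M v)%:M 0 0 M', M'^T = M' & M' \in unitmx].
Proof.
move=> symM uM; set c := qf M v => c0.
have v0 : v != 0 by apply: contraNneq c0 => v0; rewrite /c v0 /qf mulmx0 mxE.
have [E uE Ev] := complete_col v0.
set B := E^T *m M *m E.
have symB : B^T = B by rewrite /B !trmx_mul trmxK symM mulmxA.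
have Bc : ulsubmx B = c%:M.
  rewrite -qfE /B -Ev -{1 2}[E]hsubmxK tr_row_mx mul_col_mx mul_col_row.
  by rewrite block_mxKul.
have uB : B \in unitmx by rewrite !unitmx_mul unitmx_tr uE uM.
pose r := ursubmx B; pose K := drsubmx B.
have BE : B = block_mx c%:M r r^T K.
  by rewrite -{1}[B]submxK Bc; congr block_mx; rewrite /r trmx_ursub symB.
have Ksym : K^T = K by rewrite /K trmx_drsub symB.
pose L : 'M[F]_(1 + n) := block_mx 1%:M (- c^-1 *: r) 0 1%:M.
have uL : L \in unitmx by rewrite unitmxE det_ublock !det1 mulr1 unitr1.
pose K' := K - c^-1 *: (r^T *m r).
have LBL : L^T *m B *m L = block_mx c%:M 0 0 K'.
  have cr : c%:M *m (- c^-1 *: r) = - r.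
    by rewrite mul_scalar_mx scalerA mulrN mulfV // scaleN1r.
  have cr' : (- c^-1 *: r)^T *m c%:M = - r^T.
    by rewrite mul_mx_scalar -linearZ /= scalerA mulrN mulfV // scaleN1r linearN.
  rewrite BE /L tr_block_mx !trmx1 trmx0 !mulmx_block !mul1mx !mulmx1 !mul0mx.
  rewrite !mulmx0 !addr0 cr addNr cr' addNr mul0mx add0r; congr block_mx.
  rewrite /K' addrC; congr (_ + _).
  by rewrite [(_ *: r)^T]linearZ /= -scalemxAl scaleNr.
have uK : (block_mx c%:M 0 0 K' : 'M[F]_(1 + n)) \in unitmx.
  by rewrite -LBL unitmx_mul uL andbT unitmx_mul unitmx_tr uL.
exists (E *m L), K'; split.
- by rewrite unitmx_mul uE uL.
- rewrite -[in LHS](hsubmxK E) Ev /L mul_row_block row_mxKl mulmx1 mulmx0 addr0 //.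
- by rewrite trmx_mul -LBL /B !mulmxA.
- by rewrite /K' linearB linearZ /= trmx_mul trmxK Ksym.
by move: uK; rewrite !unitmxE det_ublock unitrM => /andP[].
Qed.

(** Polarization: if [M i i] and [M j j] vanish, the value at [e i + e j] is twice [M i j]. *)
Lemma ex_qf_neq0 n (M : 'M[F]_n) : 2%:R != 0 :> F -> M^T = M -> M != 0 ->
  exists v, qf M v != 0.
Proof.
move=> two0 symM M0.
have [i [j Mij]] : exists i j, M i j != 0.
  apply: contrapT => no; case/eqP: M0; apply/matrixP => i j; rewrite mxE.
  by apply: contrapT => /eqP ij; apply: no; exists i, j.
pose e k : 'cV[F]_n := delta_mx k 0.
have eM k l : (e k)^T *m M *m e l = (M k l)%:M.
  by rewrite trmx_delta -rowE -colE [LHS]mx11_scalar !mxE.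
have [Mii|] := eqVneq (M i i) 0; last first.
  by exists (e i); rewrite /qf eM mxE mulr1n.
have [Mjj|] := eqVneq (M j j) 0; last first.
  by exists (e j); rewrite /qf eM mxE mulr1n.
exists (e i + e j); rewrite /qf [(_ + _)^T]linearD /= !mulmxDl !mulmxDr !eM Mii Mjj.
have -> : M j i = M i j by rewrite -{1}symM mxE.
by rewrite !mxE !mulr1n addr0 add0r -mulr2n -mulr_natl mulf_neq0.
Qed.

End Forms.

Section Classification.
Variable F : finFieldType.
Hypothesis q_mod4 : #|F| = 3 %[mod 4].

(** The sign sits in the last place, so that vectors of norm 1 can be split off at the front. For
    [n = 0] both signs give the empty form, whence the side conditions on [s] in dimension 0
    below. *)
Definition sign_row n (s : bool) : 'rV[F]_n := \row_i (if i.+1 == n then (-1) ^+ s else 1).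

Definition stdform n (s : bool) : 'M[F]_n := diag_mx (sign_row n s).

Lemma stdformS n s : stdform (1 + n.+1) s = block_mx 1%:M 0 0 (stdform n.+1 s).
Proof.
rewrite /stdform -[sign_row _ _]hsubmxK diag_mx_row; congr block_mx.
  by apply/matrixP => i j; rewrite !ord1 !mxE /=.
by congr diag_mx; apply/rowP => i; rewrite !mxE /=.
Qed.

Lemma stdformD n m s : stdform (n + m.+1) s = block_mx 1%:M 0 0 (stdform m.+1 s).
Proof.
rewrite /stdform -[sign_row _ _]hsubmxK diag_mx_row; congr block_mx.
  apply/matrixP => i j; rewrite !mxE /= ltn_eqF //.
  by rewrite addnS ltnS (leq_trans (ltn_ord i)) ?leq_addr.
by congr diag_mx; apply/rowP => i; rewrite !mxE /= -addnS eqn_add2l.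
Qed.

Lemma stdform0 n : stdform n false = 1%:M.
Proof. by apply/matrixP => i j; rewrite !mxE if_same. Qed.

Lemma tr_stdform n s : (stdform n s)^T = stdform n s.
Proof. by rewrite tr_diag_mx. Qed.

Lemma det_stdform n s : \det (stdform n.+1 s) = (-1) ^+ s.
Proof.
rewrite det_diag big_ord_recr /= !mxE eqxx big1 ?mul1r // => i _.
by rewrite !mxE /= ltn_eqF // ltnS ltn_ord.
Qed.

Lemma stdform_unit n s : stdform n s \in unitmx.
Proof.
case: n => [|n]; first by rewrite unitmxE det_mx00 unitr1.
by rewrite unitmxE det_stdform unitfE signr_eq0.
Qed.

Lemma ex_qf_sign n (M : 'M[F]_n.+1) : M^T = M -> M \in unitmx ->
  exists v (s : bool), qf M v = (-1) ^+ s.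
Proof.
move=> symM uM; have M0 : M != 0.
  by apply: contraTneq uM => ->; rewrite unitmxE det0 unitr0.
have [v v0] := ex_qf_neq0 (two_neq0 q_mod4) symM M0.
have [s [t [t0 E]]] := sqr_or_opp_sqr q_mod4 v0.
by exists (t^-1 *: v), s; rewrite qfZ E mulrCA -exprMn mulVf // expr1n mulr1.
Qed.

(** A vector v of norm -1 has an orthogonal companion w of norm 1 or -1. If both norms are -1, then
    a v + b w has norm -(a^2 + b^2), and -1 is a sum of two squares. *)
Lemma ex_qf1 n (M : 'M[F]_(1 + n.+1)) : M^T = M -> M \in unitmx -> exists v, qf M v = 1.
Proof.
move=> symM uM; have [v [[] Ev]] := ex_qf_sign symM uM; last by exists v.
have v0 : qf M v != 0 by rewrite Ev expr1 oppr_eq0 oner_eq0.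
have [P [M' [_ _ PMP symM' uM']]] := split_off symM uM v0.
have [w [s Ew]] := ex_qf_sign symM' uM'.
have [a [b ab]] := N1_sum_sqr q_mod4.
have qP (x : F) y : qf M (P *m col_mx x%:M (y *: w)) = - x ^+ 2 + y ^+ 2 * (-1) ^+ s.
  by rewrite qfM PMP qf_block qf_scalar qfZ Ev Ew expr1 mulN1r !mxE mulr1n.
case: s Ew qP => [_|_] qP.
  exists (P *m col_mx a%:M (b *: w)); rewrite qP expr1 mulrN1 -opprD ab opprK //.
by exists (P *m col_mx 0%:M (1 *: w)); rewrite qP expr0n oppr0 add0r expr1n mulr1.
Qed.

(** Vectors of norm 1 are split off down to dimension 1, where [ex_qf1] stops applying and a sign
    may remain. *)
Lemma classify n (M : 'M[F]_n) : M^T = M -> M \in unitmx ->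
  exists (s : bool) P, P \in unitmx /\ P^T *m M *m P = stdform n s.
Proof.
case: n M => [|n] M symM uM.
  by exists false, 1%:M; split; [rewrite unitmx1 | apply/matrixP => -[]].
elim: n M symM uM => [|n IH] M symM uM.
  have [v [s Ev]] := ex_qf_sign symM uM; exists s, v.
  have E : v^T *m M *m v = stdform 1 s.
    by rewrite qfE Ev; apply/matrixP => i j; rewrite !ord1 !mxE eqxx.
  split => //; have : v^T *m M *m v \in unitmx by rewrite E stdform_unit.
  by rewrite !unitmx_mul => /andP[].
have [v Ev] := ex_qf1 symM uM.
have v0 : qf M v != 0 by rewrite Ev oner_eq0.
have [P [M' [uP _ PMP symM' uM']]] := split_off symM uM v0.
have [s [P' [uP' E']]] := IH M' symM' uM'.
pose T : 'M[F]_(1 + n.+1) := block_mx 1%:M 0 0 P'.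
have uT : T \in unitmx by rewrite unitmxE det_ublock det1 mul1r -unitmxE uP'.
exists s, (P *m T); split; first by rewrite unitmx_mul uP uT.
rewrite (@congr_mxM _ (1 + n.+1)) PMP /T tr_block_mx !trmx0 trmx1 Ev.
rewrite mulmx_block !mulmx0 !mul0mx !mulmx1 !addr0 !add0r.
by rewrite mulmx_block !mulmx0 !mul0mx !mul1mx !addr0 !add0r E' -stdformS.
Qed.

Lemma det_congr n (M P : 'M[F]_n) : \det (P^T *m M *m P) = \det M * \det P ^+ 2.
Proof. by rewrite !det_mulmx det_tr; ring. Qed.

(** Congruence multiplies the determinant by a square, so its class modulo squares identifies the
    sign found by [classify]; in dimension 0 the two standard forms coincide. *)
Lemma classify_det n (M : 'M[F]_n) (s : bool) (t : F) : M^T = M -> t != 0 ->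
  \det M = (-1) ^+ s * t ^+ 2 ->
  exists P, P \in unitmx /\ P^T *m M *m P = stdform n s.
Proof.
move=> symM t0 dM; have uM : M \in unitmx.
  by rewrite unitmxE dM unitfE mulf_neq0 ?signr_eq0 ?expf_neq0.
have [s' [P [uP E]]] := classify symM uM; exists P; split => //; rewrite E.
case: n M P symM uM dM uP E => [|n] M P symM uM dM uP E; first by apply/matrixP => -[].
congr stdform; apply: (signF_inj q_mod4 (y := t * \det P) (oner_neq0 _)).
by rewrite expr1n mulr1 -(det_stdform n) -E det_congr dM -mulrA -exprMn.
Qed.

End Classification.

(** * Counting unit vectors and isometries *)

Lemma card_const_fibers (T U : finType) (A : {set T}) (B : {set U}) (f : T -> U) c :
  (forall x, x \in A -> f x \in B) ->
  (forall y, y \in B -> #|[set x in A | f x == y]| = c) -> #|A| = (#|B| * c)%N.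
Proof.
move=> fAB fib; rewrite -sum1_card (partition_big f (mem B)) //= -sum_nat_const.
apply: eq_bigr => y By; rewrite -(fib y By) -sum1_card.
by apply: eq_bigl => x; rewrite inE.
Qed.

Section Counting.
Variable F : finFieldType.
Local Notation q := #|F|.

Definition isom_mx n (M : 'M[F]_n) : {set 'M[F]_n} := [set g | g^T *m M *m g == M].

Definition frames n (M M' : 'M[F]_n) : {set 'M[F]_n} := [set P | P^T *m M *m P == M'].

Definition nrep n (M : 'M[F]_n) : nat := #|[set v : 'cV[F]_n | qf M v == 1]|.

Lemma isom_unit n (M g : 'M[F]_n) : M \in unitmx -> g \in isom_mx M -> g \in unitmx.
Proof.
move=> uM; rewrite inE => /eqP E; have : g^T *m M *m g \in unitmx by rewrite E.
by rewrite unitmx_mul => /andP[].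
Qed.

Lemma isomM n (M g h : 'M[F]_n) : g \in isom_mx M -> h \in isom_mx M ->
  g *m h \in isom_mx M.
Proof. by rewrite !inE congr_mxM => /eqP -> . Qed.

(** The frames form a single coset: each is [P0 *m h] for a unique [h] in [isom_mx M']. *)
Lemma card_frames n (M M' P0 : 'M[F]_n) : P0 \in unitmx -> P0 \in frames M M' ->
  #|frames M M'| = #|isom_mx M'|.
Proof.
move=> uP; rewrite inE => /eqP E.
have inj : injective (mulmx P0 : 'M[F]_n -> 'M[F]_n) by apply: can_inj (mulKmx uP).
rewrite -[RHS](card_imset _ inj); apply: eq_card => P; rewrite inE.
apply/eqP/imsetP => [EP | [h]].
  exists (invmx P0 *m P); last by rewrite mulKVmx.
  by rewrite inE -{1}E -congr_mxM mulKVmx // EP.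
by rewrite inE => /eqP h1 ->; rewrite congr_mxM E h1.
Qed.

Lemma card_isom_congr n (M M' P0 : 'M[F]_n) : P0 \in unitmx -> P0 \in frames M M' ->
  #|isom_mx M| = #|isom_mx M'|.
Proof.
move=> uP; rewrite inE => /eqP E; rewrite -[LHS](card_imset _ (can_inj (mulmxK uP))).
rewrite -(@card_frames _ M M' P0) ?inE ?E //.
apply: eq_card => P; rewrite inE.
apply/imsetP/eqP => [[g] | EP].
  by rewrite inE => /eqP g1 ->; rewrite congr_mxM g1 E.
exists (P *m invmx P0); last by rewrite mulmxKV.
rewrite inE congr_mxM EP -E -congr_mxM mulmxV // trmx1 mul1mx mulmx1 //.
Qed.

Lemma nrep_congr n (M M' P : 'M[F]_n) : P \in unitmx -> P \in frames M M' ->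
  nrep M' = nrep M.
Proof.
move=> uP; rewrite inE => /eqP E.
rewrite /nrep -[LHS](card_imset _ (can_inj (mulKmx uP))); apply: eq_card => v.
rewrite inE; apply/imsetP/eqP => [[w] | vM].
  by rewrite inE => /eqP wM ->; rewrite qfM E.
by exists (invmx P *m v); rewrite ?mulKVmx // inE -E -qfM mulKVmx // vM.
Qed.

Lemma nrep_scalar (c : F) : nrep (c%:M : 'M[F]_1) = #|[set a : F | c * a ^+ 2 == 1]|.
Proof.
have inj : injective (fun a : F => a%:M : 'cV[F]_1).
  by move=> a b /matrixP /(_ 0 0); rewrite !mxE.
rewrite /nrep -[RHS](card_imset _ inj); apply: eq_card => v.
rewrite inE qf_scalar; apply/idP/imsetP => [E | [a]].
  by exists (v 0 0); rewrite ?inE // -mx11_scalar.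
by rewrite inE => E ->; rewrite mxE mulr1n.
Qed.

(** A nonzero first coordinate determines the second; a zero one leaves it free if c = 0 and
    impossible otherwise. *)
Lemma card_hyperbola (c : F) :
  #|[set p : F * F | p.1 * p.2 == c]| = (q.-1 + (c == 0%R) * q)%N.
Proof.
rewrite -sum1_card (partition_big (fun p => p.1) xpredT) //= (bigD1 0) //= addnC.
have q0 : (0 < q)%N by apply/card_gt0P; exists 0.
congr (_ + _)%N.
  rewrite (eq_bigr (fun=> 1%N)) => [|a a0].
    by rewrite sum1_card cardC1.
  rewrite (big_pred1 (a, c / a)) // => -[x y]; rewrite inE /=.
  rewrite -pair_eqE /= andbC; have [->|] //= := eqVneq x a.
  by apply/eqP/eqP => [<-|->]; [rewrite mulrAC mulfV // mul1r | rewrite mulrC mulfVK].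
rewrite sum1_card; have [->|c0] := eqVneq c 0.
  have inj : injective (fun b : F => (0 : F, b)) by move=> a b [].
  rewrite mul1n -(card_imset _ inj); apply: eq_card => -[x y]; rewrite unfold_in /= !inE /=.
  apply/andP/imsetP => [[_ /eqP ->] | [b _ [-> _]]]; first by exists y.
  by rewrite mul0r.
rewrite mul0n; apply: eq_card0 => -[x y]; rewrite unfold_in /= !inE /=.
by apply/negP => /andP[/eqP xy /eqP x0]; rewrite -xy x0 mul0r eqxx in c0.
Qed.

(** The Gram matrix of the form x y. Its determinant is minus a square, so adding this plane to a
    form flips the sign. *)
Definition hyp2 : 'M[F]_2 := \matrix_(i, j) (if i == j then 0 else 2%:R^-1).

Lemma qf_hyp2 (u : 'cV[F]_2) : 2%:R != 0 :> F -> qf hyp2 u = u 0 0 * u 1 0.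
Proof.
move=> two0; rewrite /qf !mxE !big_ord_recl big_ord0 /= !mxE !big_ord_recl !big_ord0.
rewrite !mxE /= (_ : lift 0 0 = 1); last exact: val_inj.
by field.
Qed.

Lemma tr_hyp2 : hyp2^T = hyp2.
Proof. by apply/matrixP => i j; rewrite !mxE eq_sym. Qed.

Lemma det_hyp2 : \det hyp2 = - (2%:R^-1) ^+ 2.
Proof.
rewrite (expand_det_row _ 0) !big_ord_recl big_ord0 !mxE /= mul0r add0r addr0.
rewrite /cofactor det_mx11 !mxE /= expr1; ring.
Qed.

Lemma card_hyp2 (c : F) : 2%:R != 0 :> F ->
  #|[set u : 'cV[F]_2 | qf hyp2 u == c]| = (q.-1 + (c == 0%R) * q)%N.
Proof.
move=> two0; rewrite -card_hyperbola.
pose f (u : 'cV[F]_2) := (u 0 0, u 1 0).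
have inj : injective f.
  move=> u v [E0 E1]; apply/matrixP => i j; rewrite !ord1.
  by case: i => -[|[|//]] Hi; [move: E0 | move: E1]; congr (u _ _ = v _ _); apply: val_inj.
rewrite -(card_imset _ inj); apply: eq_card => -[a b]; rewrite inE /=.
apply/imsetP/eqP => [[u] | ab].
  by rewrite inE qf_hyp2 // => /eqP <- [-> ->].
exists (\col_i (if i == 0 then a else b)); last by rewrite /f !mxE.
by rewrite inE qf_hyp2 // !mxE ab.
Qed.

(** For a fixed component [z] in the second summand, the plane has to take the value [1 - qf K z];
    it does so q - 1 times, and q more times if this value is 0. *)
Lemma nrep_hyp n (K : 'M[F]_n) : 2%:R != 0 :> F ->
  nrep (block_mx hyp2 0 0 K) = (q.-1 * q ^ n + q * nrep K)%N.
Proof.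
move=> two0; rewrite /nrep -sum1_card (partition_big (fun v => dsubmx v) xpredT) //=.
transitivity (\sum_(z : 'cV[F]_n) (q.-1 + (qf K z == 1%R) * q))%N.
  apply: eq_bigr => z _; rewrite sum1_card.
  rewrite (_ : (qf K z == 1) = (1 - qf K z == 0)); last by rewrite subr_eq0 eq_sym.
  rewrite -card_hyp2 //.
  have inj : injective (fun u : 'cV[F]_2 => col_mx u z).
    by move=> u v /eq_col_mx[].
  rewrite -(card_imset _ inj); apply: eq_card => v; rewrite unfold_in /= inE.
  apply/andP/imsetP => [[/eqP Qv /eqP vz] | [u]].
    exists (usubmx v); last by rewrite -vz vsubmxK.
    have := qf_block hyp2 K (usubmx v) (dsubmx v).
    by rewrite vsubmxK Qv vz inE => ->; rewrite addrK.
  by rewrite inE => /eqP Qu ->; rewrite qf_block Qu subrK col_mxKd !eqxx.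
rewrite big_split /= sum_nat_const card_mx muln1 mulnC; congr (_ + _)%N.
rewrite -big_distrl /= mulnC; congr (_ * _)%N.
by rewrite -sum1_card big_mkcond /= [RHS]big_mkcond /=; apply: eq_bigr => z _;
  rewrite inE; case: eqP.
Qed.

End Counting.

(** * Numbers of unit vectors and orders of the orthogonal groups *)

Section Orders.
Variable F : finFieldType.
Hypothesis q_mod4 : #|F| = 3 %[mod 4].
Local Notation q := #|F|.

(** By its determinant, [stdform F n.+2 s] is a hyperbolic plane plus [stdform F n (~~ s)]. For
    [n = 0] the second summand is empty, so the form has to be the plane itself, whose sign is
    [true]. *)
Lemma nrep_stdform_hyp n (s : bool) : (n == 0%N) ==> s ->
  nrep (stdform F n.+2 s) = (q.-1 * q ^ n + q * nrep (stdform F n (~~ s)))%N.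
Proof.
move=> ns; rewrite -nrep_hyp ?two_neq0 //.
pose M : 'M[F]_(2 + n) := block_mx (hyp2 F) 0 0 (stdform F n (~~ s)).
have symM : M^T = M by rewrite /M tr_block_mx !trmx0 tr_hyp2 tr_stdform.
have dM : \det M = (-1) ^+ s * 2%:R^-1 ^+ 2.
  rewrite /M det_ublock det_hyp2; case: (n) ns => [/= -> | m _].
    by rewrite det_mx00 expr1 mulr1 mulN1r.
  by rewrite det_stdform; case: (s); rewrite /= ?expr1 ?expr0; ring.
have [|P [uP E]] := classify_det q_mod4 symM _ dM; first by rewrite invr_eq0 two_neq0.
by apply: (nrep_congr uP); rewrite inE E.
Qed.

Lemma card_sqr1 : #|[set a : F | a ^+ 2 == 1]| = 2%N.
Proof.
rewrite (_ : [set a : F | _] = [set 1; -1]); last first.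
  by apply/setP => a; rewrite !inE sqrf_eq1.
by rewrite cards2 -subr_eq0 opprK -mulr2n (two_neq0 q_mod4).
Qed.

Lemma stdform1 s : stdform F 1 s = ((-1) ^+ s)%:M.
Proof. by apply/matrixP => i j; rewrite !ord1 !mxE eqxx. Qed.

Lemma nrep_stdform1 s : nrep (stdform F 1 s) = (if s then 0 else 2)%N.
Proof.
rewrite stdform1 nrep_scalar; case: s.
  apply: eq_card0 => a; rewrite inE expr1 mulN1r eqr_oppLR.
  exact: (negbTE (sqr_neqN1 q_mod4 a)).
by rewrite -[RHS]card_sqr1; apply: eq_card => a; rewrite !inE mul1r.
Qed.

Lemma qf1_2 (v : 'cV[F]_2) : qf 1%:M v = v 0 0 ^+ 2 + v 1 0 ^+ 2.
Proof.
rewrite /qf mulmx1 !mxE !big_ord_recl big_ord0 !mxE /= addr0.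
by rewrite (_ : lift 0 0 = 1) ?expr2 //; apply: val_inj.
Qed.

(** The form x^2 + y^2 is the norm of F(i), hence multiplicative and onto. [P] is multiplication by
    an element a + b i of norm c, which maps the vectors of norm 1 onto those of norm c. *)
Lemma card_sum_sqr2 (c : F) : c != 0 ->
  #|[set v : 'cV[F]_2 | qf 1%:M v == c]| = nrep (1%:M : 'M[F]_2).
Proof.
move=> c0; have [a [b ab]] : exists a b : F, a ^+ 2 + b ^+ 2 = c.
  have [[] [t [_ ->]]] := sqr_or_opp_sqr q_mod4 c0.
    have [a [b ab]] := N1_sum_sqr q_mod4; exists (a * t), (b * t).
    by rewrite !exprMn -mulrDl ab.
  by exists t, 0; rewrite expr0n addr0 mul1r.
pose P : 'M[F]_2 := \matrix_(i, j) (if i == j then a else if i == 0 then - b else b).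
have PP : P^T *m P = c%:M.
  apply/matrixP => i j; rewrite !mxE !big_ord_recl big_ord0 !mxE.
  by case: i => -[|[|//]] Hi; case: j => -[|[|//]] Hj; rewrite /= ?mulr1n ?mulr0n -?ab; ring.
have uP : P \in unitmx.
  have : P^T *m P \in unitmx by rewrite PP unitmxE det_scalar unitfE expf_neq0.
  by rewrite unitmx_mul => /andP[].
have qP v : qf 1%:M (P *m v) = c * qf 1%:M v.
  by rewrite qfM mulmx1 PP /qf mul_mx_scalar mulmx1 -scalemxAl mxE.
rewrite /nrep -[RHS](card_imset _ (can_inj (mulKmx uP))); apply: eq_card => v.
rewrite inE; apply/eqP/imsetP => [Qv | [w]].
  exists (invmx P *m v); last by rewrite mulKVmx.
  by rewrite inE -(inj_eq (mulfI c0)) -qP mulKVmx // Qv mulr1.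
by rewrite inE => /eqP Qw ->; rewrite qP Qw mulr1.
Qed.

(** Only 0 has norm 0, and the other q^2 - 1 vectors are shared equally by the q - 1 nonzero
    norms. *)
Lemma nrep_stdform20 : nrep (stdform F 2 false) = q.+1.
Proof.
rewrite stdform0.
have : (\sum_(c : F) #|[set v : 'cV[F]_2 | qf 1%:M v == c]| = q ^ 2)%N.
  rewrite (_ : (q ^ 2)%N = #|{: 'cV[F]_2}|); last by rewrite card_mx.
  rewrite -sum1_card (partition_big (fun v => qf 1%:M v) xpredT) //=.
  by apply: eq_bigr => c _; rewrite -sum1_card; apply: eq_bigl => v; rewrite inE.
rewrite (bigD1 0) //= (eq_bigr (fun=> nrep (1%:M : 'M[F]_2))); last exact: card_sum_sqr2.
rewrite sum_nat_const cardC1 (_ : [set _ | _] = [set 0]); last first.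
  apply/setP => v; rewrite !inE qf1_2; apply/idP/eqP => [E | ->]; last first.
    by rewrite !mxE expr0n addr0.
  have v1 : v 1 0 = 0.
    apply/eqP; apply: contraTT E => v1; apply: contraNneq (sqr_neqN1 q_mod4 (v 0 0 / v 1 0)).
    move=> E; apply/eqP; rewrite exprMn exprVn; apply: (mulIf (expf_neq0 2 v1)).
    by rewrite mulfVK ?expf_neq0 // mulN1r; apply/eqP; rewrite -addr_eq0 E.
  move: E; rewrite v1 expr0n addr0 sqrf_eq0 => /eqP v00.
  by apply/matrixP => -[[|[|//]] Hi] j; rewrite !ord1 mxE; [rewrite -v00 | rewrite -v1];
    congr (v _ _); apply: val_inj.
rewrite cards1 card_field_mod4 // => E; nia.
Qed.

Section Closed.
Variable R : comNzRingType.
Local Notation Q := (q%:R : R).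

(** Induction by hyperbolic planes: each raises [m] by one and flips [s], which leaves
    [(-1) ^+ (m + s)] unchanged. Dimensions 1 and 2 are the base cases. *)
Lemma nrep_stdformE m (s : bool) :
  (nrep (stdform F m.*2.+1 s))%:R = Q ^+ m.*2 + (-1) ^+ (m + s) * Q ^+ m /\
  (nrep (stdform F m.*2.+2 s))%:R = Q ^+ m.*2.+1 + (-1) ^+ (m + s) * Q ^+ m.
Proof.
have qE : (q.-1)%:R = Q - 1.
  by rewrite -subn1 natrB //; apply/card_gt0P; exists 0.
elim: m s => [|m IH] s.
  rewrite nrep_stdform1 add0n !expr0 mulr1; case: s; rewrite /= ?expr1 ?expr0.
    rewrite nrep_stdform_hyp // /nrep eq_card0 => [|v].
      by rewrite muln0 addn0 muln1 qE; split=> //; ring.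
    by rewrite inE /qf !mxE big_ord0 eq_sym oner_eq0.
  by rewrite nrep_stdform20; split; rewrite // -natr1.
have [IH1 IH2] := IH (~~ s).
have sE : (-1) ^+ (m.+1 + s) = (-1) ^+ (m + ~~ s) :> R.
  by rewrite !exprD exprS; case: (s); rewrite /= ?expr1 ?expr0; ring.
rewrite doubleS (@nrep_stdform_hyp m.*2.+1) // (@nrep_stdform_hyp m.*2.+2) //.
rewrite !natrD !natrM !natrX IH1 IH2 qE sE.
by split; rewrite !exprS; ring.
Qed.

(** Orbit counting: the first column of an isometry is a unit vector. Every unit vector occurs,
    because its complement has a determinant of sign [s] and so is isometric to [stdform F n.+1 s];
    the fibre is a coset of the isometries of that complement. *)
Lemma card_isom_stdformS n s :
  #|isom_mx (stdform F n.+2 s)| =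
  (nrep (stdform F n.+2 s) * #|isom_mx (stdform F n.+1 s)|)%N.
Proof.
pose D : 'M[F]_(1 + n.+1) := stdform F (1 + n.+1) s; rewrite -/D.
have DE : D = block_mx 1%:M 0 0 (stdform F n.+1 s) by exact: stdformS.
pose e : 'cV[F]_(1 + n.+1) := col_mx 1%:M 0.
have lsubE (g : 'M[F]_(1 + n.+1)) : lsubmx g = g *m e.
  by rewrite -{2}[g]hsubmxK mul_row_col mulmx1 mulmx0 addr0.
have qe : qf D e = 1.
  by rewrite DE qf_block qf_scalar /qf mulmx0 !mxE expr1n mulr1 addr0.
apply: (@card_const_fibers _ _ _ _ (lsubmx : 'M[F]_(1 + n.+1) -> 'cV[F]_(1 + n.+1))).
  by move=> g; rewrite !inE lsubE qfM => /eqP ->; rewrite qe.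
move=> v; rewrite inE => /eqP Qv.
have v0 : qf D v != 0 by rewrite Qv oner_eq0.
have [P [M' [uP Pv PDP symM' uM']]] := split_off (tr_stdform _ _ _) (stdform_unit _ _ _) v0.
have dP : \det P != 0 by rewrite -unitfE -unitmxE.
have dM' : \det M' = (-1) ^+ s * \det P ^+ 2.
  have := det_congr D P; rewrite PDP Qv det_ublock det1 mul1r => ->.
  by rewrite (_ : \det D = (-1) ^+ s) //; apply: det_stdform.
have [P' [uP' E']] := classify_det q_mod4 symM' dP dM'.
pose T h : 'M[F]_(1 + n.+1) := block_mx 1%:M 0 0 h.
have TT (h A : 'M[F]_n.+1) :
    (T h)^T *m block_mx 1%:M 0 0 A *m T h = block_mx 1%:M 0 0 (h^T *m A *m h).
  rewrite /T tr_block_mx !trmx0 trmx1 !mulmx_block.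
  by rewrite !(mulmx0, mul0mx, mul1mx, mulmx1, addr0, add0r).
have Te h : T h *m e = e.
  by rewrite /T /e mul_block_col !(mulmx0, mul0mx, mulmx1, addr0).
pose P0 : 'M[F]_(1 + n.+1) := P *m T P'.
have P0D : P0^T *m D *m P0 = D.
  by rewrite (@congr_mxM _ (1 + n.+1)) PDP Qv TT E' -DE.
have uP0 : P0 \in unitmx by apply: (isom_unit (stdform_unit F _ s)); rewrite inE P0D.
have P0v : P0 *m e = v by rewrite /P0 -mulmxA Te -lsubE.
have inj : injective (fun h => P0 *m T h).
  by move=> h h' /(can_inj (mulKmx uP0)) /eq_block_mx[].
rewrite -[RHS](card_imset _ inj); apply: eq_card => g; rewrite inE.
apply/andP/imsetP => [[gD /eqP gv] | [h]].
  pose h0 : 'M[F]_(1 + n.+1) := invmx P0 *m g.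
  have gE : g = P0 *m h0 by rewrite mulKVmx.
  have h0D : h0^T *m D *m h0 = D.
    by rewrite -{1}P0D -congr_mxM -gE; apply/eqP; move: gD; rewrite inE.
  have h0e : lsubmx h0 = e.
    by rewrite lsubE /h0 -mulmxA -lsubE gv -P0v mulKmx.
  pose w := rsubmx h0.
  have h0E : h0 = block_mx 1%:M (usubmx w) 0 (dsubmx w).
    by rewrite block_mxEh (vsubmxK w) -/e -h0e hsubmxK.
  (* [h0] preserves [D] and fixes [e], so its other columns are orthogonal to [e], which kills
     [r]. *)
  move: h0D; rewrite h0E DE; set r := usubmx w; set h := dsubmx w.
  rewrite tr_block_mx trmx0 trmx1 !mulmx_block.
  rewrite !(mulmx0, mul0mx, mul1mx, mulmx1, addr0, add0r) => /eq_block_mx[_ r0 _ hD].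
  rewrite r0 trmx0 mul0mx add0r in hD.
  by exists h; [rewrite inE hD | rewrite gE h0E -/r -/h r0].
rewrite inE => /eqP hD ->; split; last by rewrite lsubE -mulmxA Te P0v.
by rewrite inE (@congr_mxM _ (1 + n.+1)) P0D DE TT hD.
Qed.

Lemma card_isom_stdform1 s : #|isom_mx (stdform F 1 s)| = 2%N.
Proof.
rewrite -[RHS]card_sqr1.
have inj : injective (fun a : F => a%:M : 'M[F]_1).
  by move=> a b /matrixP /(_ 0 0); rewrite !mxE.
rewrite -[RHS](card_imset _ inj); apply: eq_card => g; rewrite inE.
have gE : (g^T *m stdform F 1 s *m g == stdform F 1 s) = (g 0 0 ^+ 2 == 1).
  have gc := mx11_scalar g; set c := g 0 0 in gc *.
  rewrite gc stdform1 tr_scalar_mx -!scalar_mxM -[X in _ == X%:M]mulr1.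
  rewrite [c * _]mulrC -mulrA.
  apply/eqP/eqP => [/matrixP /(_ 0 0) | E]; last by rewrite -expr2 E.
  by rewrite !mxE eqxx !mulr1n => /(mulfI _) <-; rewrite ?signr_eq0 // expr2.
rewrite gE; apply/idP/imsetP => [E | [a]].
  by exists (g 0 0); rewrite ?inE // -mx11_scalar.
by rewrite inE => E ->; rewrite mxE mulr1n.
Qed.

(** With e = (-1)^(m+s), the steps to dimensions 2m + 2 and 2m + 3 contribute Q^(m+1) + e and
    Q^(m+1) - e up to powers of Q; their product is the factor Q^(2m+2) - 1 of the next odd
    dimension. *)
Lemma card_isom_stdformE m (s : bool) :
  (#|isom_mx (stdform F m.*2.+1 s)|)%:R
    = 2%:R * Q ^+ (m ^ 2) * \prod_(i < m) (Q ^+ i.+1.*2 - 1) /\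
  (#|isom_mx (stdform F m.*2.+2 s)|)%:R
    = 2%:R * Q ^+ (m ^ 2 + m) * (Q ^+ m.+1 + (-1) ^+ (m + s))
      * \prod_(i < m) (Q ^+ i.+1.*2 - 1).
Proof.
have step k : (#|isom_mx (stdform F k.*2.+1 s)|)%:R
      = 2%:R * Q ^+ (k ^ 2) * \prod_(i < k) (Q ^+ i.+1.*2 - 1) ->
    (#|isom_mx (stdform F k.*2.+2 s)|)%:R
      = 2%:R * Q ^+ (k ^ 2 + k) * (Q ^+ k.+1 + (-1) ^+ (k + s))
        * \prod_(i < k) (Q ^+ i.+1.*2 - 1).
  move=> E; rewrite card_isom_stdformS natrM E (nrep_stdformE k s).2.
  by rewrite -addnn -addnS !exprD; ring.
elim: m => [|m [_ IH]]; first by split; [|apply: step];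
  rewrite card_isom_stdform1 big_ord0 !mulr1.
suff E : (#|isom_mx (stdform F m.+1.*2.+1 s)|)%:R
    = 2%:R * Q ^+ (m.+1 ^ 2) * \prod_(i < m.+1) (Q ^+ i.+1.*2 - 1) by split; last apply: step.
have E1 : #|isom_mx (stdform F m.+1.*2.+1 s)| =
    (nrep (stdform F m.+1.*2.+1 s) * #|isom_mx (stdform F m.*2.+2 s)|)%N.
  exact: card_isom_stdformS.
rewrite E1 natrM IH (nrep_stdformE m.+1 s).1 big_ord_recr /=.
have ss : (-1) ^+ (m + s) * (-1) ^+ (m + s) = 1 :> R.
  by rewrite -exprD addnn -signr_odd odd_double.
rewrite (_ : m.+1 ^ 2 = m ^ 2 + m + m.+1)%N; last by ring.
rewrite -addnn addSn [(-1) ^+ (m + s).+1]exprS.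
set e := (-1) ^+ (m + s) in ss *; set X := Q ^+ m.+1; set P := \prod_(i < m) _.
rewrite -addSn !exprD -/X.
transitivity (2%:R * (Q ^+ (m ^ 2) * Q ^+ m * X) * (P * (X * X - e * e))); first by ring.
by rewrite ss.
Qed.

End Closed.
End Orders.

(** * Involutions *)

Section Involutions.
Variable F : fieldType.
Hypothesis two0 : 2%:R != 0 :> F.

Definition negdiag N (p : pred nat) : 'M[F]_N :=
  diag_mx (\row_(i < N) (if p i then -1 else 1)).

Definition neg_first N j := negdiag N (fun i => (i < j)%N).

Lemma negdiagM N p1 p2 :
  negdiag N p1 *m negdiag N p2 = negdiag N (fun i => p1 i (+) p2 i).
Proof.
rewrite /negdiag mulmx_diag; congr diag_mx; apply/rowP => i; rewrite !mxE.
by case: (p1 i); case: (p2 i); rewrite /= ?mulrNN ?mulr1 ?mul1r.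
Qed.

Lemma eq_negdiag N p1 p2 : (forall i, (i < N)%N -> p1 i = p2 i) ->
  negdiag N p1 = negdiag N p2.
Proof. by move=> E; congr diag_mx; apply/rowP => i; rewrite !mxE E. Qed.

Lemma negdiag0 N : negdiag N xpred0 = 1%:M.
Proof. by apply/matrixP => i j; rewrite !mxE. Qed.

Lemma negdiagK N p : negdiag N p *m negdiag N p = 1%:M.
Proof. by rewrite negdiagM -[RHS](negdiag0 N); apply: eq_negdiag => i; rewrite addbb. Qed.

Lemma tr_negdiag N p : (negdiag N p)^T = negdiag N p.
Proof. exact: tr_diag_mx. Qed.

Lemma neg_first_block j l : neg_first (j + l) j = block_mx (-1)%:M 0 0 1%:M.
Proof.
rewrite /neg_first /negdiag -[X in diag_mx X]hsubmxK diag_mx_row; congr block_mx;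
  apply/matrixP => a b; rewrite !mxE /=; first by rewrite ltn_ord.
by rewrite ltnNge leq_addr.
Qed.

Lemma neg_firstSS N k : neg_first N k.*2.+2 =
  neg_first N k.*2 *m negdiag N (pred2 k.*2 k.*2.+1).
Proof.
rewrite negdiagM; apply: eq_negdiag => i _ /=.
move: (k.*2) => m; case: (ltngtP i m) => [im|mi|->] /=.
- by rewrite ltnS ltnW ?ltnS 1?ltnW // ltn_eqF // ltnS ltnW.
- by rewrite ltnS [LHS]leq_eqVlt ltnS leqNgt mi orbF.
- by rewrite ltnS leqnSn.
Qed.

(** As 2 is invertible, the row spaces of 1 - g and 1 + g are complementary, and g acts on them by
    -1 and 1. *)
Lemma involution_eigenbasis N (g : 'M[F]_N) : g *m g = 1%:M ->
  exists j l, (j + l = N)%N /\ exists R : 'M[F]_(j + l, N),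
    row_free R /\ R *m g = block_mx (-1)%:M 0 0 1%:M *m R.
Proof.
move=> gg; pose A := 1%:M - g; pose B := 1%:M + g.
have Ag : A *m g = - A by rewrite mulmxBl mul1mx gg opprB.
have Bg : B *m g = B by rewrite mulmxDl mul1mx gg addrC.
have cap : (A :&: B = 0)%MS.
  apply/eqP; rewrite -submx0; apply/rV_subP => u; rewrite sub_capmx.
  case/andP => /submxP[x ux] /submxP[y uy].
  have E1 : u *m g = - u by rewrite {1}ux -mulmxA Ag mulmxN -ux.
  have E2 : u *m g = u by rewrite {1}uy -mulmxA Bg -uy.
  have : 2%:R *: u = 0 by rewrite scaler_nat mulr2n -{1}E2 E1 addNr.
  by move/eqP; rewrite scaler_eq0 (negbTE two0) submx0.
have full : (1%:M <= A + B)%MS.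
  have -> : 1%:M = 2%:R^-1 *: (A + B) :> 'M[F]_N.
    rewrite /A /B addrACA addNr addr0 -mulr2n -scaler_nat scalerA mulVf //.
    by rewrite scale1r.
  by rewrite scalemx_sub // addmx_sub_adds.
have rkE : (\rank A + \rank B)%N = N.
  by rewrite -mxrank_disjoint_sum //; apply/eqP; rewrite -[_ == _]/(row_full _) -sub1mx.
exists (\rank A), (\rank B); split => //.
exists (col_mx (row_base A) (row_base B)); split.
  rewrite /row_free -addsmxE.
  by rewrite (adds_eqmx (eq_row_base A) (eq_row_base B)) mxrank_disjoint_sum.
rewrite mul_col_mx mul_block_col !mul0mx addr0 add0r mul1mx mul_scalar_mx scaleN1r.
have eig (C : 'M[F]_N) c : C *m g = c *: C -> row_base C *m g = c *: row_base C.
  move=> Cg; have /submxP[X ->] : (row_base C <= C)%MS by rewrite eq_row_base.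
  by rewrite -mulmxA Cg -scalemxAr.
by rewrite (eig A (-1)) ?scaleN1r // (eig B 1) ?scale1r.
Qed.

Lemma commute_negfirst j l (K : 'M[F]_(j + l)) :
  neg_first (j + l) j *m K = K *m neg_first (j + l) j ->
  K = block_mx (ulsubmx K) 0 0 (drsubmx K).
Proof.
have neg0 m n (X : 'M[F]_(m, n)) : - X = X -> X = 0.
  move/eqP; rewrite eq_sym -addr_eq0 -mulr2n -scaler_nat scaler_eq0 (negbTE two0).
  by move/eqP.
rewrite neg_first_block -{1 2}[K]submxK !mulmx_block.
rewrite !(mul0mx, mulmx0, addr0, add0r, mul1mx, mulmx1, mul_scalar_mx, mul_mx_scalar).
rewrite !scaleN1r => /eq_block_mx[_ /neg0 E1 E2 _].
by rewrite -{1}[K]submxK E1 [dlsubmx K]neg0.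
Qed.

End Involutions.

(** The involutions whose (-1)-eigenspace is spanned by the first [j] vectors of a standard frame;
    these are orthonormal unless [j = N] and [s] holds. *)
Definition invol_class (F : finFieldType) N (M : 'M[F]_N) (s : bool) j : {set 'M[F]_N} :=
  [set P *m neg_first F N j *m invmx P | P in frames M (stdform F N s)].

Section CardClass.
Variable F : finFieldType.
Hypothesis q_mod4 : #|F| = 3 %[mod 4].

Lemma frame_unit N (M D P : 'M[F]_N) : D \in unitmx -> P \in frames M D -> P \in unitmx.
Proof.
move=> uD; rewrite inE => /eqP E; have : P^T *m M *m P \in unitmx by rewrite E.
by rewrite unitmx_mul => /andP[].
Qed.

(** Frames are counted over the involutions they define. Two frames define the same one iff they
    differ by a matrix commuting with [neg_first], which is block diagonal with isometries of the
    two summands as blocks. With [l = 0] the sign would fall on the first block. *)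
Lemma card_invol_class j l (M : 'M[F]_(j + l)) s : (l == 0%N) ==> ~~ s ->
  (exists P, P \in frames M (stdform F (j + l) s)) ->
  #|isom_mx M| = (#|invol_class M s j| *
    (#|isom_mx (stdform F j false)| * #|isom_mx (stdform F l s)|))%N.
Proof.
move=> ls [P1 P1fr]; set D := stdform F (j + l) s in P1fr *.
have uD : D \in unitmx by apply: stdform_unit.
have DE : D = block_mx (stdform F j false) 0 0 (stdform F l s).
  rewrite stdform0 /D; case: (l) ls => [|l'] /= ls; last exact: stdformD.
  by rewrite (negbTE ls) !stdform0 scalar_mx_block.
rewrite (card_isom_congr (frame_unit uD P1fr) P1fr).
rewrite -(card_frames (frame_unit uD P1fr) P1fr).
apply: card_const_fibers => [P Pfr | y /imsetP[P0 P0fr ->]]; first exact: imset_f.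
have uP0 := frame_unit uD P0fr; set J := neg_first F (j + l) j.
have JJ : J *m J = 1%:M by apply: negdiagK.
pose T (p : 'M[F]_j * 'M[F]_l) : 'M[F]_(j + l) := block_mx p.1 0 0 p.2.
have TJ p : T p *m J = J *m T p.
  rewrite /J neg_first_block /T !mulmx_block.
  by rewrite !(mul0mx, mulmx0, addr0, add0r, mul1mx, mulmx1, mul_scalar_mx, mul_mx_scalar).
have TD p : (T p)^T *m D *m T p = block_mx (p.1^T *m stdform F j false *m p.1) 0 0
    (p.2^T *m stdform F l s *m p.2).
  by rewrite DE /T tr_block_mx !trmx0 !mulmx_block !(mul0mx, mulmx0, addr0, add0r).
have inj : injective (fun p => P0 *m T p).
  by move=> [a b] [a' b'] /(can_inj (mulKmx uP0)) /eq_block_mx[/= -> _ _ ->].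
rewrite -cardsX -[RHS](card_imset _ inj); apply: eq_card => P; rewrite inE.
apply/andP/imsetP => [[Pfr /eqP PJ] | [[a b]]].
  have uP := frame_unit uD Pfr.
  pose h := invmx P0 *m P; have PE : P = P0 *m h by rewrite mulKVmx.
  have hJ : J *m h = h *m J.
    apply: (can_inj (mulKmx uP0)); rewrite [RHS]mulmxA -PE.
    by rewrite -[P *m J](mulmxKV uP) PJ /h !mulmxA.
  have hE := commute_negfirst (two_neq0 q_mod4) hJ.
  exists (ulsubmx h, drsubmx h); last first.
    by rewrite {1}PE; congr (_ *m _); exact: hE.
  have hD : h^T *m D *m h = D.
    by move: P0fr Pfr; rewrite !inE PE congr_mxM => /eqP -> /eqP.
  have := TD (ulsubmx h, drsubmx h); rewrite -{1}(hE : h = T (_, _)) -(hE : h = T (_, _)).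
  rewrite hD DE => /eq_block_mx[E1 _ _ E2].
  by apply/setXP; split; rewrite inE; apply/eqP; rewrite /= -?E1 -?E2.
rewrite !inE /= => /andP[/eqP aD /eqP bD] ->; set h := T (a, b).
have hD : h^T *m D *m h = D by rewrite TD aD bD -DE.
have uh : h \in unitmx by apply: (isom_unit uD); rewrite inE hD.
split; first by move: P0fr; rewrite !inE congr_mxM => /eqP ->; rewrite hD.
have invM : invmx (P0 *m h) = invmx h *m invmx P0.
  apply: (can_inj (mulKmx (_ : P0 *m h \in unitmx))); rewrite ?unitmx_mul ?uP0 //.
  by rewrite mulmxV ?unitmx_mul ?uP0 // !mulmxA mulmxK // mulmxV.
by rewrite invM -!mulmxA (mulmxA h J) TJ !mulmxA mulmxK.
Qed.

End CardClass.

Lemma conj_mulmx (F : fieldType) N (P A B : 'M[F]_N) : P \in unitmx ->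
  P *m (A *m B) *m invmx P = (P *m A *m invmx P) *m (P *m B *m invmx P).
Proof. by move=> uP; rewrite !mulmxA mulmxKV. Qed.


Lemma sign_row_sign (F : finFieldType) n s (i : 'I_n) :
  sign_row F n s 0 i = 1 \/ sign_row F n s 0 i = -1.
Proof. by rewrite mxE; case: ifP; [case: s; [right | left] | left]. Qed.

(** * Involutions of a set W of special isometries that plays the role of Omega *)

Section OmegaInvolutions.
Variable F : finFieldType.
Hypothesis q_mod4 : #|F| = 3 %[mod 4].
Variables (N : nat) (M : 'M[F]_N) (s : bool) (t : F) (W : {set 'M[F]_N}).
Hypothesis symM : M^T = M.
Hypothesis t0 : t != 0.
Hypothesis dM : \det M = (-1) ^+ s * t ^+ 2.
Hypothesis W1 : 1%:M \in W.
Hypothesis WM : forall g h, g \in W -> h \in W -> g *m h \in W.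
Hypothesis Wisom : forall g, g \in W -> g \in isom_mx M.
Hypothesis Wdet : forall g, g \in W -> \det g = 1.
Hypothesis W_pos : forall P (eps : 'rV[F]_N) (i j : 'I_N),
  (forall i, eps 0 i = 1 \/ eps 0 i = -1) -> P \in unitmx ->
  P^T *m M *m P = diag_mx eps -> i != j -> eps 0 i = 1 -> eps 0 j = 1 ->
  P *m negdiag F N (pred2 (i : nat) (j : nat)) *m invmx P \in W.
Hypothesis W_neg : forall P (eps : 'rV[F]_N) (i j : 'I_N),
  (forall i, eps 0 i = 1 \/ eps 0 i = -1) -> P \in unitmx ->
  P^T *m M *m P = diag_mx eps -> eps 0 i = 1 -> eps 0 j = -1 ->
  P *m negdiag F N (pred2 (i : nat) (j : nat)) *m invmx P \notin W.

Lemma gram_unit : M \in unitmx.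
Proof. by rewrite unitmxE dM unitfE mulf_neq0 ?signr_eq0 ?expf_neq0. Qed.

Lemma ex_frame : exists P, P \in frames M (stdform F N s).
Proof.
by have [P [_ E]] := classify_det q_mod4 symM t0 dM; exists P; rewrite inE E.
Qed.

Lemma neg_first_in P (eps : 'rV[F]_N) k :
  (forall i, eps 0 i = 1 \/ eps 0 i = -1) -> P \in unitmx -> P^T *m M *m P = diag_mx eps ->
  (k.*2 <= N)%N -> (forall i : 'I_N, (i < k.*2)%N -> eps 0 i = 1) ->
  P *m neg_first F N k.*2 *m invmx P \in W.
Proof.
move=> eps_s uP PMP; elim: k => [|k IH] kN eps1.
  have -> : neg_first F N 0.*2 = 1%:M by rewrite -negdiag0; apply: eq_negdiag.
  by rewrite mulmx1 mulmxV.
rewrite doubleS neg_firstSS conj_mulmx //; apply: WM.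
  apply: IH => [|i ik]; first by apply: leq_trans kN; rewrite doubleS ltnW.
  by apply: eps1; rewrite doubleS !ltnS ltnW // ltnW.
have l0 : (k.*2 < N)%N by apply: leq_trans kN; rewrite doubleS.
have l1 : (k.*2.+1 < N)%N by apply: leq_trans kN; rewrite doubleS.
apply: (W_pos (i := Ordinal l0) (j := Ordinal l1) eps_s uP PMP).
- by rewrite -val_eqE /= neq_ltn ltnSn.
- by apply: eps1; rewrite doubleS /=.
by apply: eps1; rewrite doubleS /=.
Qed.

(* The dimension 2k of the (-1)-eigenspace is N only if the form itself has an
   orthonormal basis. *)
Definition class_index (k : nat) : bool := (k.*2 <= N)%N && ((k.*2 == N) ==> ~~ s).

Lemma omega_involutionP g : reflect
  (exists2 k, class_index k & g \in invol_class M s k.*2)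
  ((g \in W) && (g *m g == 1%:M)).
Proof.
apply: (iffP andP) => [[gW /eqP gg] | [k /andP[kN ks] /imsetP[P Pfr ->]]]; last first.
  have uP := frame_unit (stdform_unit F N s) Pfr.
  have PMP : P^T *m M *m P = stdform F N s by apply/eqP; move: Pfr; rewrite inE.
  split; last by rewrite -conj_mulmx // negdiagK mulmx1 mulmxV.
  apply: (neg_first_in _ uP PMP kN) => [i|i ik]; first exact: sign_row_sign.
  rewrite mxE.
  case: eqP => // iN; move: ks; rewrite eqn_leq kN -iN ik /= => /negbTE -> //.
(* [involution_eigenbasis] produces rows; applied to [g^T] it gives a matrix [P] whose columns are
   eigenvectors of [g]. *)
have gtt : g^T *m g^T = 1%:M by rewrite -trmx_mul gg trmx1.
have [j [l [jl [R [Rf RJ]]]]] := involution_eigenbasis (two_neq0 q_mod4) gtt.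
have gM : g^T *m M *m g = M by apply/eqP; have := Wisom gW; rewrite inE.
have gd := Wdet gW.
have WP := @neg_first_in; have W_neg' := W_neg; have uM := gram_unit.
have dM' := dM; have symM' := symM; have WM' := WM.
rewrite /class_index; subst N; move: RJ; rewrite -neg_first_block; set J := neg_first _ _ _ => RJ.
pose P := R^T; have uP : P \in unitmx by rewrite unitmx_tr -row_free_unit.
have JJ : J *m J = 1%:M by apply: negdiagK.
have trJ : J^T = J by apply: tr_negdiag.
have gP : g *m P = P *m J by rewrite -[LHS]trmxK trmx_mul /P trmxK RJ trmx_mul trJ.
have gE : g = P *m J *m invmx P by rewrite -gP mulmxK.
pose K := P^T *m M *m P.
(* The two eigenspaces are orthogonal: as [g] preserves [M], the Gram matrix [K] commutes with [J]
   and is block diagonal. *)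
have KJ : J *m K = K *m J.
  have JKJ : J *m K *m J = K.
    transitivity ((P *m J)^T *m M *m (P *m J)); first by rewrite trmx_mul trJ /K !mulmxA.
    by rewrite -gP congr_mxM gM.
  by rewrite -[in RHS]JKJ -[RHS]mulmxA JJ mulmx1.
have KE := commute_negfirst (two_neq0 q_mod4) KJ.
have symK : K^T = K by rewrite /K !trmx_mul trmxK symM' mulmxA.
have uK : K \in unitmx by rewrite /K !unitmx_mul unitmx_tr uP uM.
set K1 := ulsubmx K in KE; set K2 := drsubmx K in KE.
have symK1 : K1^T = K1 by rewrite /K1 trmx_ulsub symK.
have symK2 : K2^T = K2 by rewrite /K2 trmx_drsub symK.
have /andP[uK1 uK2] : (K1 \in unitmx) && (K2 \in unitmx).
  by move: uK; rewrite KE !unitmxE det_ublock unitrM.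
have [s1 [P1 [uP1 E1]]] := classify q_mod4 symK1 uK1.
have [s2 [P2 [uP2 E2]]] := classify q_mod4 symK2 uK2.
pose T : 'M[F]_(j + l) := block_mx P1 0 0 P2.
have uT : T \in unitmx by rewrite unitmxE det_ublock unitrM -!unitmxE uP1.
have TJ : T *m J = J *m T.
  rewrite /J neg_first_block /T !mulmx_block.
  by rewrite !(mul0mx, mulmx0, addr0, add0r, mul1mx, mulmx1, mul_scalar_mx, mul_mx_scalar).
have uPT : P *m T \in unitmx by rewrite unitmx_mul uP.
have PTM : (P *m T)^T *m M *m (P *m T) = block_mx (stdform F j s1) 0 0 (stdform F l s2).
  rewrite congr_mxM -/K KE /T tr_block_mx !trmx0 !mulmx_block.
  by rewrite !(mul0mx, mulmx0, addr0, add0r) E1 E2.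
have gE' : g = P *m T *m J *m invmx (P *m T).
  by rewrite -(mulmxA P) TJ mulmxA -gP -!mulmxA (mulmxA P) mulmxV // mulmx1.
(* The determinant of [g] is both 1 and (-1)^j. *)
have oj : ~~ odd j.
  have := gd; rewrite gE !det_mulmx mulrAC -det_mulmx mulmxV // det1 mul1r.
  rewrite /J neg_first_block det_ublock det1 mulr1 det_scalar -signr_odd.
  case: (odd j) => // /eqP.
  by rewrite expr1 eq_sym -subr_eq0 opprK -mulr2n (negbTE (two_neq0 q_mod4)).
have jE : j = j./2.*2 by rewrite -[LHS]odd_double_half (negbTE oj).
(* If the (-1)-eigenspace has sign -1, the negation of its first j - 2 basis vectors is in [W]. Its
   product with [g] negates the last two, of norms 1 and -1, against [W_neg]. *)
have [s1j | ns1] := boolP (s1 && (0 < j)%N).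
  case/andP: s1j => s1T j0; exfalso.
  have diagE : (P *m T)^T *m M *m (P *m T) = diag_mx (row_mx (sign_row F j s1) (sign_row F l s2)).
    by rewrite PTM diag_mx_row.
  have j2 : j = (j./2).-1.*2.+2 by rewrite -doubleS prednK // half_gt0; case: (j) j0 oj => [|[]].
  set k := (j./2).-1 in j2.
  have epsE (i : 'I_(j + l)) : (i < j)%N ->
      row_mx (sign_row F j s1) (sign_row F l s2) 0 i = if i.+1 == j then -1 else 1.
    move=> ij; rewrite mxE; case: splitP => [i' ii'|i' ii']; last first.
      by move: ij; rewrite ii' ltnNge leq_addr.
    by rewrite mxE ii' s1T expr1.
  have lek : (k.*2 <= j + l)%N by clear -j2; lia.
  have eps_s (i : 'I_(j + l)) : row_mx (sign_row F j s1) (sign_row F l s2) 0 i = 1 \/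
      row_mx (sign_row F j s1) (sign_row F l s2) 0 i = -1.
    by rewrite mxE; case: splitP => i' _; apply: sign_row_sign.
  have inW : P *m T *m neg_first F (j + l) k.*2 *m invmx (P *m T) \in W.
    apply: (WP _ _ k eps_s uPT diagE lek) => i ik.
    by rewrite epsE; [case: eqP => //; clear -j2 ik; lia | clear -j2 ik; lia].
  have l0 : (k.*2 < j + l)%N by clear -j2; lia.
  have l1 : (k.*2.+1 < j + l)%N by clear -j2; lia.
  have e0 : row_mx (sign_row F j s1) (sign_row F l s2) 0 (Ordinal l0) = 1.
    by rewrite epsE /=; [case: eqP => //; clear -j2; lia | clear -j2; lia].
  have e1 : row_mx (sign_row F j s1) (sign_row F l s2) 0 (Ordinal l1) = -1.
    by rewrite epsE /=; [case: eqP => //; clear -j2; lia | clear -j2; lia].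
  have /negP[] := W_neg' _ _ _ _ eps_s uPT diagE e0 e1.
  have -> : negdiag F (j + l) (pred2 k.*2 k.*2.+1) = neg_first F (j + l) k.*2 *m J.
    rewrite (_ : J = neg_first F (j + l) k.*2.+2); last by rewrite -j2.
    by rewrite neg_firstSS mulmxA negdiagK mul1mx.
  by rewrite conj_mulmx //; apply: WM' => //; rewrite -gE'.
(* Otherwise the eigenspace is orthonormal, and a sign can only come from the last vector of the
   complement, if there is one. *)
have PTD : (P *m T)^T *m M *m (P *m T) = stdform F (j + l) (if l == 0%N then false else s2).
  rewrite PTM (_ : stdform F j s1 = 1%:M); last first.
    move: ns1; rewrite negb_and -eqn0Ngt => /orP[/negbTE ->|/eqP j0]; first exact: stdform0.
    by apply/matrixP => i; have := ltn_ord i; rewrite [X in (_ < X)%N]j0.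
  have [l0|] := posnP l; last by case: (l) => // l' _; rewrite -stdformD.
  rewrite stdform0 scalar_mx_block; congr block_mx.
  by apply/matrixP => i; have := ltn_ord i; rewrite [X in (_ < X)%N]l0.
have fr : (0 < j + l)%N -> (if l == 0%N then false else s2) = s.
  move=> N0; apply: (signF_inj q_mod4 (y := t * \det (P *m T)) (oner_neq0 _)).
  rewrite expr1n mulr1 exprMn mulrA -dM' -det_congr PTD.
  by case: (j + l)%N N0 => // n _; rewrite det_stdform.
have frD : (P *m T)^T *m M *m (P *m T) = stdform F (j + l) s.
  rewrite PTD; have [N0|/fr -> //] := posnP (j + l).
  by apply/matrixP => i; have := ltn_ord i; rewrite [X in (_ < X)%N]N0.
exists j./2; rewrite -jE.
  rewrite leq_addr -{1}[j]addn0 eqn_add2l /=; apply/implyP => /eqP l0.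
  have [j0|j0] := posnP (j + l); last by rewrite -fr // -l0.
  (* In dimension 0 the determinant is 1, a square, so [s] is false. *)
  apply/negbT/esym; apply: (signF_inj q_mod4 (oner_neq0 F) (y := t)).
  rewrite -dM' mul1r expr1n; move: (M) => M'; move: M'.
  by rewrite j0 => M'; rewrite det_mx00.
apply/imsetP; exists (P *m T); first by rewrite inE frD.
exact: gE'.
Qed.

(** Recovers [j] from the involution, so that the classes for different [j] are disjoint. *)
Lemma rank_invol_class j g : (j <= N)%N -> g \in invol_class M s j ->
  \rank (1%:M - g) = j.
Proof.
move=> jN /imsetP[P Pfr ->].
have uP := frame_unit (stdform_unit F N s) Pfr.
have -> : 1%:M - P *m neg_first F N j *m invmx P
    = P *m (1%:M - neg_first F N j) *m invmx P.
  by rewrite mulmxBr mulmx1 mulmxBl mulmxV.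
rewrite mxrankMfree ?row_free_unit ?unitmx_inv //.
have fP : row_full P by rewrite row_full_unit.
rewrite (eqmxMfull _ fP).
move: (subnKC jN); move: (N - j)%N => l <-.
rewrite neg_first_block scalar_mx_block opp_block_mx add_block_mx !subr0 subrr.
rewrite rank_diag_block_mx mxrank0 addn0.
have -> : 1%:M - (-1)%:M = 2%:R *: 1%:M :> 'M[F]_j.
  by apply/matrixP => a b; rewrite !mxE; case: eqP => _; rewrite ?mulr1n ?mulr0n; ring.
by rewrite mxrank_scale_nz ?two_neq0 // mxrank1.
Qed.

Lemma card_omega_involutions :
  #|[set g in W | g *m g == 1%:M]| =
  (\sum_(k < (N./2).+1 | class_index k) #|invol_class M s k.*2|)%N.
Proof.
have kN k : (k.*2 <= N)%N -> (k < (N./2).+1)%N.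
  by move=> kN; rewrite ltnS -[k](doubleK k) half_leq.
(* The ranks that occur are of the form [k.*2] with [k.*2 <= N], so [inord] stays in range. *)
rewrite -sum1_card (partition_big (fun g => inord (\rank (1%:M - g))./2 : 'I_(N./2).+1)
  (fun k => class_index k)) /=.
  apply: eq_bigr => k ck; rewrite -sum1_card; apply: eq_bigl => g.
  rewrite inE; apply/andP/idP => [[/omega_involutionP[k' ck' gk'] /eqP E] | gk].
    have /andP[k'N _] := ck'.
    move: E; rewrite (rank_invol_class k'N gk') doubleK => E.
    by rewrite -E inordK // kN.
  split; first by apply/omega_involutionP; exists k.
  have /andP[kkN _] := ck.
  by rewrite (rank_invol_class kkN gk) doubleK inord_val.
move=> g; rewrite inE => /omega_involutionP[k ck gk]; have /andP[kkN _] := ck.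
by rewrite (rank_invol_class kkN gk) doubleK inordK // kN.
Qed.

Lemma omega_involution_ratio (R : numFieldType) :
  (#|[set g in W | g *m g == 1%:M]|)%:R / (#|isom_mx M|)%:R =
  \sum_(k < (N./2).+1 | class_index k)
     ((#|isom_mx (stdform F k.*2 false)|)%:R^-1
      * (#|isom_mx (stdform F (N - k.*2) s)|)%:R^-1) :> R.
Proof.
have [P Pfr] := ex_frame.
have isom_gt0 n s' : (0 < #|isom_mx (stdform F n s')|)%N.
  by apply/card_gt0P; exists 1%:M; rewrite inE trmx1 mul1mx mulmx1.
rewrite card_omega_involutions natr_sum mulr_suml; apply: eq_bigr => k /andP[kN ks].
have ks' : (N - k.*2 == 0)%N ==> ~~ s.
  by apply/implyP => /eqP E; move/implyP: ks; apply; rewrite eqn_leq kN -subn_eq0 E.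
have -> : #|isom_mx M| = (#|invol_class M s k.*2| *
    (#|isom_mx (stdform F k.*2 false)| * #|isom_mx (stdform F (N - k.*2) s)|))%N.
  move: (M) (P) Pfr; move: (subnKC kN) ks'; move: (nat_of_ord k) => k'.
  move: (N - k'.*2)%N => l <- ks' M' P' P'fr.
  by apply: card_invol_class => //; exists P'.
have c0 : (#|invol_class M s k.*2|)%:R != 0 :> R.
  rewrite pnatr_eq0 -lt0n; apply/card_gt0P; exists (P *m neg_first F N k.*2 *m invmx P).
  exact: imset_f.
have o1 := isom_gt0 k.*2 false; have o2 := isom_gt0 (N - k.*2)%N s.
rewrite !natrM; rewrite !lt0n -!(pnatr_eq0 R) in o1 o2.
by field; rewrite c0 o1 o2.
Qed.

End OmegaInvolutions.

(** * Spinor norm as a permutation sign *)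

(** Composing with the transposition of a moved point and its image removes exactly these two moved
    points and changes the parity. *)
Lemma odd_perm_involution (T : finType) (p : {perm T}) : (p * p = 1)%g ->
  exists m, #|[set x | p x != x]| = m.*2 /\ odd_perm p = odd m.
Proof.
have [n] := ubnP #|[set x | p x != x]|; elim: n => // n IH in p *.
rewrite ltnS => mn pp; have pK x : p (p x) = x by rewrite -permM pp perm1.
have [x px | p1] := pickP [pred x | p x != x]; last first.
  exists 0%N; rewrite (_ : p = 1%g) ?odd_perm1; last first.
    by apply/permP => x; rewrite perm1; apply/eqP/negbFE; exact: p1.
  by split => //; apply: eq_card0 => x; rewrite inE perm1 eqxx.
rewrite /= in px; set y := p x in px.
pose p' := (tperm x y * p)%g.
have p'x : p' x = x by rewrite permM tpermL pK.
have p'y : p' y = y by rewrite permM tpermR.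
have p'z z : z != x -> z != y -> p' z = p z.
  by move=> zx zy; rewrite permM tpermD // eq_sym.
have p'p' : (p' * p' = 1)%g.
  apply/permP => z; rewrite permM perm1.
  have [->|zx] := eqVneq z x; first by rewrite !p'x.
  have [->|zy] := eqVneq z y; first by rewrite !p'y.
  rewrite (p'z z) // p'z ?pK //.
    by apply: contraNneq zy => E; rewrite /y -E pK.
  by apply: contraNneq zx => /perm_inj ->.
have mE : [set z | p z != z] = [set x; y] :|: [set z | p' z != z].
  apply/setP => z; rewrite !inE.
  have [->|zx] := eqVneq z x; first by rewrite /= px.
  have [->|zy] := eqVneq z y; first by rewrite /= pK eq_sym.
  by rewrite (p'z z).
have card_m : #|[set z | p z != z]| = #|[set z | p' z != z]|.+2.
  rewrite mE -finset.setUA cardsU1 cardsU1 !inE ?p'x ?p'y !eqxx /= orbF.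
  by rewrite eq_sym px.
have [|m [Em Om]] := IH p' _ p'p'; first by rewrite card_m in mn; apply: ltnW.
exists m.+1; rewrite card_m Em doubleS; split => //.
have -> : p = (tperm x y * p')%g by rewrite /p' mulgA tperm2 mul1g.
by rewrite odd_permM odd_tperm eq_sym px Om.
Qed.

(** The points of [B] moved by [f] come in pairs; [g] extends [f] by the identity to a permutation
    of [T]. *)
Lemma odd_card_involution (T : finType) (B : {set T}) (f : T -> T) :
  (forall x, x \in B -> f x \in B /\ f (f x) = x) ->
  odd #|B| = odd #|[set x in B | f x == x]|.
Proof.
move=> fB; pose g x := if x \in B then f x else x.
have gg : involutive g.
  move=> x; rewrite /g; have [xB|xB] := boolP (x \in B); last by rewrite (negbTE xB).
  by have [-> ->] := fB _ xB.
pose p := perm (inv_inj gg).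
have pp : (p * p = 1)%g by apply/permP => x; rewrite permM !permE gg.
have [m [Em _]] := odd_perm_involution pp.
rewrite -(cardsID [set x | f x == x] B) oddD.
have -> : B :\: [set x | f x == x] = [set x | p x != x].
  apply/setP => x; rewrite !inE permE /g; case: ifP => //=; rewrite ?andbT ?eqxx ?andbF //.
rewrite Em odd_double addbF; congr (odd #|pred_of_set _|).
by apply/setP => x; rewrite !inE.
Qed.

Section SignOnUnitVectors.
Variable F : finFieldType.
Hypothesis q_mod4 : #|F| = 3 %[mod 4].
Variables (N : nat) (eps : 'rV[F]_N).
Hypothesis eps_sign : forall i, eps 0 i = 1 \/ eps 0 i = -1.
Local Notation D := (diag_mx eps).

Lemma eps_diag_unit : D \in unitmx.
Proof.
rewrite unitmxE det_diag unitfE; apply/prodf_neq0 => i _.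
by case: (eps_sign i) => ->; rewrite ?oppr_eq0 oner_eq0.
Qed.

(** Vectors of other norms are fixed, so that isometries permute the whole column space. *)
Definition unit_action (h : 'M[F]_N) (v : 'cV[F]_N) :=
  if qf D v == 1 then h *m v else v.

(** For an isometry the required permutation exists ([unit_permE]); the default 1 makes the
    definition total on matrices. *)
Definition unit_perm (h : 'M[F]_N) : {perm 'cV[F]_N} :=
  odflt 1%g [pick p : {perm 'cV[F]_N} | [forall v, p v == unit_action h v]].

Lemma qf_isom h v : h \in isom_mx D -> qf D (h *m v) = qf D v.
Proof. by rewrite inE qfM => /eqP ->. Qed.

Lemma unit_permE h : h \in isom_mx D -> unit_perm h =1 unit_action h.
Proof.
move=> hD v; rewrite /unit_perm; case: pickP => [p /forallP /(_ v) /eqP //|].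
have inj : injective (unit_action h).
  move=> v1 v2; rewrite /unit_action; case: eqP => q1; case: eqP => q2 //.
  - exact: (can_inj (mulKmx (isom_unit eps_diag_unit hD))).
  - by move=> E; case: q2; rewrite -E qf_isom.
  - by move=> E; case: q1; rewrite E qf_isom.
move/(_ (perm inj)) => /negP[]; apply/forallP => w; rewrite permE //.
Qed.

(** The permutation is coerced to its parity, which serves as a spinor norm. *)
Definition spin_sign h : bool := unit_perm h.

Lemma spin_signM g h : g \in isom_mx D -> h \in isom_mx D ->
  spin_sign (g *m h) = spin_sign g (+) spin_sign h.
Proof.
move=> gD hD; rewrite /spin_sign [RHS]addbC -odd_permM; congr (odd_perm _).
apply/permP => v; rewrite permM !unit_permE ?isomM // /unit_action.
by have [qv|qv] := eqVneq (qf D v) 1; rewrite ?qf_isom ?qv ?eqxx ?mulmxA // (negbTE qv).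
Qed.

Lemma spin_sign1 : spin_sign 1%:M = false.
Proof.
have D1 : 1%:M \in isom_mx D by rewrite inE trmx1 mul1mx mulmx1.
by have := spin_signM D1 D1; rewrite mulmx1; case: spin_sign.
Qed.

Lemma negdiag_isom p : negdiag F N p \in isom_mx D.
Proof.
rewrite inE tr_negdiag /negdiag !mulmx_diag; apply/eqP; congr diag_mx.
by apply/rowP => i; rewrite !mxE; case: ifP; rewrite ?mulN1r ?mulrN1 ?opprK ?mul1r ?mulr1.
Qed.

Lemma negdiag_mulE p (v : 'cV[F]_N) i :
  (negdiag F N p *m v) i 0 = if p i then - v i 0 else v i 0.
Proof. by rewrite mul_diag_mx !mxE; case: ifP; rewrite ?mulN1r ?mul1r. Qed.

Lemma opp_neq (a : F) : a != 0 -> - a != a.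
Proof.
by move=> a0; rewrite eq_sym -addr_eq0 -mulr2n -mulr_natl mulf_neq0 ?two_neq0.
Qed.

(* An arbitrary choice of one element of each pair {a, -a}. *)
Definition pos (a : F) : bool := (enum_rank a < enum_rank (- a))%N.

Lemma posN a : a != 0 -> pos (- a) = ~~ pos a.
Proof.
move=> a0; rewrite /pos opprK -leqNgt [RHS]leq_eqVlt.
by rewrite val_eqE (inj_eq enum_rank_inj) (negbTE (opp_neq a0)).
Qed.

Lemma pos_neq0 a : pos a -> a != 0.
Proof. by apply: contraTneq => ->; rewrite /pos oppr0 ltnn. Qed.

(* The vectors moved by the i-th reflection r split in halves B and r B, so r is odd
   iff |B| is; and - r acts on B, fixing only the multiples of the i-th basis vector. *)
Lemma spin_sign_reflection (i : 'I_N) :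
  spin_sign (negdiag F N (pred1 (i : nat))) = (eps 0 i == 1).
Proof.
set r := negdiag F N _; have rD : r \in isom_mx D by apply: negdiag_isom.
have rr : r *m r = 1%:M by apply: negdiagK.
have rE (v : 'cV[F]_N) k : (r *m v) k 0 = if k == i then - v k 0 else v k 0.
  by rewrite /r negdiag_mulE.
have pE v : unit_perm r v = if qf D v == 1 then r *m v else v by rewrite unit_permE.
have pp : (unit_perm r * unit_perm r = 1)%g.
  apply/permP => v; rewrite permM perm1 [unit_perm r v]pE.
  by case: ifP => [qv|nqv]; rewrite pE ?nqv // qf_isom // qv mulmxA rr mul1mx.
have [m [Em Om]] := odd_perm_involution pp.
pose B := [set v : 'cV[F]_N | (qf D v == 1) && pos (v i 0)].
have mB : m = #|B|.
  apply: double_inj; rewrite -Em.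
  rewrite -[LHS](cardsID [set v : 'cV[F]_N | pos (v i 0)]) -[RHS]addnn; congr (_ + _)%N.
    apply: eq_card => v; rewrite !inE pE.
    case: ifP => [_|]; last by rewrite eqxx.
    have [pv|] := boolP (pos _); last by rewrite andbF.
    rewrite andbT; apply/eqP => /matrixP /(_ i 0); rewrite rE eqxx => /eqP.
    by rewrite (negbTE (opp_neq (pos_neq0 pv))).
  have inj : injective (mulmx r : 'cV[F]_N -> 'cV[F]_N).
    by apply: can_inj (_ : cancel _ (mulmx r)) => v; rewrite mulmxA rr mul1mx.
  rewrite -[RHS](card_imset _ inj); apply: eq_card => v; rewrite !inE pE.
  apply/andP/imsetP => [[npos] | [w]].
    case: ifP => qv; last by rewrite eqxx.
    move=> rv; exists (r *m v); last by rewrite mulmxA rr mul1mx.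
    rewrite inE qf_isom // qv rE eqxx posN //.
    apply: contraNneq rv => v0; apply/eqP/matrixP => k j; rewrite ord1 rE.
    by case: eqP => // ->; rewrite v0 oppr0.
  rewrite inE => /andP[qw pw] ->; rewrite qf_isom // qw rE eqxx posN ?pos_neq0 //.
  rewrite pw mulmxA rr mul1mx; split => //; apply/eqP => /matrixP /(_ i 0).
  by rewrite rE eqxx => /esym/eqP; rewrite (negbTE (opp_neq (pos_neq0 pw))).
rewrite /spin_sign Om mB (odd_card_involution (f := fun v => - (r *m v))); last first.
  move=> v; rewrite !inE qfN qf_isom // => /andP[-> pv].
  by rewrite mxE rE eqxx opprK pv mulmxN opprK mulmxA rr mul1mx.
pose axis a : 'cV[F]_N := a *: delta_mx i 0.
have axisE v : - (r *m v) = v -> v = axis (v i 0).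
  move=> /matrixP E; apply/matrixP => k j; rewrite ord1 !mxE eqxx andbT.
  have [->|ki] := eqVneq k i; first by rewrite mulr1.
  rewrite mulr0; apply/eqP; apply: contraT => /opp_neq.
  by have := E k 0; rewrite mxE rE (negbTE ki) => ->; rewrite eqxx.
have q_axis a : qf D (axis a) = eps 0 i * a ^+ 2.
  rewrite qf_diag (bigD1 i) //= big1 => [|k ki]; rewrite !mxE.
    by rewrite !eqxx mulr1 addr0.
  by rewrite (negbTE ki) mulr0 expr0n mulr0.
(* The vector a e_i has norm eps_i a^2. For eps_i = 1 exactly one of a = 1 and a = -1 satisfies
   [pos], so there is one fixed point; for eps_i = -1 there is none, as -1 is not a square. *)
case: (eps_sign i) => ei; rewrite ei.
  have one_pos : exists2 c : F, pos c & c ^+ 2 = 1.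
    have [p1|np1] := boolP (pos 1); first by exists 1; rewrite ?expr1n.
    by exists (-1); rewrite ?sqrrN ?expr1n // posN ?oner_eq0.
  have [c pc c2] := one_pos.
  rewrite eqxx (_ : [set _ in _ | _] = [set axis c]) ?cards1 //.
  apply/setP => v; rewrite !inE; apply/andP/eqP => [[/andP[/eqP qv pv] /eqP /axisE vE] | ->].
    move: qv pv; rewrite vE q_axis ei mul1r => /eqP; set a := v i 0.
    rewrite -c2 eqf_sqr !mxE !eqxx mulr1 => /orP[/eqP -> //|/eqP ->].
    by rewrite posN ?pos_neq0 // pc.
  rewrite q_axis ei mul1r c2 !mxE !eqxx mulr1 pc; split=> //.
  apply/eqP/matrixP => k j; rewrite ord1 mxE rE !mxE.
  by case: (k == i); rewrite ?mulr1 ?opprK // mulr0 oppr0.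
rewrite (negbTE (opp_neq (oner_neq0 _))) (_ : [set _ in _ | _] = finset.set0) ?cards0 //.
apply/setP => v; rewrite !inE; apply/negP => /andP[/andP[/eqP qv _] /eqP /axisE vE].
move: qv; rewrite vE q_axis ei mulN1r => /eqP; rewrite eqr_oppLR.
by rewrite (negbTE (sqr_neqN1 q_mod4 _)).
Qed.

Lemma spin_sign_pair (i j : 'I_N) : eps 0 i = 1 -> eps 0 j = -1 ->
  spin_sign (negdiag F N (pred2 (i : nat) (j : nat))).
Proof.
move=> ei ej; have ij : i != j.
  by apply: contra_eq_neq ei => ->; rewrite ej opp_neq ?oner_eq0.
have -> : negdiag F N (pred2 (i : nat) (j : nat)) =
    negdiag F N (pred1 (i : nat)) *m negdiag F N (pred1 (j : nat)).
  rewrite negdiagM; apply: eq_negdiag => k _ /=.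
  by have [->|//] := eqVneq k i; rewrite val_eqE (negbTE ij).
rewrite spin_signM ?negdiag_isom // !spin_sign_reflection ei ej eqxx.
by rewrite (negbTE (opp_neq (oner_neq0 _))).
Qed.

End SignOnUnitVectors.

(** * Special orthogonal groups *)

Lemma qf_inj (F : fieldType) n (A B : 'M[F]_n) : 2%:R != 0 :> F ->
  A^T = A -> B^T = B -> qf A =1 qf B -> A = B.
Proof.
move=> two0 symA symB AB; apply/eqP; rewrite -subr_eq0; apply: contraT => AB0.
have symAB : (A - B)^T = A - B by rewrite linearB /= symA symB.
have [v] := ex_qf_neq0 two0 symAB AB0.
by have := AB v; rewrite /qf mulmxBr mulmxBl !mxE => ->; rewrite subrr eqxx.
Qed.

Lemma tperm_mx_conj_diag (R : comPzRingType) n (d : 'rV[R]_n) i j :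
  tperm_mx i j *m diag_mx d *m tperm_mx i j = diag_mx (\row_k d 0 (tperm i j k)).
Proof.
rewrite /tperm_mx -row_permE -{2}[tperm i j]tpermV -col_permE.
by apply/matrixP => a b; rewrite !mxE (inj_eq perm_inj).
Qed.

Lemma mem_der1_commg (gT : finGroupType) (G : {group gT}) x y :
  x \in G -> y \in G -> [~ x, y]%g \in G^`(1)%g.
Proof. by move=> xG yG; rewrite derg1 mem_commg. Qed.

Section SpecialOrthogonal.
Variable F : finFieldType.
Hypothesis q_mod4 : #|F| = 3 %[mod 4].
Variables (k : nat) (Q : 'cV[F]_k.+1 -> F) (M : 'M[F]_k.+1) (s : bool) (t : F).
Hypothesis symM : M^T = M.
Hypothesis t0 : t != 0.
Hypothesis dM : \det M = (-1) ^+ s * t ^+ 2.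
Hypothesis QM : forall x, Q x = qf M x.
Local Notation SO := (special_isometries Q).

Let two0 : 2%:R != 0 :> F := two_neq0 q_mod4.
Let uM : M \in unitmx := gram_unit t0 dM.

Lemma isometries_isom_mx (g : {'GL_k.+1[F]}) :
  (g \in isometries Q) = (GLval g \in isom_mx M).
Proof.
rewrite !inE; apply/forallP/eqP => [gQ | gM x].
  apply: (qf_inj two0) => //; first by rewrite !trmx_mul trmxK symM mulmxA.
  by move=> v; rewrite -qfM -!QM (eqP (gQ v)).
by rewrite !QM qfM gM.
Qed.

Lemma ex_GLval (A : 'M[F]_k.+1) : A \in unitmx -> exists g : {'GL_k.+1[F]}, GLval g = A.
Proof. by move=> uA; exists (FinRing.Unit (uA : A \is a GRing.unit)). Qed.

Lemma GLval_inj : injective (@GLval k.+1 F).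
Proof. exact: val_inj. Qed.

Lemma card_isometries : #|isometries Q| = #|isom_mx M|.
Proof.
rewrite -(card_imset _ GLval_inj); apply: eq_card => A.
apply/imsetP/idP => [[g] | AM]; first by rewrite isometries_isom_mx => gM ->.
have [g gA] := ex_GLval (isom_unit uM AM).
by exists g => //; rewrite isometries_isom_mx gA.
Qed.

Lemma mem_SO (g : {'GL_k.+1[F]}) :
  (g \in SO) = (GLval g \in isom_mx M) && (\det (GLval g) == 1).
Proof. by rewrite inE isometries_isom_mx. Qed.

Definition mx_image (H : {set {'GL_k.+1[F]}}) : {set 'M[F]_k.+1} := [set GLval g | g in H].

Lemma num_invol_mx (H : {set {'GL_k.+1[F]}}) :
  num_invol H = #|[set g in mx_image H | g *m g == 1%:M]|.
Proof.
rewrite /num_invol -(card_imset _ GLval_inj); apply: eq_card => A; rewrite inE.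
have E (g : {'GL_k.+1[F]}) : (g ^+ 2 == 1)%g = (GLval g *m GLval g == 1%:M).
  by rewrite -(inj_eq GLval_inj) expgS expg1 GL_ME GL_1E.
apply/imsetP/andP => [[g] | [/imsetP[g gH ->] gg]].
  by move=> /setIdP[gH g2] ->; rewrite -E g2; split=> //; apply: imset_f.
by exists g => //; rewrite inE gH E.
Qed.

Section Subgroup.
Variable H : {group {'GL_k.+1[F]}}.
Hypothesis HSO : H \subset SO.

Lemma mx_image1 : 1%:M \in mx_image H.
Proof. by apply/imsetP; exists 1%g; rewrite ?group1 ?GL_1E. Qed.

Lemma mx_imageM g h : g \in mx_image H -> h \in mx_image H -> g *m h \in mx_image H.
Proof.
move=> /imsetP[a aH ->] /imsetP[b bH ->]; apply/imsetP; exists (a * b)%g.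
  by rewrite groupM.
by rewrite GL_ME.
Qed.

Lemma mx_image_isom g : g \in mx_image H -> g \in isom_mx M.
Proof. by move=> /imsetP[a /(fintype.subsetP HSO) aS ->]; move: aS; rewrite mem_SO => /andP[]. Qed.

Lemma mx_image_det g : g \in mx_image H -> \det g = 1.
Proof.
by move=> /imsetP[a /(fintype.subsetP HSO) aS ->]; move: aS; rewrite mem_SO => /andP[_ /eqP].
Qed.

End Subgroup.

Lemma conj_isom P (D A : 'M[F]_k.+1) : P \in unitmx -> P^T *m M *m P = D ->
  (P *m A *m invmx P \in isom_mx M) = (A \in isom_mx D).
Proof.
move=> uP PD; have E : M = (invmx P)^T *m D *m invmx P.
  by rewrite -PD -congr_mxM mulmxV // trmx1 mul1mx mulmx1.
rewrite !inE -(mulmxA P) congr_mxM PD congr_mxM [X in _ == X]E; apply/eqP/eqP => [H|-> //].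
apply: (can_inj (mulmxK (_ : invmx P \in unitmx))); first by rewrite unitmx_inv.
apply: (can_inj (mulKmx (_ : (invmx P)^T \in unitmx))); first by rewrite unitmx_tr unitmx_inv.
by move: H; rewrite !mulmxA.
Qed.

Lemma det_conj (P A : 'M[F]_k.+1) : P \in unitmx -> \det (P *m A *m invmx P) = \det A.
Proof.
move=> uP; rewrite !det_mulmx mulrAC -det_mulmx mulmxV // det1 mul1r //.
Qed.

(** The sign is a morphism to a group of order 2, so its kernel [K] in SO contains all commutators.
    Conjugation by [P] passes to diagonal coordinates, where the sign is defined. *)
Lemma derived_spin_sign P (eps : 'rV[F]_k.+1) (g : {'GL_k.+1[F]}) :
  (forall i, eps 0 i = 1 \/ eps 0 i = -1) -> P \in unitmx ->
  P^T *m M *m P = diag_mx eps -> g \in (SO)^`(1)%g ->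
  spin_sign eps (invmx P *m GLval g *m P) = false.
Proof.
move=> eps1 uP PM gder.
pose f (h : {'GL_k.+1[F]}) := invmx P *m GLval h *m P.
have fM x y : f (x * y)%g = f x *m f y by rewrite /f GL_ME !mulmxA mulmxK.
have fD h : h \in SO -> f h \in isom_mx (diag_mx eps).
  rewrite mem_SO -(conj_isom (f h) uP PM) => /andP[hM _].
  by rewrite /f !mulmxA mulmxV // mul1mx mulmxK.
pose K := [set h in SO | ~~ spin_sign eps (f h)].
have K_group : group_set K.
  apply/group_setP; split.
    apply/setIdP; split; first exact: group1.
    by rewrite /f GL_1E mulmx1 mulVmx // spin_sign1.
  move=> x y /setIdP[xS xs] /setIdP[yS ys]; apply/setIdP; split; first exact: groupM.
  by rewrite fM spin_signM ?fD // (negbTE xs) (negbTE ys).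
suff /fintype.subsetP/(_ g gder)/setIdP[_ /negbTE] : (SO)^`(1)%g \subset Group K_group by [].
rewrite gen_subG; apply/fintype.subsetP => _ /imset2P[x y xS yS ->].
have cS : [~ x, y]%g \in SO by rewrite groupR.
have E : (y * x * [~ x, y] = x * y)%g by rewrite -commgC.
have sM a b : a \in SO -> b \in SO ->
    spin_sign eps (f (a * b)%g) = spin_sign eps (f a) (+) spin_sign eps (f b).
  by move=> aS bS; rewrite fM spin_signM ?fD.
have := congr1 (fun h => spin_sign eps (f h)) E.
rewrite (sM _ _ (groupM yS xS) cS) (sM _ _ yS xS) (sM _ _ xS yS) => E'.
apply/setIdP; split=> //; move: E'.
by case: (spin_sign eps (f x)); case: (spin_sign eps (f y)); case: (spin_sign eps (f [~ x, y]%g)).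
Qed.

Lemma derived_refl_notin P (eps : 'rV[F]_k.+1) (i j : 'I_k.+1) :
  (forall i, eps 0 i = 1 \/ eps 0 i = -1) -> P \in unitmx ->
  P^T *m M *m P = diag_mx eps -> eps 0 i = 1 -> eps 0 j = -1 ->
  P *m negdiag F k.+1 (pred2 (i : nat) (j : nat)) *m invmx P \notin mx_image (SO)^`(1)%g.
Proof.
move=> eps1 uP PM ei ej; apply/imsetP => -[g gder gE].
have := derived_spin_sign eps1 uP PM gder.
by rewrite -gE !mulmxA mulVmx // mul1mx mulmxKV // spin_sign_pair.
Qed.

(* The product of the i-th and j-th reflections is the commutator of the i-th
   reflection and the transposition of the i-th and j-th basis vectors; multiplying
   both by the reflection in a third basis vector gives them determinant 1. *)
Lemma derived_refl_in P (eps : 'rV[F]_k.+1) (i j w : 'I_k.+1) :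
  (forall i, eps 0 i = 1 \/ eps 0 i = -1) -> P \in unitmx ->
  P^T *m M *m P = diag_mx eps -> i != j -> w != i -> w != j -> eps 0 i = 1 -> eps 0 j = 1 ->
  P *m negdiag F k.+1 (pred2 (i : nat) (j : nat)) *m invmx P \in mx_image (SO)^`(1)%g.
Proof.
move=> eps1 uP PM ij wi wj ei ej.
pose r (x : 'I_k.+1) := negdiag F k.+1 (pred1 (x : nat)).
pose T : 'M[F]_k.+1 := tperm_mx i j.
have rr x y : r x *m r y = r y *m r x.
  by rewrite !negdiagM; apply: eq_negdiag => a _; rewrite addbC.
have rK x : r x *m r x = 1%:M by apply: negdiagK.
have TT : T *m T = 1%:M by rewrite /T -perm_mxM tperm2 perm_mx1.
have TrT x : T *m r x *m T = r (tperm i j x).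
  rewrite /T tperm_mx_conj_diag; congr diag_mx; apply/rowP => a; rewrite !mxE /=.
  by rewrite !val_eqE -{1}[x](tpermK i j) (inj_eq perm_inj).
have TD : T \in isom_mx (diag_mx eps).
  rewrite inE /T tr_perm_mx tpermV tperm_mx_conj_diag; apply/eqP; congr diag_mx.
  by apply/rowP => a; rewrite mxE; case: tpermP => [->|->|//]; rewrite ei ej.
have Tw : T *m r w = r w *m T.
  by rewrite -{2}[w](tpermD (x := i) (y := j)) 1?eq_sym // -TrT -!mulmxA TT mulmx1.
have dr x : \det (r x) = -1.
  rewrite det_diag (bigD1 x) //= big1 ?mulr1 => [|a ax]; rewrite !mxE /= ?eqxx //.
  by rewrite val_eqE (negbTE ax).
have dT : \det T = -1 by rewrite det_perm odd_tperm ij expr1.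
have rD x : r x \in isom_mx (diag_mx eps) by apply: negdiag_isom.
have lift A : A \in isom_mx (diag_mx eps) -> \det A = 1 ->
    exists2 g, g \in SO & GLval g = P *m A *m invmx P.
  move=> AD dA; have AM : P *m A *m invmx P \in isom_mx M by rewrite (conj_isom _ uP PM).
  have [g gE] := ex_GLval (isom_unit uM AM).
  by exists g => //; rewrite mem_SO gE AM det_conj // dA eqxx.
have [||a aS aE] := lift (r i *m r w); first exact: isomM.
  by rewrite det_mulmx !dr mulrNN mulr1.
have [||b bS bE] := lift (T *m r w); first exact: isomM.
  by rewrite det_mulmx dr dT mulrNN mulr1.
have invol (g : {'GL_k.+1[F]}) A : GLval g = P *m A *m invmx P -> A *m A = 1%:M ->
    (g^-1 = g)%g.
  move=> gE AA; apply/eqP; rewrite eq_invg_mul; apply/eqP/GLval_inj.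
  rewrite GL_ME GL_1E gE; apply: etrans (esym (conj_mulmx A A uP)) _.
  by rewrite AA mulmx1 mulmxV.
have ai : (a^-1 = a)%g.
  by apply: (invol _ _ aE); rewrite -mulmxA (mulmxA (r w)) (rr w i) -(mulmxA (r i)) rK mulmx1 rK.
have bi : (b^-1 = b)%g.
  by apply: (invol _ _ bE); rewrite {1}Tw -!mulmxA (mulmxA T) TT mul1mx rK.
have cder : [~ a, b]%g \in (SO)^`(1)%g by apply: mem_der1_commg.
apply/imsetP; exists [~ a, b]%g; first exact: cder.
have cE : GLval [~ a, b]%g =
    P *m (r i *m r w *m (T *m r w *m (r i *m r w *m (T *m r w)))) *m invmx P.
  by rewrite commgEl conjgE ai bi !GL_ME aE bE !conj_mulmx.
rewrite cE; congr (_ *m _ *m _).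
have -> : negdiag F k.+1 (pred2 (i : nat) (j : nat)) = r i *m r j.
  rewrite negdiagM; apply: eq_negdiag => c _ /=.
  by have [->|//] := eqVneq c i; rewrite val_eqE (negbTE ij).
(* As a and b are involutions, [a, b] = (a b)^2. The two reflections in w cancel in a b, which
   leaves (r_i T)^2 = r_i (T r_i T) = r_i r_j. *)
have AB : r i *m r w *m (T *m r w) = r i *m T.
  by rewrite Tw -!mulmxA (mulmxA (r w)) rK mul1mx.
by rewrite (mulmxA (r i *m r w)) !AB -mulmxA (mulmxA T) TrT tpermL.
Qed.

Lemma derived_involutions (R : numFieldType) : k.+1 != 2%N ->
  (num_invol (SO)^`(1)%g)%:R / (#|isometries Q|)%:R =
  \sum_(l < (k.+1./2).+1 | class_index k.+1 s l)
     ((#|isom_mx (stdform F l.*2 false)|)%:R^-1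
      * (#|isom_mx (stdform F (k.+1 - l.*2) s)|)%:R^-1) :> R.
Proof.
move=> k2; have derS : (SO)^`(1)%g \subset SO by apply: der_sub.
rewrite num_invol_mx card_isometries.
apply: (omega_involution_ratio q_mod4 symM t0 dM).
- exact: mx_image1.
- exact: mx_imageM.
- exact: mx_image_isom.
- exact: mx_image_det.
- move=> P eps i j eps1 uP PM ij ei ej.
  (* Dimension 1 is ruled out by [i != j] and dimension 2 by hypothesis, so there is a third
     index. *)
  have [w] : exists w, w \in ~: [set i; j].
    apply/card_gt0P; have := cardsC [set i; j]; rewrite cards2 ij card_ord.
    have : k != 0%N.
      apply: contraNneq ij => k0; apply/eqP/val_inj => /=.
      by move: (ltn_ord i) (ltn_ord j); clear -k0; lia.
    by clear -k2; lia.
  rewrite !inE negb_or => /andP[wi wj].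
  exact: (derived_refl_in eps1 uP PM ij wi wj).
- move=> P eps i j eps1 uP PM ei ej.
  exact: (derived_refl_notin eps1 uP PM).
Qed.

End SpecialOrthogonal.

(** The subgroup of squares: squaring is a morphism of the abelian group [G] with kernel {1, z}, so
    its image has index 2. *)
Lemma ex_index2_subgroup (gT : finGroupType) (G : {group gT}) z :
  abelian G -> z \in G -> z != 1%g -> (z ^+ 2 = 1)%g ->
  (forall x, x \in G -> (x ^+ 2 = 1)%g -> x = 1%g \/ x = z) ->
  exists H : {group gT}, (H \subset G) && (#|G : H|%g == 2%N).
Proof.
move=> abG zG z1 zz roots; pose K := [set (x ^+ 2)%g | x in G].
have sqM x y : x \in G -> y \in G -> ((x * y) ^+ 2 = x ^+ 2 * y ^+ 2)%g.
  by move=> xG yG; apply: expgMn; apply: (centsP abG).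
have K_group : group_set K.
  apply/group_setP; split; first by apply/imsetP; exists 1%g; rewrite ?expg1n.
  move=> _ _ /imsetP[x xG ->] /imsetP[y yG ->]; rewrite -sqM //.
  by apply: imset_f; rewrite groupM.
have KG : Group K_group \subset G.
  by apply/fintype.subsetP => _ /imsetP[x xG ->]; rewrite groupX.
exists (Group K_group); rewrite KG -divgS //=.
rewrite (@card_const_fibers _ _ G K (fun x => (x ^+ 2)%g) 2).
- by rewrite mulKn //; apply/card_gt0P; exists 1%g; apply: (group1 (Group K_group)).
- by move=> x xG; apply: imset_f.
move=> _ /imsetP[x xG ->].
rewrite (_ : [set _ in _ | _] = [set x; (x * z)%g]); last first.
  apply/setP => y; rewrite !inE; apply/andP/orP => [[yG /eqP yx] | [/eqP -> | /eqP ->]].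
  - have xyG : (x^-1 * y)%g \in G by rewrite groupM ?groupV.
    have [||E|E] := roots (x^-1 * y)%g => //.
    + by rewrite sqM ?groupV // yx expgVn mulVg.
    + by left; apply/eqP; rewrite -[y](mulKVg x) E mulg1.
    + by right; apply/eqP; rewrite -[y](mulKVg x) E.
  - by rewrite xG.
  by rewrite groupM // sqM // zz mulg1.
by rewrite cards2 -{1}[x]mulg1 (inj_eq (mulgI x)) eq_sym z1.
Qed.

(** * Dimension 2: rotations and the index 2 subgroup *)

Section Plane.
Variable F : finFieldType.
Hypothesis q_mod4 : #|F| = 3 %[mod 4].
Variable s : bool.
Local Notation d := ((-1) ^+ s : F).

(** Multiplication by a + c w on F[w], where w^2 = -d, in the basis (1, w). *)
Definition rot2 (a c : F) : 'M[F]_2 :=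
  \matrix_(i, j) (if i == j then a else if i == 0 then - (d * c) else c).

Lemma ord2P (k : 'I_2) : k = 0 \/ k = 1.
Proof. by case: k => -[|[|//]] Hk; [left | right]; apply: val_inj. Qed.

Lemma mx2P (A B : 'M[F]_2) : A 0 0 = B 0 0 -> A 0 1 = B 0 1 ->
  A 1 0 = B 1 0 -> A 1 1 = B 1 1 -> A = B.
Proof.
move=> E00 E01 E10 E11; apply/matrixP => i j.
by case: (ord2P i) => ->; case: (ord2P j) => ->.
Qed.

Lemma mulmx2E (A B : 'M[F]_2) i j : (A *m B) i j = A i 0 * B 0 j + A i 1 * B 1 j.
Proof.
rewrite mxE !big_ord_recl big_ord0 addr0 (_ : lift 0 0 = 1) //; exact: val_inj.
Qed.

Lemma det_mx2 (A : 'M[F]_2) : \det A = A 0 0 * A 1 1 - A 0 1 * A 1 0.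
Proof.
rewrite (expand_det_row _ 0) !big_ord_recl big_ord0 addr0 /cofactor !det_mx11 !mxE /=.
have l0 : lift 0 0 = 1 :> 'I_2 by exact: val_inj.
have l1 : lift 1 0 = 0 :> 'I_2 by exact: val_inj.
by rewrite !l0 l1 expr0 expr1; ring.
Qed.

Lemma rot2M a c a' c' : rot2 a c *m rot2 a' c' = rot2 (a * a' - d * c * c') (a * c' + c * a').
Proof. by apply: mx2P; rewrite mulmx2E !mxE /=; ring. Qed.

Lemma stdform2E i j : stdform F 2 s i j = if i == j then (if i == 0 then 1 else d) else 0.
Proof.
by case: (ord2P i) => ->; case: (ord2P j) => ->; rewrite !mxE.
Qed.

Lemma rot2_isom (a c : F) : a ^+ 2 + d * c ^+ 2 = 1 ->
  rot2 a c \in isom_mx (stdform F 2 s) /\ \det (rot2 a c) = 1.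
Proof.
move=> E; split.
  rewrite inE; apply/eqP; apply: mx2P; rewrite !mulmx2E !stdform2E /= !mxE /=.
  - transitivity (a ^+ 2 + d * c ^+ 2); [ring | exact: E].
  - ring.
  - ring.
  - transitivity (d * (a ^+ 2 + d * c ^+ 2)); first by ring.
    by rewrite E mulr1.
by rewrite det_mx2 !mxE /=; transitivity (a ^+ 2 + d * c ^+ 2); [ring | exact: E].
Qed.

(** Orthogonality of the columns and determinant 1 are two linear equations for the second column;
    their determinant is the norm a^2 + d c^2 = 1 of the first. *)
Lemma special_isom2P (h : 'M[F]_2) :
  reflect (h = rot2 (h 0 0) (h 1 0) /\ h 0 0 ^+ 2 + d * h 1 0 ^+ 2 = 1)
    ((h \in isom_mx (stdform F 2 s)) && (\det h == 1)).
Proof.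
apply: (iffP andP) => [[] | [hE E]]; last first.
  by have [] := rot2_isom E; rewrite -hE => hD /eqP.
  rewrite inE => /eqP hD /eqP; rewrite det_mx2.
  move/matrixP: hD => hD; have := hD 0 0; have := hD 0 1; rewrite !mulmx2E !stdform2E /= !mxE.
  set a := h 0 0; set b := h 0 1; set c := h 1 0; set e := h 1 1.
  rewrite !(mulr0, addr0, add0r, mulr1) => E01 E00 dh.
  have N : a ^+ 2 + d * c ^+ 2 = 1 by apply: etrans E00; ring.
  split=> //; apply: mx2P; rewrite mxE //= -?/a -?/b -?/c -?/e.
    transitivity (b * (a ^+ 2 + d * c ^+ 2)); first by rewrite N mulr1.
    transitivity (a * (a * b + c * d * e) - d * c * (a * e - b * c)); first by ring.
    by rewrite E01 dh; ring.
  transitivity (e * (a ^+ 2 + d * c ^+ 2)); first by rewrite N mulr1.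
  transitivity (a * (a * e - b * c) + c * (a * b + c * d * e)); first by ring.
  by rewrite E01 dh; ring.
Qed.

Lemma rot2_sqr1 a c : a ^+ 2 + d * c ^+ 2 = 1 -> rot2 a c *m rot2 a c = 1%:M ->
  rot2 a c = 1%:M \/ rot2 a c = (-1)%:M.
Proof.
move=> N /matrixP /(_ 0 0); rewrite rot2M !mxE /= mulr1n => E.
have c0 : c = 0.
  have : 2%:R * (d * c ^+ 2) = 0.
    transitivity (a ^+ 2 + d * c ^+ 2 - (a * a - d * c * c)); first by ring.
    by rewrite N E subrr.
  move/eqP; rewrite !mulf_eq0 (negbTE (two_neq0 q_mod4)) signr_eq0 /=.
  by rewrite orbb => /eqP.
move: N; rewrite c0 expr0n mulr0 addr0 => /eqP; rewrite sqrf_eq1.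
case/orP => /eqP ->; [left | right]; apply: mx2P;
  by rewrite !mxE /= ?mulr0 ?oppr0.
Qed.

End Plane.

Section Index2.
Variable F : finFieldType.
Hypothesis q_mod4 : #|F| = 3 %[mod 4].
Variables (Q : 'cV[F]_2 -> F) (M : 'M[F]_2) (s : bool) (t : F).
Hypothesis symM : M^T = M.
Hypothesis t0 : t != 0.
Hypothesis dM : \det M = (-1) ^+ s * t ^+ 2.
Hypothesis QM : forall x, Q x = qf M x.
Local Notation SO := (special_isometries_group Q).
Local Notation d := ((-1) ^+ s : F).

Lemma SO2_rotations : exists2 P, P \in unitmx &
  forall g : {'GL_2[F]}, g \in SO <->
    exists a c, a ^+ 2 + d * c ^+ 2 = 1 /\ GLval g = P *m rot2 s a c *m invmx P.
Proof.
have [P [uP PM]] := classify_det q_mod4 symM t0 dM; exists P => // g.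
pose h := invmx P *m GLval g *m P.
have gh : GLval g = P *m h *m invmx P by rewrite /h !mulmxA mulmxV // mul1mx mulmxK.
have E : (g \in SO) = (h \in isom_mx (stdform F 2 s)) && (\det h == 1).
  by rewrite (mem_SO q_mod4 symM QM) gh (conj_isom _ uP PM) det_conj.
rewrite E; split.
  by case/special_isom2P => hE N; exists (h 0 0), (h 1 0); rewrite -hE.
case=> a [c [N gE]]; apply/special_isom2P.
have -> : h = rot2 s a c by rewrite /h gE !mulmxA mulVmx // mul1mx mulmxKV.
by rewrite !mxE.
Qed.

(** A rotation is determined by its first column, an arbitrary unit vector of the standard plane. *)
Lemma card_SO2 : #|SO| = (if s then #|F|.-1 else #|F|.+1).
Proof.
have [P uP rotP] := SO2_rotations.
have -> : #|SO| = nrep (stdform F 2 s).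
  pose phi (v : 'cV[F]_2) := P *m rot2 s (v 0 0) (v 1 0) *m invmx P.
  have inj : injective phi.
    move=> v w /(can_inj (mulmxK (_ : invmx P \in unitmx))).
    rewrite unitmx_inv => /(_ uP) /(can_inj (mulKmx uP)) /matrixP E.
    apply/matrixP => i j; rewrite ord1; have := E 0 0; have := E 1 0; rewrite !mxE /=.
    by case: (ord2P i) => ->.
  have qv (v : 'cV[F]_2) : qf (stdform F 2 s) v = v 0 0 ^+ 2 + d * v 1 0 ^+ 2.
    rewrite qf_diag !big_ord_recl big_ord0 !mxE /= mul1r addr0.
    by rewrite (_ : lift 0 0 = 1) //; apply: val_inj.
  rewrite /nrep -[RHS](card_imset _ inj) -(card_imset _ (@GLval_inj F 1)); apply: eq_card => A.
  apply/imsetP/imsetP => [[g /rotP[a [c [N gE]]] ->] | [v]].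
    exists (\col_i (if i == 0 then a else c)); first by rewrite inE qv !mxE N.
    by rewrite /phi !mxE /=.
  rewrite inE qv => /eqP N ->.
  have uA : phi v \in unitmx.
    have [hD _] := rot2_isom N; rewrite /phi !unitmx_mul unitmx_inv uP andbT /=.
    exact: isom_unit (stdform_unit _ _ _) hD.
  have [g gE] := @ex_GLval F 1 _ uA.
  by exists g => //; apply/rotP; exists (v 0 0), (v 1 0).
case: s.
  rewrite nrep_stdform_hyp // /nrep eq_card0 ?muln0 ?addn0 ?muln1 // => v.
  by rewrite inE /qf !mxE big_ord0 eq_sym oner_eq0.
exact: nrep_stdform20.
Qed.

Lemma abelian_SO2 : abelian SO.
Proof.
have [P uP rotP] := SO2_rotations.
apply/centsP => x /rotP[a [c [_ xE]]] y /rotP[a' [c' [_ yE]]].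
apply: GLval_inj; rewrite !GL_ME xE yE.
apply: etrans (esym (conj_mulmx _ _ uP)) (etrans _ (conj_mulmx _ _ uP)).
by rewrite !rot2M; congr (_ *m rot2 _ _ _ *m _); ring.
Qed.

Lemma SO2_sqr1 (x : {'GL_2[F]}) : x \in SO -> (x ^+ 2 = 1)%g ->
  x = 1%g \/ GLval x = (-1)%:M.
Proof.
have [P uP rotP] := SO2_rotations.
move=> /rotP[a [c [N xE]]] /(congr1 (@GLval 2 F)).
rewrite expgS expg1 GL_ME GL_1E {1 2}xE => xx.
have : rot2 s a c *m rot2 s a c = 1%:M.
  have := etrans (conj_mulmx (rot2 s a c) (rot2 s a c) uP) xx.
  move/(congr1 (fun A => invmx P *m A *m P)).
  by rewrite !mulmxA mulVmx // mul1mx mulmxKV // mulmx1 mulVmx.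
case/(rot2_sqr1 q_mod4 N) => E; [left | right].
  by apply: GLval_inj; rewrite xE E mulmx1 mulmxV // GL_1E.
by rewrite xE E mul_mx_scalar -scalemxAl mulmxV // scalemx1.
Qed.

Lemma ex_opp_SO2 : exists2 z : {'GL_2[F]}, z \in SO & GLval z = (-1)%:M.
Proof.
have [P uP rotP] := SO2_rotations.
have uN : ((-1)%:M : 'M[F]_2) \in unitmx by rewrite unitmxE det_scalar sqrrN expr1n unitr1.
have [z zE] := @ex_GLval F 1 (-1)%:M uN.
exists z => //; apply/rotP; exists (-1), 0; split; first by rewrite sqrrN expr1n expr0n mulr0 addr0.
have -> : rot2 s (-1) 0 = (-1)%:M :> 'M[F]_2.
  by apply: mx2P; rewrite !mxE /= ?mulr0 ?oppr0.
by rewrite zE mul_mx_scalar -scalemxAl mulmxV // scalemx1.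
Qed.

(** The only involution of SO is -1, so it lies in the subgroup iff the latter has even order.
    Modulo 4, the order of SO is q + 1 = 0 for [s] false and q - 1 = 2 for [s] true. *)
Lemma index2_opp : (((-1)%:M : 'M[F]_2) \in mx_image (index2_subgroup SO)) = ~~ s.
Proof.
have [z zS zE] := ex_opp_SO2.
have N1 : (-1)%:M != 1%:M :> 'M[F]_2.
  apply/eqP => /matrixP /(_ 0 0) /eqP; rewrite !mxE /= mulr1n eq_sym -subr_eq0 opprK.
  by rewrite -mulr2n (negbTE (two_neq0 q_mod4)).
have z1 : z != 1%g by apply: contraNneq N1 => z1; rewrite -zE z1 GL_1E.
have zz : (z ^+ 2 = 1)%g.
  apply: GLval_inj; rewrite expgS expg1 GL_ME GL_1E zE.
  by apply: etrans (esym (scalar_mxM _ _ _)) _; rewrite mulrNN mulr1.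
have oz : #[z]%g = 2%N by apply: nt_prime_order.
have roots x : x \in SO -> (x ^+ 2 = 1)%g -> x = 1%g \/ x = z.
  move=> xS /(SO2_sqr1 xS)[->|E]; [by left | right].
  by apply: GLval_inj; rewrite E zE.
have -> : (((-1)%:M : 'M[F]_2) \in mx_image (index2_subgroup SO)) = (z \in index2_subgroup SO).
  rewrite -zE; apply/imsetP/idP => [[x xH /GLval_inj -> //] | zH].
  by exists z.
rewrite /index2_subgroup; case: pickP => [H /andP[HS /eqP iH] | none] /=; last first.
  have [H HS] := ex_index2_subgroup abelian_SO2 zS z1 zz roots.
  by have := none H; rewrite HS.
have qE := card_field_mod4 q_mod4.
have := Lagrange HS; rewrite iH card_SO2; case: s => cH /=.
  apply/negbTE/negP => zH; have := order_dvdG zH; rewrite oz => dv.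
  move: cH; rewrite -(divnK dv) qE; clear; lia.
have ev : (2 %| #|H|)%N by apply/dvdnP; exists (#|F| %/ 4 + 1)%N; move: cH qE; clear; lia.
have [x xH ox] := Cauchy (isT : prime 2) ev.
have x2 : (x ^+ 2 = 1)%g by have := expg_order x; rewrite ox.
have [x1|<- //] := roots x (fintype.subsetP HS x xH) x2.
by move: ox; rewrite x1 order1.
Qed.

Lemma index2_involutions (R : numFieldType) :
  (num_invol (index2_subgroup SO))%:R / (#|isometries Q|)%:R =
  \sum_(l < 2 | class_index 2 s l)
     ((#|isom_mx (stdform F l.*2 false)|)%:R^-1
      * (#|isom_mx (stdform F (2 - l.*2) s)|)%:R^-1) :> R.
Proof.
have HS : index2_subgroup SO \subset SO.
  rewrite /index2_subgroup; case: pickP => [H /andP[] // | _ /=]; exact: sub1G.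
rewrite num_invol_mx (card_isometries q_mod4 symM t0 dM QM).
have negE (P : 'M[F]_2) (i j : 'I_2) : P \in unitmx -> i != j ->
    P *m negdiag F 2 (pred2 (i : nat) (j : nat)) *m invmx P = (-1)%:M.
  move=> uP ij; have -> : negdiag F 2 (pred2 (i : nat) (j : nat)) = (-1)%:M.
    apply/matrixP => a b; rewrite !mxE /= (_ : (a == i :> nat) || (a == j :> nat)) //.
    rewrite !val_eqE; move: ij.
    by case: (ord2P a) => ->; case: (ord2P i) => ->; case: (ord2P j) => ->.
  by rewrite mul_mx_scalar -scalemxAl mulmxV // scalemx1.
(* In dimension 2 the norms 1 and (-1)^b of an orthogonal basis already determine [s]. *)
have sE (P : 'M[F]_2) (eps : 'rV[F]_2) (i j : 'I_2) (b : bool) : P \in unitmx -> i != j ->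
    P^T *m M *m P = diag_mx eps -> eps 0 i = 1 -> eps 0 j = (-1) ^+ b -> s = b.
  move=> uP ij PM ei ej; have dP : \det P != 0 by rewrite -unitfE -unitmxE.
  apply: (signF_inj q_mod4 (x := t * \det P) (y := 1)); first by rewrite mulf_neq0.
  rewrite exprMn mulrA -dM -det_congr PM det_diag expr1n mulr1 (bigD1 i) //=.
  rewrite (bigD1 j) 1?eq_sym //= big1 ?ei ?ej ?mul1r ?mulr1 // => c.
  move: ij; case: (ord2P c) => ->; case: (ord2P i) => ->; case: (ord2P j) => ->;
    by rewrite ?eqxx //= ?andbF.
apply: (omega_involution_ratio q_mod4 symM t0 dM).
- exact: mx_image1.
- exact: mx_imageM.
- exact: (mx_image_isom q_mod4 symM QM HS).
- exact: (mx_image_det q_mod4 symM QM HS).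
- move=> P eps i j _ uP PM ij ei ej; rewrite negE // index2_opp.
  by rewrite (sE P eps i j false).
move=> P eps i j _ uP PM ei ej.
have ij : i != j.
  by apply: contra_eq_neq ei => ->; rewrite ej opp_neq ?oner_eq0.
by rewrite negE // index2_opp (sE P eps i j true).
Qed.

End Index2.

(** * Coefficients of the generating functions *)

Section Weights.
Variables (R : fieldType) (Q : R).

Definition qpoch k : R := \prod_(i < k) (1 - Q^-1 ^+ i.+1.*2).

(* x^((k-l)^2/2) / ((x;x)_k (x;x)_l) with x = Q^-2, without subtraction on nat. *)
Definition weight k l : R :=
  Q ^+ ((k + l) ^ 2) * Q^-1 ^+ (2 * k ^ 2 + 2 * l ^ 2) / (qpoch k * qpoch l).

Definition wsum (a b : R) n : R :=
  \sum_(k < n.+1) a ^+ k * b ^+ (n - k) * weight k (n - k).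

(* 1 / |O(2k)|, with the convention 1 / |O^-(0)| = 0. *)
Definition inv_even k (s : bool) : R :=
  (Q ^+ k + (-1) ^+ (k + s)) * Q^-1 ^+ (2 * k ^ 2) / (2%:R * qpoch k).

Definition inv_odd l : R := Q^-1 ^+ (2 * l ^ 2 + l) / (2%:R * qpoch l).

Hypothesis Q0 : Q != 0.

Lemma prod_pow_sub1 m : \prod_(i < m) (Q ^+ i.+1.*2 - 1) = Q ^+ (m * m.+1) * qpoch m.
Proof.
elim: m => [|m IH]; first by rewrite /qpoch !big_ord0 mulr1.
rewrite /qpoch !big_ord_recr /= IH -/(qpoch m).
have -> : (m.+1 * m.+2 = m * m.+1 + m.+1.*2)%N by rewrite -mul2n; ring.
rewrite exprD; transitivity (Q ^+ (m * m.+1) * qpoch m * (Q ^+ m.+1.*2 * (1 - Q^-1 ^+ m.+1.*2))).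
  by congr (_ * _); rewrite mulrBr mulr1 exprVn mulfV // expf_neq0.
by ring.
Qed.

End Weights.

Section CardInverse.
Variables (R : numFieldType) (F : finFieldType).
Hypothesis q_mod4 : #|F| = 3 %[mod 4].
Local Notation Q := (#|F|%:R : R).

Lemma card_gt2 : (2 < #|F|)%N.
Proof. by rewrite (card_field_mod4 q_mod4); lia. Qed.

Lemma Q_gt1 : 1 < Q.
Proof. by rewrite ltr1n (ltn_trans _ card_gt2). Qed.

Lemma Q_neq0 : Q != 0.
Proof. by rewrite gt_eqF // (lt_trans _ Q_gt1). Qed.

Lemma qpoch_neq0 k : qpoch Q k != 0.
Proof.
apply/prodf_neq0 => i _; rewrite subr_eq0 eq_sym lt_eqF // exprVn invf_lt1.
  by rewrite exprn_egt1 ?Q_gt1.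
by rewrite exprn_gt0 // (lt_trans _ Q_gt1).
Qed.

Lemma card_isom_stdform0 (s : bool) : #|isom_mx (stdform F 0 s)| = 1%N.
Proof.
rewrite -(card1 (0 : 'M[F]_0)); apply: eq_card => g; rewrite !inE.
by rewrite [g]flatmx0 [X in _ == X]flatmx0 [X in X == _]flatmx0 !eqxx.
Qed.

(** The order contains Q^k - (-1)^(k+s); multiplying by Q^k + (-1)^(k+s) completes it to Q^(2k) - 1
    and so to [qpoch]. For [k = 0] and [s] true, [inv_even] is 0 by convention although the empty
    form has one isometry. *)
Lemma card_isom_evenV k (s : bool) : (k == 0%N) ==> ~~ s ->
  (#|isom_mx (stdform F k.*2 s)|)%:R^-1 = inv_even Q k s.
Proof.
have Q0 := Q_neq0; have p0 := qpoch_neq0.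
have two : 2%:R != 0 :> R by rewrite pnatr_eq0.
case: k => [|m] /= ks.
  rewrite card_isom_stdform0 (negbTE ks) /inv_even /qpoch big_ord0 !expr0 !mulr1 invr1.
  by rewrite -[1 + 1]/(2%:R) mulfV.
have := (card_isom_stdformE q_mod4 R m s).2; rewrite -doubleS => cE.
apply: (mulfI (_ : #|isom_mx (stdform F m.+1.*2 s)|%:R != 0)).
  rewrite pnatr_eq0 -lt0n; apply/card_gt0P; exists 1%:M.
  by rewrite inE trmx1 mul1mx mulmx1.
rewrite mulfV; last first.
  rewrite pnatr_eq0 -lt0n; apply/card_gt0P; exists 1%:M.
  by rewrite inE trmx1 mul1mx mulmx1.
rewrite cE /inv_even addSn [(-1) ^+ (m + s).+1]exprS mulN1r.
set e := (-1) ^+ (m + s).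
have ee : e * e = 1 by rewrite -exprD addnn -signr_odd odd_double.
have P : (Q ^+ m.+1 + e) * (Q ^+ m.+1 - e) = Q ^+ m.+1.*2 - 1.
  rewrite -addnn exprD; set x := Q ^+ m.+1.
  by transitivity (x * x - e * e); [ring | rewrite ee].
have P' : \prod_(i < m) (Q ^+ i.+1.*2 - 1) * (Q ^+ m.+1.*2 - 1) = Q ^+ (m.+1 * m.+2) * qpoch Q m.+1.
  by rewrite -prod_pow_sub1 // big_ord_recr.
transitivity (Q ^+ (m ^ 2 + m) * (\prod_(i < m) (Q ^+ i.+1.*2 - 1) *
    ((Q ^+ m.+1 + e) * (Q ^+ m.+1 - e))) * Q^-1 ^+ (2 * m.+1 ^ 2) / qpoch Q m.+1).
  rewrite P P' mulrA -exprD (_ : m ^ 2 + m + m.+1 * m.+2 = 2 * m.+1 ^ 2)%N; last by ring.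
  have := expf_neq0 (2 * m.+1 ^ 2) Q0; rewrite exprVn; move: (Q ^+ _) => K K0.
  by rewrite mulrAC mulfK // mulfV.
by field; rewrite ?p0 ?two.
Qed.

Lemma card_isom_oddV l (s : bool) :
  (#|isom_mx (stdform F l.*2.+1 s)|)%:R^-1 = inv_odd Q l.
Proof.
have Q0 := Q_neq0; have p0 := qpoch_neq0.
have two : 2%:R != 0 :> R by rewrite pnatr_eq0.
rewrite (card_isom_stdformE q_mod4 R l s).1 prod_pow_sub1 // /inv_odd.
rewrite -mulrA [Q ^+ (l ^ 2) * _]mulrA -exprD.
rewrite (_ : l ^ 2 + l * l.+1 = 2 * l ^ 2 + l)%N; last by ring.
by rewrite exprVn; field; rewrite ?p0 ?two ?expf_neq0.
Qed.

Lemma even_sum n (s : bool) :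
  \sum_(l < (n.*2./2).+1 | class_index n.*2 s l)
     ((#|isom_mx (stdform F l.*2 false)|)%:R^-1
      * (#|isom_mx (stdform F (n.*2 - l.*2) s)|)%:R^-1) =
  \sum_(l < n.+1) inv_even Q l false * inv_even Q (n - l) s.
Proof.
rewrite doubleK big_mkcond; apply: eq_bigr => l _; have ln : (l <= n)%N by rewrite -ltnS.
rewrite /class_index leq_double ln (inj_eq double_inj) -doubleB.
rewrite (card_isom_evenV (s := false)) ?implybT //.
case: (boolP (_ ==> _)) => [ls | ].
  by rewrite card_isom_evenV // subn_eq0 leqNgt ltn_neqAle ln andbT negbK.
(* The term that [class_index] omits vanishes on the right, by the convention for O^-(0). *)
rewrite negb_imply negbK => /andP[/eqP -> ->]; rewrite subnn.
by rewrite /inv_even !expr0 add0n expr1 subrr !mul0r mulr0.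
Qed.

Lemma odd_sum n (s : bool) :
  \sum_(l < (n.*2.+1./2).+1 | class_index n.*2.+1 s l)
     ((#|isom_mx (stdform F l.*2 false)|)%:R^-1
      * (#|isom_mx (stdform F (n.*2.+1 - l.*2) s)|)%:R^-1) =
  \sum_(l < n.+1) inv_even Q l false * inv_odd Q (n - l).
Proof.
rewrite /= uphalf_double big_mkcond; apply: eq_bigr => l _; have ln : (l <= n)%N by rewrite -ltnS.
have l2 : (l.*2 <= n.*2)%N by rewrite leq_double.
rewrite /class_index ltnW ?ltnS // ltn_eqF ?ltnS //=.
by rewrite card_isom_evenV ?implybT // subSn // -doubleB card_isom_oddV.
Qed.

End CardInverse.

Section Combine.
Variables (R : numFieldType) (F : finFieldType).
Hypothesis q_mod4 : #|F| = 3 %[mod 4].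
Local Notation Q := (#|F|%:R : R).

Lemma signX_add l k (s : bool) : (-1) ^+ (k + (odd (l + k) (+) s)) = (-1) ^+ s * (-1) ^+ l :> R.
Proof.
rewrite -[LHS]signr_odd -[(-1) ^+ l]signr_odd -signr_addb oddD oddb oddD.
by case: (odd l); case: (odd k); case: s.
Qed.

(** The product of Q^l + (-1)^l and Q^k + (-1)^s (-1)^l has four terms. Each is absorbed, as a
    factor Q or -1 of the arguments, into u^l and u^k. *)
Lemma even_wsum n (s : bool) (u : R) :
  (\sum_(l < n.+1) inv_even Q l false * inv_even Q (n - l) (odd n (+) s))
    * Q ^+ (n ^ 2) * u ^+ n =
  4%:R^-1 * (wsum Q (u * Q) (u * Q) n + wsum Q (- u) (u * Q) n
             + (-1) ^+ s * wsum Q (- u * Q) u n + (-1) ^+ s * wsum Q u u n).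
Proof.
rewrite /wsum !big_distrr /= -!big_split /= -mulrA mulr_suml mulr_sumr.
apply: eq_bigr => l _; have ln : (l <= n)%N by rewrite -ltnS.
move: (subnKC ln); move: (n - l)%N => k; move: (nat_of_ord l) => {l ln} l <-.
rewrite /inv_even /weight signX_add addn0 [u ^+ (l + k)]exprD -(mulN1r u) !exprMn.
rewrite (exprD Q^-1 (2 * l ^ 2) (2 * k ^ 2)).
have p0 := qpoch_neq0 R q_mod4.
have ss : (-1) ^+ l * (-1) ^+ l = 1 :> R by rewrite -exprD addnn -signr_odd odd_double.
set e := (-1) ^+ l in ss *; set N := Q ^+ (_ ^ 2); set c := (-1) ^+ s.
set A := Q^-1 ^+ (2 * l ^ 2); set B := Q^-1 ^+ _.
transitivity (4%:R^-1 * (Q ^+ l * Q ^+ k + e * Q ^+ k + c * e * Q ^+ l + c * (e * e)) * (A * B * N)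
  / (qpoch Q l * qpoch Q k) * (u ^+ l * u ^+ k)); last by rewrite ss; ring.
by field; rewrite ?p0 //.
Qed.

(** Only the even-dimensional factor has two terms; the power [Q^-1 ^+ k] of the other one turns its
    argument into [u / Q]. *)
Lemma odd_wsum n (u : R) :
  (\sum_(l < n.+1) inv_even Q l false * inv_odd Q (n - l)) * Q ^+ (n ^ 2) * u ^+ n =
  4%:R^-1 * (wsum Q (u * Q) (u / Q) n + wsum Q (- u) (u / Q) n).
Proof.
rewrite /wsum -!big_split /= -mulrA mulr_suml mulr_sumr.
apply: eq_bigr => l _; have ln : (l <= n)%N by rewrite -ltnS.
move: (subnKC ln); move: (n - l)%N => k; move: (nat_of_ord l) => {l ln} l <-.
rewrite /inv_even /inv_odd /weight addn0 [u ^+ (l + k)]exprD -(mulN1r u) !exprMn.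
rewrite (exprD Q^-1 (2 * l ^ 2) (2 * k ^ 2)) (exprD Q^-1 (2 * k ^ 2) k).
have p0 := qpoch_neq0 R q_mod4.
set e := (-1) ^+ l; set N := Q ^+ (_ ^ 2).
set A := Q^-1 ^+ (2 * l ^ 2); set B := Q^-1 ^+ (2 * k ^ 2); set D := Q^-1 ^+ k.
by field; rewrite ?p0 //.
Qed.

End Combine.

(** * Gram matrices of the three forms and the coefficients of the series *)

Section FormRatios.
Variable F : finFieldType.
Hypothesis q_mod4 : #|F| = 3 %[mod 4].

(** Indexing by nat allows shifts of coordinates between dimensions without casts of ordinals. *)
Definition atn n (x : 'cV[F]_n) (j : nat) : F := oapp (fun i => x i 0) 0 (insub j).

Lemma atn_ord n (x : 'cV[F]_n) (i : 'I_n) : atn x i = x i 0.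
Proof. by rewrite /atn valK. Qed.

Lemma atn_dsubmx n (x : 'cV[F]_(2 + n)) j : atn (dsubmx x) j = atn x (2 + j).
Proof.
rewrite /atn; case: insubP => [i _ ij | jn] /=.
  rewrite mxE -ij -[(2 + i)%N]/(val (rshift 2 i)) valK //.
by rewrite insubF //= ltn_add2l; apply: negbTE.
Qed.

Lemma coord_atE k (x : 'cV[F]_k.+1) j : (j < k.+1)%N -> coord_at x j = atn x j.
Proof. by move=> jk; rewrite /coord_at -(atn_ord x (inord j)) inordK. Qed.

Definition has_gram n (s : bool) (Q : 'cV[F]_n -> F) : Prop := exists (M : 'M[F]_n) t,
  [/\ M^T = M, t != 0, \det M = (-1) ^+ s * t ^+ 2 & forall x, Q x = qf M x].

(** [B] takes a coordinate function, so that the same form can be read behind the hyperbolic planes.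
    Each plane flips the sign, which gives [odd n]. *)
Lemma add_hyperbolic n r (s : bool) (B : (nat -> F) -> F) :
  has_gram s (fun x : 'cV[F]_r => B (atn x)) -> forall N, N = (n.*2 + r)%N ->
  has_gram (odd n (+) s) (fun x : 'cV[F]_N =>
    \sum_(i < n) atn x i.*2 * atn x i.*2.+1 + B (fun j => atn x (n.*2 + j))).
Proof.
move=> HB; elim: n => [|n IH] N NE.
  rewrite NE; case: HB => M [t [symM t0 dM QM]]; exists M, t; split=> // x.
  by rewrite big_ord0 add0r -QM.
have [M [t [symM t0 dM QM]]] := IH _ erefl.
have two0 := two_neq0 q_mod4.
rewrite NE; pose M' : 'M[F]_(2 + (n.*2 + r)) := block_mx (hyp2 F) 0 0 M.
have symM' : M'^T = M' by rewrite /M' tr_block_mx !trmx0 tr_hyp2 symM.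
have dM' : \det M' = (-1) ^+ (odd n.+1 (+) s) * (2%:R^-1 * t) ^+ 2.
  rewrite /M' det_ublock det_hyp2 dM exprMn /=.
  by case: (odd n); case: (s); rewrite /= ?expr0 ?expr1; ring.
exists M', (2%:R^-1 * t); split=> //; first by rewrite mulf_neq0 ?invr_eq0.
have QM' (x : 'cV[F]_(2 + (n.*2 + r))) :
    qf M' x = usubmx x 0 0 * usubmx x 1 0 + qf M (dsubmx x).
  by rewrite -[X in qf M' X]vsubmxK /M' qf_block qf_hyp2.
move=> x; rewrite (QM' x) -QM big_ord_recl -addrA; congr (_ * _ + (_ + _)).
- by rewrite mxE -atn_ord.
- by rewrite mxE -atn_ord.
- by apply: eq_bigr => i _; rewrite !atn_dsubmx.
by congr B; apply/funext => j; rewrite atn_dsubmx.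
Qed.

Lemma has_gram_ext n s (Q Q' : 'cV[F]_n -> F) : Q =1 Q' -> has_gram s Q -> has_gram s Q'.
Proof. by move=> E [M [t [? ? ? QM]]]; exists M, t; split=> // x; rewrite -E. Qed.

Lemma hyperbolicE k n (x : 'cV[F]_k.+1) : (n.*2 <= k.+1)%N ->
  hyperbolic n x = \sum_(i < n) atn x i.*2 * atn x i.*2.+1.
Proof.
move=> nk; apply: eq_bigr => i _; have ilt := ltn_ord i.
by rewrite !coord_atE //; clear -ilt nk; lia.
Qed.

Lemma qform_plus_gram m : has_gram (odd m.+1) (@qform_plus F m).
Proof.
have H0 : has_gram false (fun x : 'cV[F]_0 => (fun=> 0 : F) (atn x)).
  exists 0, 1; split; rewrite ?oner_neq0 ?trmx0 ?det_mx00 ?expr1n ?mulr1 //.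
  by move=> x; rewrite /qf mulmx0 mul0mx mxE.
have := @add_hyperbolic m.+1 0 false (fun=> 0) H0 m.*2.+2 _; rewrite addn0 addbF => /(_ erefl).
by apply: has_gram_ext => x; rewrite addr0 /qform_plus hyperbolicE.
Qed.

Lemma qform_minus_gram (delta : F) m : (forall x, x ^+ 2 != delta) ->
  has_gram (odd m) (@qform_minus F delta m).
Proof.
move=> nsq; have d0 : delta != 0 by have := nsq 0; rewrite expr0n eq_sym.
(* A nonsquare is minus a square here, so x^2 - delta y^2 has a square determinant. *)
have [t [t0 dE]] : exists t, t != 0 /\ - delta = t ^+ 2.
  have [[] [t [t0 E]]] := sqr_or_opp_sqr q_mod4 d0.
    by exists t; rewrite E expr1 mulN1r opprK.
  by have := nsq t; rewrite E expr0 mul1r eqxx.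
have H0 : has_gram false (fun x : 'cV[F]_2 =>
    (fun c : nat -> F => c 0%N ^+ 2 - delta * c 1%N ^+ 2) (atn x)).
  exists (diag_mx (\row_i (if i == 0 then 1 else - delta))), t; split => //.
  - exact: tr_diag_mx.
  - by rewrite det_diag !big_ord_recl big_ord0 !mxE /= expr0 !mul1r mulr1.
  move=> x; rewrite qf_diag !big_ord_recl big_ord0 !mxE /= mul1r addr0 -!atn_ord.
  by rewrite mulNr.
have := @add_hyperbolic m 2 false (fun c => c 0%N ^+ 2 - delta * c 1%N ^+ 2) H0 m.*2.+2
  (esym (addn2 _)); rewrite addbF.
apply: has_gram_ext => x; rewrite /qform_minus hyperbolicE 1?ltnW ?ltnS ?leqnSn //.
by rewrite !coord_atE // addn0 addn1 addrA.
Qed.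

Lemma qform_odd_gram n : has_gram (odd n) (@qform_odd F n).
Proof.
have H0 : has_gram false (fun x : 'cV[F]_1 => (fun c : nat -> F => c 0%N ^+ 2) (atn x)).
  exists 1%:M, 1; split; rewrite ?oner_neq0 ?trmx1 ?det1 ?expr1n ?mulr1 //.
  by move=> x; rewrite qf_scalar mul1r -atn_ord.
have := @add_hyperbolic n 1 false (fun c => c 0%N ^+ 2) H0 n.*2.+1 (esym (addn1 _)); rewrite addbF.
by apply: has_gram_ext => x; rewrite /qform_odd hyperbolicE // coord_atE // addn0.
Qed.

Variable R : numFieldType.
Local Notation Q := (#|F|%:R : R).

Lemma omega_even_ratio m s (q : 'cV[F]_(m.*2.+2) -> F) : has_gram s q ->
  (num_invol (Omega_even q))%:R / (#|isometries q|)%:R =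
  \sum_(l < m.+2) inv_even Q l false * inv_even Q (m.+1 - l) s.
Proof.
case=> M [t [symM t0 dM QM]]; rewrite -(even_sum R q_mod4 m.+1 s) /Omega_even.
case: m q M t symM t0 dM QM => [|m] q M t symM t0 dM QM /=.
  exact: (index2_involutions q_mod4 symM t0 dM QM).
exact: (derived_involutions q_mod4 symM t0 dM QM).
Qed.

Lemma ratio_plusE n (u : R) :
  ratio_plus R F n * Q ^+ (n ^ 2) * u ^+ n =
  4%:R^-1 * (wsum Q (u * Q) (u * Q) n + wsum Q (- u) (u * Q) n
             + wsum Q (- u * Q) u n + wsum Q u u n).
Proof.
rewrite -[wsum Q (- u * Q) u n]mul1r -[wsum Q u u n]mul1r -(even_wsum q_mod4 n false).
congr (_ * _ * _); case: n => [|m] /=.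
  by rewrite big_ord1 /= -!card_isom_evenV // card_isom_stdform0 invr1 mulr1.
by rewrite (omega_even_ratio (qform_plus_gram m)) addbF.
Qed.

Lemma ratio_minusE (delta : F) n (u : R) : (forall x, x ^+ 2 != delta) ->
  ratio_minus R delta n * Q ^+ (n ^ 2) * u ^+ n =
  4%:R^-1 * (wsum Q (u * Q) (u * Q) n + wsum Q (- u) (u * Q) n
             - wsum Q (- u * Q) u n - wsum Q u u n).
Proof.
move=> nsq; rewrite -[- wsum Q (- u * Q) u n]mulN1r -[- wsum Q u u n]mulN1r.
have := even_wsum q_mod4 n true u; rewrite expr1 => <-.
congr (_ * _ * _); case: n => [|m] /=.
  by rewrite big_ord1 /inv_even /= !expr0 expr1 subrr !mul0r mulr0.
by rewrite (omega_even_ratio (qform_minus_gram m nsq)) addbT negbK.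
Qed.

Lemma ratio_oddE n (u : R) :
  ratio_odd R F n * Q ^+ (n ^ 2) * u ^+ n =
  4%:R^-1 * (wsum Q (u * Q) (u / Q) n + wsum Q (- u) (u / Q) n).
Proof.
rewrite -(odd_wsum q_mod4); congr (_ * _ * _).
have [M [t [symM t0 dM QM]]] := qform_odd_gram n.
rewrite -(odd_sum R q_mod4 n (odd n)) /ratio_odd /Omega_odd.
by apply: (derived_involutions q_mod4 symM t0 dM QM); apply/eqP; lia.
Qed.

End FormRatios.

(** * Complex series and products *)

Import numFieldNormedType.Exports.

Section ComplexLimits.
Variable R : realType.
Local Notation C := R[i].
Local Open Scope classical_set_scope.
Local Open Scope complex_scope.
Local Notation Re := (@complex.Re R).
Local Notation Im := (@complex.Im R).

Definition tends (u : nat -> C) (l : C) : Prop := (u : nat -> C^o) @ \oo --> (l : C^o).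

(** The modulus as an element of [R], since the norm of [R[i]] takes its values in [R[i]]. *)
Definition absc (z : C) : R := Re `|z|.

Lemma normE (z : C) : `|z| = (absc z)%:C.
Proof. by rewrite /absc RRe_real // normr_real. Qed.

Lemma real_complex_le (x y : R) : (x%:C <= y%:C) = (x <= y).
Proof. by rewrite lecE /= eqxx. Qed.

Lemma real_complex_lt (x y : R) : (x%:C < y%:C) = (x < y).
Proof. by rewrite ltcE /= eqxx. Qed.

Lemma absc_ge0 z : 0 <= absc z.
Proof. by rewrite -real_complex_le -normE normr_ge0. Qed.

Lemma abscM z w : absc (z * w) = absc z * absc w.
Proof. by apply: (@complexI R); rewrite rmorphM /= -!normE normrM. Qed.

Lemma absc_real (x : R) : absc x%:C = `|x|.
Proof. by rewrite /absc normc_def /= expr0n /= addr0 sqrtr_sqr. Qed.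

Lemma absc1 : absc 1 = 1.
Proof. by have := absc_real 1; rewrite normr1. Qed.

Lemma abscX z n : absc (z ^+ n) = absc z ^+ n.
Proof. by elim: n => [|n IH]; rewrite ?absc1 // !exprS abscM IH. Qed.

Lemma ler_abscD z w : absc (z + w) <= absc z + absc w.
Proof. by rewrite -real_complex_le rmorphD /= -!normE ler_normD. Qed.

Lemma abscN z : absc (- z) = absc z.
Proof. by apply: (@complexI R); rewrite -!normE normrN. Qed.

Lemma absc0 : absc 0 = 0.
Proof. by have := absc_real 0; rewrite normr0. Qed.

Lemma ler_absc_sum (u : nat -> C) n : absc (\sum_(i < n) u i) <= \sum_(i < n) absc (u i).
Proof.
elim: n => [|n IH]; first by rewrite !big_ord0 absc0.
by rewrite !big_ord_recr /= (le_trans (ler_abscD _ _)) // lerD2r.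
Qed.

Lemma absc_le_ReIm (a b : R) : absc (a +i* b) <= `|a| + `|b|.
Proof.
rewrite [a +i* b]complexE /= (le_trans (ler_abscD _ _)) // abscM !absc_real lerD2l.
by rewrite /absc normc_def /= expr0n /= add0r expr1n sqrtr1 mul1r.
Qed.

Lemma Re_le_absc (z : C) : `|Re z| <= absc z.
Proof. by rewrite -real_complex_le -normE normc_ge_Re. Qed.

Lemma Im_le_absc (z : C) : `|Im z| <= absc z.
Proof.
case: z => a b; rewrite /absc normc_def /= -sqrtr_sqr ler_wsqrtr //.
by rewrite lerDr sqr_ge0.
Qed.

Lemma tendsP u l : tends u l <->
  forall e : R, 0 < e -> exists N, forall n, (N <= n)%N -> absc (l - u n) < e.
Proof.
rewrite /tends; split => [/cvgrPdist_lt ul e e0 | H].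
  have e0' : (0 : C) < e%:C by rewrite real_complex_lt.
  have [N _ HN] := ul _ e0'; exists N => n Nn.
  by rewrite -real_complex_lt -normE; apply: HN.
apply/cvgrPdist_lt => e e0.
have eE : e = (Re e)%:C by rewrite RRe_real // gtr0_real.
have e0' : 0 < Re e by rewrite -real_complex_lt -eE.
have [N HN] := H _ e0'; exists N => // n Nn /=.
by rewrite eE normE real_complex_lt; apply: HN.
Qed.

Lemma tends_uniq u l l' : tends u l -> tends u l' -> l = l'.
Proof. by apply: cvg_unique => //; exact: norm_hausdorff. Qed.

Lemma tendsM u v l m : tends u l -> tends v m -> tends (fun n => u n * v n) (l * m).
Proof. exact: cvgM. Qed.

Lemma tendsD u v l m : tends u l -> tends v m -> tends (fun n => u n + v n) (l + m).
Proof. exact: cvgD. Qed.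

Lemma tends_cst c : tends (fun=> c) c.
Proof. exact: cvg_cst. Qed.

Lemma tends_sub u l (f : nat -> nat) : (forall n, (n <= f n)%N) ->
  tends u l -> tends (fun n => u (f n)) l.
Proof.
move=> fn /tendsP ul; apply/tendsP => e /ul[N HN]; exists N => n Nn.
by apply: HN; apply: leq_trans (fn n).
Qed.

Lemma tends_ext u v l : u =1 v -> tends u l -> tends v l.
Proof. by move=> /funext ->. Qed.

Lemma tends_ReIm u (a b : R) : (Re \o u) @ \oo --> a -> (Im \o u) @ \oo --> b ->
  tends u (a +i* b).
Proof.
move=> /cvgrPdist_lt ua /cvgrPdist_lt ub; apply/tendsP => e e0.
have e2 : 0 < e / 2%:R by rewrite divr_gt0.
have [N1 _ H1] := ua _ e2; have [N2 _ H2] := ub _ e2.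
exists (maxn N1 N2) => n; rewrite geq_max => /andP[n1 n2].
have := H1 n n1; have := H2 n n2; rewrite /=; case: (u n) => x y /= hb ha.
apply: le_lt_trans (absc_le_ReIm (a - x) (b - y)) _.
by rewrite (splitr e) ltrD.
Qed.

Lemma real_series_cvg (u v : nat -> R) (K : R) : (forall n, `|u n| <= v n) ->
  (forall n, \sum_(i < n) v i <= K) -> cvgn (series u).
Proof.
move=> uv vK; have v0 n : 0 <= v n by apply: le_trans (uv n).
apply: normed_cvg; apply: (@series_le_cvg _ _ v) => //.
  by move=> n /=; rewrite normr_ge0.
apply: nondecreasing_is_cvgn; first exact: nondecreasing_series.
by exists K => _ [n _ <-]; rewrite /series /= big_mkord.
Qed.

Lemma complex_series_cvg (u : nat -> C) (v : nat -> R) (K : R) :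
  (forall n, absc (u n) <= v n) -> (forall n, \sum_(i < n) v i <= K) ->
  exists l, tends (fun n => \sum_(i < n) u i) l.
Proof.
move=> uv vK.
have /cvg_ex[a ha] : cvgn (series (fun n => Re (u n))).
  by apply: (@real_series_cvg _ v K) => // n; apply: le_trans (Re_le_absc _) (uv n).
have /cvg_ex[b hb] : cvgn (series (fun n => Im (u n))).
  by apply: (@real_series_cvg _ v K) => // n; apply: le_trans (Im_le_absc _) (uv n).
exists (a +i* b); apply: tends_ReIm.
  apply: cvg_trans ha; apply: near_eq_cvg; near=> n => /=.
  by rewrite /series /= big_mkord raddf_sum.
apply: cvg_trans hb; apply: near_eq_cvg; near=> n => /=.
by rewrite /series /= big_mkord raddf_sum.
Unshelve. all: by end_near.
Qed.

Lemma geometric_sum_le (r : R) n : 0 <= r -> r < 1 -> \sum_(i < n) r ^+ i <= (1 - r)^-1.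
Proof.
move=> r0 r1; have r1' : 0 < 1 - r by rewrite subr_gt0.
rewrite -[leRHS]mul1r ler_pdivlMr // mulrC -opprB mulNr -subrX1 opprB.
by rewrite lerBlDr lerDl exprn_ge0.
Qed.

Lemma weighted_geometric_sum_le (r : R) n : 0 <= r -> r < 1 ->
  \sum_(i < n) i.+1%:R * r ^+ i <= ((1 - r) ^+ 2)^-1.
Proof.
move=> r0 r1; have r1' : 0 < (1 - r) ^+ 2 by rewrite exprn_gt0 // subr_gt0.
rewrite -[leRHS]mul1r ler_pdivlMr //.
have -> : (\sum_(i < n) i.+1%:R * r ^+ i) * (1 - r) ^+ 2
    = 1 - n.+1%:R * r ^+ n + n%:R * r ^+ n.+1.
  elim: n => [|n IH]; first by rewrite big_ord0 mul0r mul1r expr0 subrr mul0r addr0.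
  by rewrite big_ord_recr /= mulrDl IH -!natr1 !exprS; ring.
rewrite -addrA gerDl addrC subr_le0 exprS mulrA ler_wpM2r ?exprn_ge0 //.
by rewrite -natr1 (le_trans (ler_piMr _ (ltW r1))) ?ler0n // lerDl.
Qed.

(** The partial products are bounded by the exponential of a geometric sum, so their successive
    differences [p i * c i] are summable. *)
Lemma cvg_infprod (c : nat -> C) (K r : R) : 0 <= K -> 0 <= r -> r < 1 ->
  (forall n, absc (c n) <= K * r ^+ n) ->
  exists l, tends (fun n => \prod_(i < n) (1 + c i)) l.
Proof.
move=> K0 r0 r1 cK; pose p n := \prod_(i < n) (1 + c i).
have bound n : absc (p n) <= expR (K / (1 - r)).
  have : absc (p n) <= expR (\sum_(i < n) K * r ^+ i).
    elim: n => [|n IH]; first by rewrite /p !big_ord0 absc1 expR0.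
    rewrite /p !big_ord_recr /= abscM expRD ler_pM ?absc_ge0 //.
    rewrite (le_trans (ler_abscD _ _)) // absc1.
    by apply: le_trans (expR_ge1Dx _); rewrite lerD2l.
  move/le_trans; apply; rewrite ler_expR -mulr_sumr ler_wpM2l //.
  exact: geometric_sum_le.
set B := expR _ in bound.
have B0 : 0 <= B by apply: expR_ge0.
have [l hl] : exists l, tends (fun n => \sum_(i < n) (p i * c i)) l.
  apply: (@complex_series_cvg (fun i => p i * c i) (fun n => B * (K * r ^+ n))
    (B * (K * (1 - r)^-1))).
    by move=> n; rewrite abscM ler_pM ?absc_ge0.
  move=> n; rewrite -!mulr_sumr !ler_wpM2l //; exact: geometric_sum_le.
exists (1 + l); apply: (tends_ext _ (tendsD (@tends_cst 1) hl)) => n /=.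
elim: n => [|n IH]; first by rewrite !big_ord0 addr0.
by rewrite !big_ord_recr /= addrA IH mulrDr mulr1.
Qed.

(** The inverse factors are again of the form 1 + d with d decaying geometrically, so their product
    converges too, and the two limits multiply to 1. *)
Lemma infprod_neq0 (c : nat -> C) (K r l : _) : 0 <= K -> 0 <= r -> r < 1 ->
  (forall n, absc (c n) <= K * r ^+ n) -> (forall n, absc (c n) <= r) ->
  tends (fun n => \prod_(i < n) (1 + c i)) l -> l != 0.
Proof.
move=> K0 r0 r1 cK cr hl; have r1' : 0 < 1 - r by rewrite subr_gt0.
have low n : 1 - r <= absc (1 + c n).
  have := ler_abscD (1 + c n) (- c n); rewrite addrK absc1 abscN.
  by have := cr n; lra.
have c0 n : 1 + c n != 0.
  by apply: contraTneq (low n) => ->; rewrite absc0 -ltNge.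
pose d n := - c n / (1 + c n).
have dE n : 1 + d n = (1 + c n)^-1 by rewrite /d; field; apply: c0.
have [l' hl'] : exists l', tends (fun n => \prod_(i < n) (1 + d i)) l'.
  apply: (@cvg_infprod d (K / (1 - r)) r) => //.
    by rewrite divr_ge0 // ltW.
  move=> n; have dn : absc (d n) * absc (1 + c n) = absc (c n).
    by rewrite -abscM /d mulfVK // abscN.
  have := cK n; rewrite -dn => H; rewrite mulrAC ler_pdivlMr //.
  by apply: le_trans H; rewrite ler_wpM2l ?absc_ge0.
have E1 : (fun n => \prod_(i < n) (1 + c i) * \prod_(i < n) (1 + d i)) =1 fun=> 1.
  move=> n; rewrite -big_split big1 //= => i _.
  by rewrite dE mulfV.
have ll := tends_uniq (tends_ext E1 (tendsM hl hl')) (@tends_cst 1).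
by apply/eqP => l0; move/eqP: ll; rewrite l0 mul0r eq_sym oner_eq0.
Qed.

End ComplexLimits.

(** * The sum of the series *)

Section WsumRecurrence.
Variables (R : fieldType) (Q : R).
Hypothesis Q0 : Q != 0.
Hypothesis qpoch0 : forall k, qpoch Q k != 0.
Local Notation y := (Q^-1).

(** Reduces identities between powers of Q to equations in nat without subtraction. *)
Lemma powVM m n m' n' : (m + n' = m' + n)%N -> y ^+ m * Q ^+ n = y ^+ m' * Q ^+ n'.
Proof.
move=> E; apply: (mulIf (expf_neq0 (m + m') Q0)).
have yQ k l : y ^+ k * Q ^+ (k + l) = Q ^+ l.
  by rewrite exprD mulrA -exprMn mulVf // expr1n mul1r.
rewrite -!mulrA -!exprD (_ : n + (m + m') = m + (m' + n))%N; last by lia.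
by rewrite (_ : n' + (m + m') = m' + (m + n'))%N ?yQ ?E //; lia.
Qed.

Lemma qpochS k : qpoch Q k.+1 = qpoch Q k * (1 - y ^+ k.+1.*2).
Proof. by rewrite /qpoch big_ord_recr. Qed.

Lemma one_sub_pow_neq0 k : 1 - y ^+ k.+1.*2 != 0.
Proof. by have := qpoch0 k.+1; rewrite qpochS mulf_eq0 negb_or => /andP[]. Qed.

(** The left side is x^((k-l)^2/2) / ((x;x)_k (x;x)_(l+1)), and the terms on the right are this
    times 1 - x^(l+1) and x^(l+1). *)
Lemma weightSS k l : weight Q k.+1 l.+1 * (1 - y ^+ k.+1.*2) =
  weight Q k l + y ^+ k.*2.+1 * weight Q k l.+1.
Proof.
rewrite /weight !qpochS; have pk := qpoch0 k; have pl := qpoch0 l.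
have qk := one_sub_pow_neq0 k; have ql := one_sub_pow_neq0 l.
set N := Q ^+ ((k + l) ^ 2) * y ^+ (2 * k ^ 2 + 2 * l ^ 2).
have E1 : Q ^+ ((k.+1 + l.+1) ^ 2) * y ^+ (2 * k.+1 ^ 2 + 2 * l.+1 ^ 2) = N.
  by rewrite /N [LHS]mulrC [RHS]mulrC; apply: powVM; ring.
have E2 : y ^+ k.*2.+1 * (Q ^+ ((k + l.+1) ^ 2) * y ^+ (2 * k ^ 2 + 2 * l.+1 ^ 2)) =
    y ^+ l.+1.*2 * N.
  rewrite /N ![Q ^+ _ * y ^+ _]mulrC !mulrA -!exprD; apply: powVM.
  by rewrite -!mul2n; ring.
rewrite E1 [y ^+ k.*2.+1 * _]mulrA E2.
by field; rewrite pk pl qk ql.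
Qed.

Lemma weightS0 k : weight Q k.+1 0 * (1 - y ^+ k.+1.*2) = y ^+ k.*2.+1 * weight Q k 0.
Proof.
rewrite /weight !qpochS; have pk := qpoch0 k; have p0 := qpoch0 0.
have qk := one_sub_pow_neq0 k.
have E : Q ^+ ((k.+1 + 0) ^ 2) * y ^+ (2 * k.+1 ^ 2 + 2 * 0 ^ 2) =
    y ^+ k.*2.+1 * (Q ^+ ((k + 0) ^ 2) * y ^+ (2 * k ^ 2 + 2 * 0 ^ 2)).
  rewrite ![Q ^+ _ * y ^+ _]mulrC !mulrA -!exprD; apply: powVM.
  by rewrite -!mul2n; ring.
rewrite [y ^+ k.*2.+1 * _]mulrA -E.
by field; rewrite pk p0 qk.
Qed.

Lemma weight00 : weight Q 0 0 = 1.
Proof.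
rewrite -[LHS]/(Q ^+ 0 * y ^+ 0 / (qpoch Q 0 * qpoch Q 0)) /qpoch !big_ord0.
by rewrite !expr0 !mulr1 divr1.
Qed.

Lemma weightC k l : weight Q k l = weight Q l k.
Proof. by rewrite /weight addnC [(2 * k ^ 2 + _)%N]addnC [qpoch Q k * _]mulrC. Qed.

Lemma wsumC a b n : wsum Q a b n = wsum Q b a n.
Proof.
rewrite /wsum (reindex_inj rev_ord_inj); apply: eq_bigr => k _ /=.
have kn : (k <= n)%N by rewrite -ltnS.
by rewrite !subSS subKn // weightC [a ^+ _ * _]mulrC.
Qed.

Lemma wsum0 a b : wsum Q a b 0 = 1.
Proof. by rewrite /wsum big_ord1 /= weight00 !expr0 !mulr1. Qed.

Lemma wsum_sub a b n : wsum Q a b n.+1 - wsum Q (a * y ^+ 2) b n.+1 =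
  \sum_(k < n.+1) a ^+ k.+1 * b ^+ (n - k) * (weight Q k.+1 (n - k) * (1 - y ^+ k.+1.*2)).
Proof.
rewrite /wsum -sumrB big_ord_recl /= !expr0 subrr add0r; apply: eq_bigr => k _.
rewrite /bump leq0n add1n subSS exprMn -[y ^+ 2 ^+ _]exprM mul2n; ring.
Qed.

Lemma wsum1 a b : wsum Q a b 1 = wsum Q (a * y ^+ 2) b 1 + a * y * wsum Q (a * y ^+ 2) b 0.
Proof.
apply/eqP; rewrite -subr_eq0 opprD addrA wsum_sub big_ord1 /= weightS0 weight00 wsum0.
by apply/eqP; rewrite !expr1 expr0; ring.
Qed.

(** The part of degree n + 2 of S(a, b) = a b S(a, b) + (1 + a x^(1/2)) S(a x, b), with [y] for
    x^(1/2). *)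
Lemma wsumSS a b n : wsum Q a b n.+2 = a * b * wsum Q a b n
  + (wsum Q (a * y ^+ 2) b n.+2 + a * y * wsum Q (a * y ^+ 2) b n.+1).
Proof.
have E : wsum Q a b n.+2 - wsum Q (a * y ^+ 2) b n.+2 =
    a * b * wsum Q a b n + a * y * wsum Q (a * y ^+ 2) b n.+1.
  rewrite wsum_sub big_ord_recr /= subnn weightS0.
  have -> : wsum Q (a * y ^+ 2) b n.+1 =
      \sum_(k < n.+1) (a * y ^+ 2) ^+ k * b ^+ (n.+1 - k) * weight Q k (n.+1 - k)
      + (a * y ^+ 2) ^+ n.+1 * b ^+ 0 * weight Q n.+1 0.
    by rewrite /wsum big_ord_recr /= subnn.
  rewrite mulrDr addrA; congr (_ + _).
    rewrite !mulr_sumr -big_split /=; apply: eq_bigr => k _.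
    have kn : (k <= n)%N by rewrite -ltnS.
    rewrite subSn // weightSS exprMn -[y ^+ 2 ^+ _]exprM mul2n !exprS; ring.
  by rewrite exprMn -[y ^+ 2 ^+ _]exprM mul2n !exprS; ring.
by rewrite addrCA -E addrCA subrr addr0.
Qed.

(** The shifts in degree become different ranges of partial sums, which do not affect the limits. *)
Lemma partial_wsum_rec a b n : \sum_(i < n.+2) wsum Q a b i =
  a * b * \sum_(i < n) wsum Q a b i
  + (\sum_(i < n.+2) wsum Q (a * y ^+ 2) b i
     + a * y * \sum_(i < n.+1) wsum Q (a * y ^+ 2) b i).
Proof.
pose T c N := \sum_(i < N) wsum Q c b i; set a' := a * y ^+ 2.
have TS c N : T c N.+1 = T c N + wsum Q c b N by rewrite /T big_ord_recr.
rewrite -!/(T _ _); elim: n => [|n IH].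
  by rewrite !TS /T !big_ord0 !add0r !wsum0 wsum1 wsum0; ring.
by rewrite [LHS]TS IH wsumSS (TS a n) (TS a' n.+2) (TS a' n.+1) -/a'; ring.
Qed.

Lemma wsum_scale a b c n : wsum Q (a * c) (b * c) n = c ^+ n * wsum Q a b n.
Proof.
rewrite /wsum mulr_sumr; apply: eq_bigr => k _; have kn : (k <= n)%N by rewrite -ltnS.
have -> : c ^+ n = c ^+ k * c ^+ (n - k) by rewrite -exprD subnKC.
by rewrite !exprMn; ring.
Qed.

End WsumRecurrence.

(** * Convergence of S(a, b) and its product formula *)

Section WsumLimit.
Variables (R : realType) (F : finFieldType).
Hypothesis q_mod4 : #|F| = 3 %[mod 4].
Local Notation C := R[i].
Local Notation Q := (#|F|%:R : C).
Local Notation y := (Q^-1).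
Local Notation qR := (#|F|%:R : R).

Let Q0 : Q != 0 := Q_neq0 C q_mod4.
Let qpoch0 : forall k, qpoch Q k != 0 := qpoch_neq0 C q_mod4.

Lemma absc_Q : absc Q = qR.
Proof.
have -> : Q = (qR)%:C%C by rewrite rmorph_nat.
by rewrite absc_real ger0_norm ?ler0n.
Qed.

Lemma qR_ge3 : 3%:R <= qR.
Proof. by rewrite ler_nat card_gt2. Qed.

Lemma absc_y : absc y = qR^-1.
Proof.
have q0 : qR != 0 by have := qR_ge3; apply: contraTneq => ->; rewrite -ltNge ltr0n.
by apply: (mulfI q0); rewrite mulfV // -absc_Q -abscM mulfV // absc1.
Qed.

Lemma absc_y_ge0 : 0 <= absc y. Proof. exact: absc_ge0. Qed.

Lemma absc_y_le : absc y <= 3%:R^-1.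
Proof.
have q0 : 0 < qR by apply: lt_le_trans qR_ge3; rewrite ltr0n.
by rewrite absc_y lef_pV2 ?posrE // qR_ge3.
Qed.

Lemma absc_qpoch_ge k : 2%:R^-1 <= absc (qpoch Q k).
Proof.
have Y0 := absc_y_ge0; have Y1 := absc_y_le.
set X := absc y ^+ 2; have X0 : 0 <= X by rewrite exprn_ge0.
have X1 : X <= 9%:R^-1.
  rewrite (_ : 9%:R^-1 = 3%:R^-1 ^+ 2 :> R); first by rewrite lerXn2r ?nnegrE ?invr_ge0.
  by rewrite exprVn -natrX.
(* Strengthened for the induction: the term X^k / 2 pays for the factor 1 - X^(k+1), since X is at
   most 1/9. *)
suff : 2%:R^-1 + X ^+ k / 2%:R <= absc (qpoch Q k).
  by apply: le_trans; rewrite lerDl divr_ge0 ?exprn_ge0.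
elim: k => [|k IH]; first by rewrite /qpoch big_ord0 absc1 expr0; lra.
rewrite qpochS abscM.
have t0 : 0 <= X ^+ k by rewrite exprn_ge0.
have t1 : X ^+ k <= 1 by rewrite exprn_ile1 //; apply: le_trans X1 _; lra.
have low : 1 - X ^+ k * X <= absc (1 - y ^+ k.+1.*2).
  have ax : absc (y ^+ k.+1.*2) = X ^+ k * X.
    by rewrite -mul2n exprM !abscX -/X exprSr.
  have := ler_abscD (1 - y ^+ k.+1.*2) (y ^+ k.+1.*2); rewrite subrK absc1 ax.
  by rewrite lerBlDr.
apply: le_trans (_ : (2%:R^-1 + X ^+ k / 2%:R) * (1 - X ^+ k * X) <= _).
  by rewrite exprSr; move: (X ^+ k) t0 t1 => t t0 t1; nra.
apply: ler_pM => //; first by rewrite addr_ge0 ?divr_ge0 ?invr_ge0.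
by move: (X ^+ k) t0 t1 => t t0 t1; nra.
Qed.

(* |a| may exceed 1: it is x^((k-l)^2/2) that makes the double series converge. *)
Definition dominated (a b : C) (r : R) : Prop := forall k l,
  absc a ^+ k * absc b ^+ l * (qR ^+ ((k + l) ^ 2) * qR^-1 ^+ (2 * k ^ 2 + 2 * l ^ 2))
    <= r ^+ (k + l).

(** There are n + 1 terms, and 4 bounds the product of the two inverse [qpoch], each at most 2. *)
Lemma absc_wsum_le a b r n : dominated a b r ->
  absc (wsum Q a b n) <= 4%:R * (n.+1%:R * r ^+ n).
Proof.
move=> dom; rewrite /wsum.
apply: le_trans (ler_absc_sum (fun k => a ^+ k * b ^+ (n - k) * weight Q k (n - k)) n.+1) _.
apply: le_trans (_ : \sum_(i < n.+1) 4%:R * r ^+ n <= _); last first.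
  by rewrite sumr_const card_ord -[leLHS]mulr_natl mulrCA.
apply: ler_sum => k _; have kn : (k <= n)%N by rewrite -ltnS.
have := dom k (n - k)%N; rewrite subnKC // => dk.
rewrite /weight !abscM !abscX subnKC // absc_Q absc_y mulrA.
have inv2 m : absc (qpoch Q m)^-1 <= 2%:R.
  have p0 := absc_qpoch_ge m.
  have p1 : 0 < absc (qpoch Q m) by apply: lt_le_trans p0; rewrite invr_gt0.
  rewrite -(ler_pM2r p1) -abscM mulVf // absc1.
  by move: p0; move: (absc _) => z; lra.
rewrite invfM abscM [4%:R * _]mulrC; apply: ler_pM => //.
- by rewrite !mulr_ge0 ?exprn_ge0 ?absc_ge0 ?invr_ge0 ?ler0n.
- by rewrite mulr_ge0 ?absc_ge0.
by rewrite -[4%:R]/((2 * 2)%:R) natrM ler_pM ?absc_ge0.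
Qed.

Lemma dominated_scale a b r c d : absc c <= 1 -> absc d <= 1 ->
  dominated a b r -> dominated (a * c) (b * d) r.
Proof.
move=> c1 d1 dom k l; apply: le_trans (dom k l).
rewrite !abscM !exprMn ler_wpM2r ?mulr_ge0 ?exprn_ge0 ?invr_ge0 ?ler0n //.
apply: ler_pM; rewrite ?mulr_ge0 ?exprn_ge0 ?absc_ge0 //.
  by rewrite ler_piMr ?exprn_ge0 ?absc_ge0 // exprn_ile1 ?absc_ge0.
by rewrite ler_piMr ?exprn_ge0 ?absc_ge0 // exprn_ile1 ?absc_ge0.
Qed.

Section Limit.
Variables (a b : C) (r : R).
Hypotheses (r0 : 0 <= r) (r1 : r < 1) (dom : dominated a b r).
Let K := 4%:R * ((1 - r) ^+ 2)^-1.

Lemma wsum_bound_sum n : \sum_(i < n) 4%:R * (i.+1%:R * r ^+ i) <= K.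
Proof. by rewrite -mulr_sumr ler_wpM2l // weighted_geometric_sum_le. Qed.

Lemma wsum_series_cvg c d : absc c <= 1 -> absc d <= 1 ->
  exists l, tends (fun n => \sum_(i < n) wsum Q (a * c) (b * d) i) l.
Proof.
move=> c1 d1; apply: (complex_series_cvg _ wsum_bound_sum) => n.
exact: absc_wsum_le (dominated_scale c1 d1 dom).
Qed.

(** By homogeneity the part of degree i carries c^i, so everything except the constant term 1 has a
    factor c. *)
Lemma wsum_series_scaled_near1 c l : absc c <= 1 ->
  tends (fun n => \sum_(i < n) wsum Q (a * c) (b * c) i) l -> absc (l - 1) <= absc c * K.
Proof.
move=> c1 /tendsP hl.
have part n : absc (\sum_(i < n.+1) wsum Q (a * c) (b * c) i - 1) <= absc c * K.
  rewrite big_ord_recl wsum0 addrAC subrr add0r.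
  apply: le_trans (ler_absc_sum (fun i => wsum Q (a * c) (b * c) i.+1) n) _.
  apply: le_trans (_ : \sum_(i < n) absc c * (4%:R * (i.+2%:R * r ^+ i.+1)) <= _).
    apply: ler_sum => i _; rewrite wsum_scale abscM; apply: ler_pM; rewrite ?absc_ge0 //.
      by rewrite abscX exprS ler_piMr ?absc_ge0 // exprn_ile1 ?absc_ge0.
    exact: absc_wsum_le.
  rewrite -mulr_sumr ler_wpM2l ?absc_ge0 //; apply: le_trans (wsum_bound_sum n.+1).
  by rewrite [leRHS]big_ord_recl /= lerDr !mulr_ge0 ?ler0n ?exprn_ge0.
apply/ler_addgt0Pr => e e0; have [N HN] := hl e e0.
have := HN N.+1 (leqnSn N); have := part N; set T := \sum_(i < _) _ => h1 h2.
rewrite (_ : l - 1 = (T - 1) + (l - T)); last by ring.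
by apply: le_trans (ler_abscD _ _) _; rewrite lerD // ltW.
Qed.

End Limit.

Lemma tends_shift (u : nat -> C) l k : tends u l -> tends (fun n => u (n + k)%N) l.
Proof. by apply: tends_sub => n; apply: leq_addr. Qed.

Lemma wsum_limit_rec a b l l' :
  tends (fun n => \sum_(i < n) wsum Q a b i) l ->
  tends (fun n => \sum_(i < n) wsum Q (a * y ^+ 2) b i) l' ->
  l * (1 - a * b) = (1 + a * y) * l'.
Proof.
move=> hl hl'.
have H1 := tends_shift 2 hl.
have H2 := tendsD (tendsM (@tends_cst R (a * b)) hl)
  (tendsD (tends_shift 2 hl') (tendsM (@tends_cst R (a * y)) (tends_shift 1 hl'))).
have E : l = a * b * l + (l' + a * y * l').
  apply: (tends_uniq H1); apply: tends_ext H2 => n.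
  by rewrite addn1 addn2 -partial_wsum_rec.
by rewrite mulrBr mulr1 {1}E; ring.
Qed.

Lemma absc_y2_le1 : absc (y ^+ 2) <= 1.
Proof.
rewrite abscX exprn_ile1 ?absc_ge0 //; apply: le_trans absc_y_le _.
by rewrite invf_le1 ?ltr0n // ler1n.
Qed.

Lemma leq_double2 n : (n <= n.*2)%N.
Proof. by rewrite -addnn leq_addr. Qed.

(** With S_N = S(a x^N, b x^N), the functional equation used once in a and, by symmetry, once in b
    leads from S_N to S_(N+1). This produces one factor of [num] but two of [den], 1 - a b x^(2N)
    and 1 - a b x^(2N+1), hence [den N.*2] against [num N] in [iter]. *)
Lemma wsum_limit a b r num den alpha beta : 0 <= r -> r < 1 -> dominated a b r ->
  (forall n, num n = \prod_(i < n) ((1 + a * y * y ^+ i.*2) * (1 + b * y * y ^+ i.*2))) ->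
  (forall n, den n = \prod_(i < n) (1 - a * b * y ^+ i.*2)) ->
  tends num alpha -> tends den beta -> beta != 0 ->
  tends (fun n => \sum_(i < n) wsum Q a b i) (alpha / beta).
Proof.
move=> r0 r1 dom numE denE hnum hden beta0.
have c1 N : absc (y ^+ 2 ^+ N) <= 1.
  by rewrite abscX exprn_ile1 ?absc_ge0 // absc_y2_le1.
have c2 N : absc (y ^+ 2 ^+ N * y ^+ 2) <= 1 by rewrite -exprSr.
have lims N c : absc c <= 1 ->
    {l | tends (fun n => \sum_(i < n) wsum Q (a * c) (b * y ^+ 2 ^+ N) i) l}.
  by move=> cc; apply: cid; apply: (wsum_series_cvg r0 r1 dom).
pose S N := projT1 (lims N _ (c1 N)).
have hS N : tends (fun n => \sum_(i < n) wsum Q (a * y ^+ 2 ^+ N) (b * y ^+ 2 ^+ N) i) (S N).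
  exact: (projT2 (lims N _ (c1 N))).
have hS0 : tends (fun n => \sum_(i < n) wsum Q a b i) (S 0%N).
  by apply: tends_ext (hS 0%N) => n; rewrite expr0 !mulr1.
have step N : S N * ((1 - a * b * y ^+ N.*2.*2) * (1 - a * b * y ^+ N.*2.+1.*2)) =
    (1 + a * y * y ^+ N.*2) * (1 + b * y * y ^+ N.*2) * S N.+1.
  have [l hl] := lims N _ (c2 N).
  set M := y ^+ 2 ^+ N in hl *.
  have E1 : S N * (1 - a * M * (b * M)) = (1 + a * M * y) * l.
    by apply: wsum_limit_rec (hS N) _; apply: tends_ext hl => n; rewrite mulrA.
  have E2 : l * (1 - b * M * (a * M * y ^+ 2)) = (1 + b * M * y) * S N.+1.
    apply: wsum_limit_rec.
      by apply: tends_ext hl => n; apply: eq_bigr => i _; rewrite mulrA wsumC.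
    apply: tends_ext (hS N.+1) => n; apply: eq_bigr => i _.
    by rewrite exprSr !mulrA wsumC.
  have ME : y ^+ N.*2 = M by rewrite /M -exprM mul2n.
  have ME2 : y ^+ N.*2.*2 = M * M by rewrite -[in LHS]addnn exprD ME.
  have ME3 : y ^+ N.*2.+1.*2 = M * M * y ^+ 2 by rewrite doubleS -addn2 exprD ME2.
  rewrite ME ME2 ME3 mulrA.
  transitivity (S N * (1 - a * M * (b * M)) * (1 - b * M * (a * M * y ^+ 2))); first by ring.
  by rewrite E1 -mulrA E2; ring.
have iter N : S 0%N * den N.*2 = num N * S N.
  elim: N => [|N IH]; first by rewrite numE denE !big_ord0 mulr1 mul1r.
  have -> : den N.+1.*2 = den N.*2 * ((1 - a * b * y ^+ N.*2.*2) * (1 - a * b * y ^+ N.*2.+1.*2)).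
    by rewrite !denE doubleS !big_ord_recr /= mulrA.
  have -> : num N.+1 = num N * ((1 + a * y * y ^+ N.*2) * (1 + b * y * y ^+ N.*2)).
    by rewrite !numE big_ord_recr.
  by rewrite (mulrA (S 0%N)) IH -(mulrA _ (S N)) step mulrA.
have S1 : tends S 1.
  apply/tendsP => e e0; pose K := 4%:R * ((1 - r) ^+ 2)^-1.
  have K0 : 0 < K + 1 by rewrite ltr_wpDl // mulr_ge0 ?invr_ge0 ?exprn_ge0 ?subr_ge0 ?(ltW r1).
  have X1 : `|absc (y ^+ 2)| < 1.
    rewrite ger0_norm ?absc_ge0 // abscX.
    apply: le_lt_trans (_ : 3%:R^-1 ^+ 2 < 1); last first.
      by rewrite exprn_ilt1 ?invr_ge0 ?ler0n // invf_lt1 ?ltr0n // ltr1n.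
    by rewrite lerXn2r ?nnegrE ?absc_ge0 ?invr_ge0 // absc_y_le.
  have /cvgrPdist_lt/(_ _ (divr_gt0 e0 K0))[N _ HN] := cvg_expr X1.
  exists N => n Nn; have := HN n Nn; rewrite /= sub0r normrN ger0_norm ?exprn_ge0 ?absc_ge0 //.
  rewrite ltr_pdivlMr // => H; rewrite -opprB abscN.
  apply: le_lt_trans (wsum_series_scaled_near1 r0 r1 dom (c1 n) (hS n)) _.
  apply: le_lt_trans H; rewrite [absc (y ^+ 2 ^+ n)]abscX ler_wpM2l ?exprn_ge0 ?absc_ge0 //.
  by rewrite lerDl.
have H1 := tendsM (@tends_cst R (S 0%N)) (tends_sub (fun n => leq_double2 n) hden).
have H2 := tends_ext (fun n => esym (iter n)) (tendsM hnum S1).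
have E := tends_uniq H1 H2; rewrite mulr1 in E.
by rewrite -E mulfK.
Qed.

End WsumLimit.

Lemma sign_m1 (C : unitRingType) i : (-1) ^ (i.+1%:Z - 1) = (-1) ^+ i :> C.
Proof. by rewrite (_ : i.+1%:Z - 1 = i%:Z) ?exprnP //; lia. Qed.

(** * The infinite products of the theorem and the values of the series *)

Section InfiniteProducts.
Variables (R : realType) (F : finFieldType).
Hypothesis q_mod4 : #|F| = 3 %[mod 4].
Local Notation C := R[i].
Local Notation Q := (#|F|%:R : C).
Local Notation y := (Q^-1).
Local Notation qR := (#|F|%:R : R).

Definition geoprod (z : C) n : C := \prod_(i < n) (1 + z * y ^+ i.*2).

Definition altprod (z : C) n : C := \prod_(i < n) (1 + (-1) ^+ i * z * y ^+ i).

Lemma absc_y_lt1 : absc y < 1.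
Proof.
by apply: le_lt_trans (absc_y_le R q_mod4) _; rewrite invf_lt1 ?ltr0n // ltr1n.
Qed.

Lemma absc_y2_lt1 : absc y ^+ 2 < 1.
Proof. by rewrite exprn_ilt1 ?absc_ge0 ?absc_y_lt1. Qed.

Lemma geoprod_cvg z : exists l, tends (geoprod z) l.
Proof.
apply: (@cvg_infprod _ (fun i => z * y ^+ i.*2) (absc z) (absc y ^+ 2));
  rewrite ?exprn_ge0 ?absc_ge0 ?absc_y2_lt1 //.
by move=> n; rewrite abscM abscX -mul2n exprM.
Qed.

Lemma geoprod_neq0 z l : absc z < 1 -> tends (geoprod z) l -> l != 0.
Proof.
move=> z1; pose r := Num.max (absc z) (absc y ^+ 2).
have y2r : absc y ^+ 2 <= r by rewrite le_max lexx orbT.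
have zr : absc z <= r by rewrite le_max lexx.
have E n : absc (z * y ^+ n.*2) = absc z * (absc y ^+ 2) ^+ n.
  by rewrite abscM abscX -mul2n exprM.
move=> hl; apply: (@infprod_neq0 _ (fun i => z * y ^+ i.*2) (absc z) r l _ _ _ _ _ hl);
  rewrite ?absc_ge0 //.
- by rewrite le_max absc_ge0.
- by rewrite gt_max z1 absc_y2_lt1.
- move=> n; rewrite E ler_wpM2l ?absc_ge0 //.
  by rewrite lerXn2r ?nnegrE ?exprn_ge0 ?absc_ge0 // le_max absc_ge0.
move=> n; rewrite E; apply: le_trans zr; rewrite ler_piMr ?absc_ge0 //.
by rewrite exprn_ile1 ?exprn_ge0 ?absc_ge0 // ltW ?absc_y2_lt1.
Qed.

Lemma altprod_cvg z : exists l, tends (altprod z) l.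
Proof.
apply: (@cvg_infprod _ (fun i => (-1) ^+ i * z * y ^+ i) (absc z) (absc y));
  rewrite ?absc_ge0 ?absc_y_lt1 //.
move=> n; rewrite !abscM !abscX abscN absc1 expr1n mul1r //.
Qed.

(** The factors of even index and those of odd index are two products in x; this is how the products
    with alternating signs arise from S(a, b). *)
Lemma altprod_double z n : altprod z n.*2 = geoprod z n * geoprod (- z * y) n.
Proof.
elim: n => [|n IH]; first by rewrite /altprod /geoprod !big_ord0 mulr1.
have -> : altprod z n.+1.*2 = altprod z n.*2 *
    ((1 + z * y ^+ n.*2) * (1 - z * y * y ^+ n.*2)).
  rewrite /altprod doubleS !big_ord_recr /= -mulrA; congr (_ * (_ * _)).
    by rewrite -signr_odd odd_double mul1r.
  by rewrite -signr_odd /= odd_double expr1 exprS; ring.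
by rewrite IH /geoprod !big_ord_recr /=; ring.
Qed.

Lemma altprod_even z l : tends (altprod z) l ->
  tends (fun n => geoprod z n * geoprod (- z * y) n) l.
Proof.
move=> hl; apply: tends_ext (tends_sub leq_double2 hl) => n; exact: altprod_double.
Qed.

Lemma wsum_cvg a b r z w d alpha beta : 0 <= r -> r < 1 -> dominated F a b r ->
  a * y = z -> b * y = w -> - (a * b) = d ->
  tends (fun n => geoprod z n * geoprod w n) alpha ->
  tends (geoprod d) beta -> beta != 0 ->
  tends (fun n => \sum_(i < n) wsum Q a b i) (alpha / beta).
Proof.
move=> r0 r1 dom <- <- <-; apply: (wsum_limit q_mod4 r0 r1 dom) => n.
  by rewrite /geoprod -big_split.
by apply: eq_bigr => i _; rewrite mulNr.
Qed.

Lemma infprodE (f : nat -> C) (p : nat -> C) l :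
  (forall n, \prod_(i < n) f i.+1 = p n) -> tends p l -> infprod_cvg f /\ infprod f = l.
Proof.
move=> fp hl; have E : partial_infprod f = p.
  by apply/funext => n; rewrite /partial_infprod big_add1 big_mkord fp.
have H : (partial_infprod f @ \oo --> (l : C^o))%classic by rewrite E.
split; first by apply/cvg_ex; exists l.
by apply: cvg_lim => //; apply: norm_hausdorff.
Qed.

Lemma sum_toE (f : nat -> C) l : tends (fun n => \sum_(i < n) f i) l -> sum_to f l.
Proof.
rewrite /sum_to /tends => H; rewrite (_ : series _ = fun n => \sum_(i < n) f i) //.
by apply/funext => n; rewrite /series /= big_mkord.
Qed.

(** Some integer exponents, such as 2(i - 2) at i = 1, are negative; a difference of naturals covers
    them all. *)
Lemma exprz_invE (m : int) n k : m = n%:Z - k%:Z -> (Q ^ m)^-1 = y ^+ n * Q ^+ k.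
Proof.
have Q0 := Q_neq0 C q_mod4; move=> ->.
by rewrite expfzDr // -exprz_inv -!exprnP invfM !exprVn invrK.
Qed.

Lemma qR_gt0 : 0 < qR.
Proof. by apply: lt_le_trans (qR_ge3 R q_mod4); rewrite ltr0n. Qed.

Lemma qpow_le1 m n : (m <= n)%N -> qR ^+ m * qR^-1 ^+ n <= 1.
Proof.
move=> mn; have q0 := qR_gt0; rewrite -(subnKC mn) exprD mulrA -exprMn mulfV ?gt_eqF //.
rewrite expr1n mul1r exprn_ile1 ?invr_ge0 ?(ltW q0) // invf_le1 //.
by apply: le_trans (qR_ge3 R q_mod4); rewrite ler1n.
Qed.

Lemma sqr_sum_le k l : ((k + l) ^ 2 <= 2 * k ^ 2 + 2 * l ^ 2)%N.
Proof. by rewrite sqrnD !mul2n -!addnn [leqRHS]addnACA leq_add2l addnn -mul2n (nat_Cauchy k l). Qed.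

(** This is k - l <= (k - l)^2 for integers. *)
Lemma sqr_sum_le_shift k l : (k + (k + l) ^ 2 <= l + (2 * k ^ 2 + 2 * l ^ 2))%N.
Proof.
have [kl|lk] := leqP k l; first by rewrite leq_add // sqr_sum_le.
by rewrite -(subnKC lk) -!mulnn; nia.
Qed.

Lemma dominated_le (a b : C) (r : R) : 0 <= r -> absc a <= r -> absc b <= r -> dominated F a b r.
Proof.
move=> r0 ar br k l; rewrite (exprD r) -[leRHS]mulr1; apply: ler_pM.
- by rewrite mulr_ge0 ?exprn_ge0 ?absc_ge0.
- by rewrite mulr_ge0 ?exprn_ge0 ?invr_ge0 ?ler0n.
- by rewrite ler_pM ?exprn_ge0 ?absc_ge0 // lerXn2r ?nnegrE ?absc_ge0.
by rewrite qpow_le1 // sqr_sum_le.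
Qed.

(** Gives the odd series its larger disc |u| < 1: the growth q^(k-l) of the arguments is absorbed by
    the weight q^(-(k-l)^2). *)
Lemma dominated_unbalanced (u a b : C) : absc a <= absc u * qR -> absc b = absc u / qR ->
  dominated F a b (absc u).
Proof.
move=> au bu k l; have q0 := qR_gt0.
apply: le_trans (_ : (absc u * qR) ^+ k * (absc u / qR) ^+ l *
  (qR ^+ ((k + l) ^ 2) * qR^-1 ^+ (2 * k ^ 2 + 2 * l ^ 2)) <= _).
  rewrite ler_wpM2r ?mulr_ge0 ?exprn_ge0 ?invr_ge0 ?ler0n // bu.
  rewrite ler_wpM2r ?exprn_ge0 ?mulr_ge0 ?invr_ge0 ?ler0n ?absc_ge0 //.
  by rewrite lerXn2r ?nnegrE ?mulr_ge0 ?absc_ge0 ?ler0n.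
rewrite !exprMn (_ : _ * _ = absc u ^+ (k + l) *
  (qR ^+ (k + (k + l) ^ 2) * qR^-1 ^+ (l + (2 * k ^ 2 + 2 * l ^ 2)))); last first.
  by rewrite (exprD qR) (exprD qR^-1 l) (exprD (absc u)); ring.
by rewrite ler_piMr ?exprn_ge0 ?absc_ge0 // qpow_le1 // sqr_sum_le_shift.
Qed.

Lemma exprz_2m2 i : (Q ^ (2 * (i.+1%:Z - 1)))^-1 = y ^+ i.*2.
Proof. by rewrite (@exprz_invE _ i.*2 0) ?mulr1 //; lia. Qed.

Lemma exprz_2m4 i : (Q ^ (2 * (i.+1%:Z - 2)))^-1 = y ^+ i.*2 * Q ^+ 2.
Proof. by rewrite (@exprz_invE _ i.*2 2) //; lia. Qed.

Lemma exprz_m1 i : (Q ^ (i.+1%:Z - 1))^-1 = y ^+ i.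
Proof. by rewrite (@exprz_invE _ i 0) ?mulr1 //; lia. Qed.

Lemma exprz_2m3 i : (Q ^ (2 * i.+1%:Z - 3))^-1 = y ^+ i.*2 * Q.
Proof. by rewrite (@exprz_invE _ i.*2 1) //; lia. Qed.

Lemma exprz_2m1 i : (Q ^ (2 * i.+1%:Z - 1))^-1 = y ^+ i.*2.+1.
Proof. by rewrite (@exprz_invE _ i.*2.+1 0) ?mulr1 //; lia. Qed.

Lemma exprz_2 i : (Q ^ (2 * i.+1%:Z))^-1 = y ^+ i.*2.+2.
Proof. by rewrite (@exprz_invE _ i.*2.+2 0) ?mulr1 //; lia. Qed.

Lemma geoprod_sqr (z : C) l : tends (geoprod z) l ->
  tends (fun n => \prod_(i < n) (1 + z * y ^+ i.*2) ^+ 2) (l * l).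
Proof.
move=> hl; apply: tends_ext (tendsM hl hl) => n; rewrite -big_split /=.
by apply: eq_bigr => i _; rewrite expr2.
Qed.

Section SeriesValues.
Variable u : C.
Let Q0 : Q != 0 := Q_neq0 C q_mod4.

Section Small.
Hypothesis u_small : absc u * qR < 1.
Let r := absc u * qR.

Lemma small_ge0 : 0 <= r. Proof. by rewrite mulr_ge0 ?absc_ge0 ?ler0n. Qed.

Lemma absc_le_small : absc u <= r.
Proof.
by rewrite ler_peMr ?absc_ge0 //; apply: le_trans (qR_ge3 R q_mod4); rewrite ler1n.
Qed.

Lemma dominated_small a b : absc a <= r -> absc b <= r -> dominated F a b r.
Proof. exact: dominated_le small_ge0. Qed.

Lemma absc_uQ : absc (u * Q) = r.
Proof. by rewrite abscM absc_Q. Qed.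

Lemma wsum_uQ_uQ l m : tends (geoprod u) l -> tends (geoprod (- (u * Q * (u * Q)))) m ->
  m != 0 -> tends (fun n => \sum_(i < n) wsum Q (u * Q) (u * Q) i) (l * l / m).
Proof.
move=> hl hm m0; have uQ : u * Q * y = u by rewrite mulfK.
apply: (wsum_cvg small_ge0 u_small _ uQ uQ erefl (tendsM hl hl) hm m0).
by apply: dominated_small; rewrite absc_uQ.
Qed.

Lemma wsum_u_u l m : tends (geoprod (u * y)) l -> tends (geoprod (- (u * u))) m ->
  m != 0 -> tends (fun n => \sum_(i < n) wsum Q u u i) (l * l / m).
Proof.
move=> hl hm m0.
apply: (wsum_cvg small_ge0 u_small _ erefl erefl erefl (tendsM hl hl) hm m0).
by apply: dominated_small; exact: absc_le_small.
Qed.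

Lemma wsum_NuQ_u l m : tends (altprod (- u)) l -> tends (geoprod (u * u * Q)) m ->
  m != 0 -> tends (fun n => \sum_(i < n) wsum Q (- u * Q) u i) (l / m).
Proof.
move=> hl hm m0; have uQ : - u * Q * y = - u by rewrite mulfK.
have uy : u * y = - - u * y by rewrite opprK.
have d : - (- u * Q * u) = u * u * Q by ring.
apply: (wsum_cvg small_ge0 u_small _ uQ uy d (altprod_even hl) hm m0).
by apply: dominated_small; rewrite ?absc_le_small // mulNr abscN absc_uQ.
Qed.

Lemma wsum_Nu_uQ l m : tends (altprod u) l -> tends (geoprod (u * u * Q)) m ->
  m != 0 -> tends (fun n => \sum_(i < n) wsum Q (- u) (u * Q) i) (l / m).
Proof.
move=> hl hm m0; have uQ : u * Q * y = u by rewrite mulfK.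
have d : - (u * Q * - u) = u * u * Q by ring.
apply: tends_ext (wsum_cvg small_ge0 u_small _ uQ erefl d (altprod_even hl) hm m0).
  by move=> n; apply: eq_bigr => i _; rewrite wsumC.
by apply: dominated_small; rewrite ?absc_uQ // abscN absc_le_small.
Qed.

Lemma geoprod_small_neq0 l : tends (geoprod (- (u * Q * (u * Q)))) l -> l != 0.
Proof.
by apply: geoprod_neq0; rewrite abscN abscM absc_uQ mulr_ilt1 ?small_ge0.
Qed.

Lemma geoprod_small_neq0' l : tends (geoprod (u * u * Q)) l -> l != 0.
Proof.
apply: geoprod_neq0; rewrite -mulrA abscM absc_uQ.
by rewrite mulr_ilt1 ?absc_ge0 ?small_ge0 // (le_lt_trans absc_le_small).
Qed.

End Small.

Hypothesis u_lt1 : absc u < 1.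

Lemma geoprod_unit_neq0 l : tends (geoprod (- (u * u))) l -> l != 0.
Proof. by apply: geoprod_neq0; rewrite abscN abscM mulr_ilt1 ?absc_ge0. Qed.

Lemma geoprod_unit_neq0' l : tends (geoprod (u * u * y)) l -> l != 0.
Proof.
apply: geoprod_neq0; rewrite -mulrA !abscM mulr_ilt1 ?mulr_ge0 ?absc_ge0 //.
by rewrite mulr_ilt1 ?absc_ge0 // absc_y_lt1.
Qed.

(** The source of the single factor 1 + u in the odd series: the two numerator products differ only
    by their first factor. *)
Lemma geoprod_shift l l' : tends (geoprod u) l -> tends (geoprod (u * y ^+ 2)) l' ->
  l = (1 + u) * l'.
Proof.
move=> hl hl'; apply: (tends_uniq (tends_sub leqnSn hl)).
apply: tends_ext (tendsM (@tends_cst R (1 + u)) hl') => n.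
rewrite /geoprod [RHS]big_ord_recl expr0 mulr1; congr (_ * _); apply: eq_bigr => i _.
by rewrite -mulrA -exprD.
Qed.

Lemma wsum_uQ_uV l l' m : tends (geoprod u) l -> tends (geoprod (u * y ^+ 2)) l' ->
  tends (geoprod (- (u * u))) m -> m != 0 ->
  tends (fun n => \sum_(i < n) wsum Q (u * Q) (u * y) i) (l * l' / m).
Proof.
move=> hl hl' hm m0; have uQ : u * Q * y = u by rewrite mulfK.
have uy : u * y * y = u * y ^+ 2 by rewrite -mulrA.
have d : - (u * Q * (u * y)) = - (u * u) by field.
apply: (wsum_cvg (absc_ge0 u) u_lt1 _ uQ uy d (tendsM hl hl') hm m0).
by apply: dominated_unbalanced; rewrite abscM ?absc_Q ?absc_y.
Qed.

Lemma wsum_Nu_uV l m : tends (altprod (- (u * y))) l -> tends (geoprod (u * u * y)) m ->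
  m != 0 -> tends (fun n => \sum_(i < n) wsum Q (- u) (u * y) i) (l / m).
Proof.
move=> hl hm m0; have uy : - u * y = - (u * y) by rewrite mulNr.
have uyy : u * y * y = - - (u * y) * y by rewrite opprK.
have d : - (- u * (u * y)) = u * u * y by ring.
apply: (wsum_cvg (absc_ge0 u) u_lt1 _ uy uyy d (altprod_even hl) hm m0).
apply: dominated_unbalanced; rewrite ?abscN ?abscM ?absc_y //.
by rewrite ler_peMr ?absc_ge0 //; apply: le_trans (qR_ge3 R q_mod4); rewrite ler1n.
Qed.

End SeriesValues.

End InfiniteProducts.

(** * Assembly of the generating functions *)

Section MainSeries.
Variables (R : realType) (F : finFieldType).
Hypothesis q_mod4 : #|F| = 3 %[mod 4].
Local Notation C := R[i].
Local Notation q := (#|F|%:R : C).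
Local Notation y := (q^-1).
Variable u : C.

Lemma abs_lt_invq : (`|u| < 1 / q) = (absc u * #|F|%:R < 1).
Proof.
rewrite -ltr_pdivlMr ?qR_gt0 // normE -real_complex_lt rmorphM rmorph1 fmorphV rmorph_nat //.
Qed.

Lemma infprod_sqr z (f : nat -> C) l : (forall i, f i.+1 = (1 + z * y ^+ i.*2) ^+ 2) ->
  tends (geoprod F z) l -> infprod_cvg f /\ infprod f = l * l.
Proof.
move=> fE hl; apply: (infprodE _ (geoprod_sqr hl)) => n.
by apply: eq_bigr => i _.
Qed.

Lemma infprod_geo z (f : nat -> C) l : (forall i, f i.+1 = 1 + z * y ^+ i.*2) ->
  tends (geoprod F z) l -> infprod_cvg f /\ infprod f = l.
Proof. by move=> fE hl; apply: (infprodE _ hl) => n; apply: eq_bigr => i _. Qed.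

Lemma infprod_alt z (f : nat -> C) l : (forall i, f i.+1 = 1 + (-1) ^+ i * z * y ^+ i) ->
  tends (altprod F z) l -> infprod_cvg f /\ infprod f = l.
Proof. by move=> fE hl; apply: (infprodE _ hl) => n; apply: eq_bigr => i _. Qed.

(** Shared by the three series: c is 1 or -1 for the two signs in even dimension, and 0 in odd
    dimension, where only two sums occur. *)
Lemma sum_to4 (a w1 w2 w3 w4 : nat -> C) c l1 l2 l3 l4 :
  (forall n, a n = 4%:R^-1 * (w1 n + w2 n + c * w3 n + c * w4 n)) ->
  tends (fun n => \sum_(i < n) w1 i) l1 -> tends (fun n => \sum_(i < n) w2 i) l2 ->
  tends (fun n => \sum_(i < n) w3 i) l3 -> tends (fun n => \sum_(i < n) w4 i) l4 ->
  sum_to a (1 / 4%:R * (l1 + l2 + c * l3 + c * l4)).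
Proof.
move=> aE h1 h2 h3 h4; apply: sum_toE.
have hc l w := tendsM (@tends_cst R c) (w : tends _ l).
have H := tendsM (@tends_cst R (1 / 4%:R))
  (tendsD (tendsD (tendsD h1 h2) (hc _ _ h3)) (hc _ _ h4)).
apply: tends_ext H => n; rewrite div1r !mulr_sumr -!big_split mulr_sumr.
by apply: eq_bigr => i _; rewrite aE.
Qed.

End MainSeries.
Theorem theorem6p4 (R : realType) (F : finFieldType) (delta : F)
    (q_mod4 : #|F| = 3 %[mod 4])
    (delta_nonsquare : forall x : F, x ^+ 2 != delta) :
  let q : R[i] := #|F|%:R in
  (forall u : R[i], `|u| < 1 / q ->
    let A  := fun i : nat => (1 + u / q ^ (2 * (i%:Z - 1))) ^+ 2 in
    let A' := fun i : nat => 1 - u ^+ 2 / q ^ (2 * (i%:Z - 2)) in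
    let B  := fun i : nat => 1 + (-1) ^ (i%:Z - 1) * u / q ^ (i%:Z - 1) in
    let B' := fun i : nat => 1 + u ^+ 2 / q ^ (2 * i%:Z - 3) in
    let D  := fun i : nat => 1 - (-1) ^ (i%:Z - 1) * u / q ^ (i%:Z - 1) in
    let E  := fun i : nat => (1 + u / q ^ (2 * i%:Z - 1)) ^+ 2 in
    let E' := fun i : nat => 1 - u ^+ 2 / q ^ (2 * (i%:Z - 1)) in
    [/\ [/\ infprod_cvg A, infprod_cvg B, infprod_cvg D & infprod_cvg E],
        [/\ infprod_cvg A', infprod_cvg B' & infprod_cvg E'],
        [/\ infprod A' != 0, infprod B' != 0 & infprod E' != 0],
        sum_to (fun n => ratio_plus R[i] F n * q ^+ (n ^ 2) * u ^+ n)
          (1 / 4 * (infprod A / infprod A' + infprod B / infprod B'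
                    + infprod D / infprod B' + infprod E / infprod E'))
      & sum_to (fun n => ratio_minus R[i] delta n * q ^+ (n ^ 2) * u ^+ n)
          (1 / 4 * (infprod A / infprod A' + infprod B / infprod B'
                    - infprod D / infprod B' - infprod E / infprod E'))])
  /\
  (forall u : R[i], `|u| < 1 ->
    let A  := fun i : nat => (1 + u / q ^ (2 * i%:Z)) ^+ 2 in
    let A' := fun i : nat => 1 - u ^+ 2 / q ^ (2 * (i%:Z - 1)) in
    let B  := fun i : nat => 1 + (-1) ^ i%:Z * u / q ^ i%:Z in
    let B' := fun i : nat => 1 + u ^+ 2 / q ^ (2 * i%:Z - 1) in
    [/\ [/\ infprod_cvg A, infprod_cvg B, infprod_cvg A' & infprod_cvg B'],
        infprod A' != 0, infprod B' != 0
      & sum_to (fun n => ratio_odd R[i] F n * q ^+ (n ^ 2) * u ^+ n)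
          (1 / 4 * ((1 + u) * infprod A / infprod A'
                    + infprod B / infprod B'))]).
Proof.
move=> q; have Q0 : q != 0 := Q_neq0 R[i] q_mod4.
split=> u.
  move=> u_lt A A' B B' D E E'.
  have u1 : absc u * #|F|%:R < 1 by rewrite -(abs_lt_invq q_mod4).
  have uu1 : absc u < 1 by apply: le_lt_trans (absc_le_small q_mod4 u) u1.
  have [lu hu] := geoprod_cvg q_mod4 u.
  have [luy huy] := geoprod_cvg q_mod4 (u * q^-1).
  have [la ha] := altprod_cvg q_mod4 u.
  have [ld hd] := altprod_cvg q_mod4 (- u).
  have [lA' hA'] := geoprod_cvg q_mod4 (- (u * q * (u * q))).
  have [lB' hB'] := geoprod_cvg q_mod4 (u * u * q).
  have [lE' hE'] := geoprod_cvg q_mod4 (- (u * u)).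
  have [cA eA] : infprod_cvg A /\ infprod A = lu * lu.
    by apply: infprod_sqr hu => i; rewrite /A exprz_2m2.
  have [cA' eA'] : infprod_cvg A' /\ infprod A' = lA'.
    by apply: infprod_geo hA' => i; rewrite /A' exprz_2m4 // /q; ring.
  have [cB eB] : infprod_cvg B /\ infprod B = la.
    by apply: infprod_alt ha => i; rewrite /B sign_m1 exprz_m1.
  have [cD eD] : infprod_cvg D /\ infprod D = ld.
    by apply: infprod_alt hd => i; rewrite /D sign_m1 exprz_m1 // mulrN mulNr.
  have [cB' eB'] : infprod_cvg B' /\ infprod B' = lB'.
    by apply: infprod_geo hB' => i; rewrite /B' exprz_2m3 // /q; ring.
  have [cE eE] : infprod_cvg E /\ infprod E = luy * luy.
    by apply: infprod_sqr huy => i; rewrite /E exprz_2m1 // (exprS q^-1) mulrA.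
  have [cE' eE'] : infprod_cvg E' /\ infprod E' = lE'.
    by apply: infprod_geo hE' => i; rewrite /E' exprz_2m2 // /q; ring.
  have nA' := geoprod_small_neq0 q_mod4 u1 hA'.
  have nB' := geoprod_small_neq0' q_mod4 u1 hB'.
  have nE' := geoprod_unit_neq0 q_mod4 uu1 hE'.
  have W1 := wsum_uQ_uQ q_mod4 u1 hu hA' nA'.
  have W2 := wsum_u_u q_mod4 u1 huy hE' nE'.
  have W3 := wsum_NuQ_u q_mod4 u1 hd hB' nB'.
  have W4 := wsum_Nu_uQ q_mod4 u1 ha hB' nB'.
  rewrite eA eB eD eE eA' eB' eE'; apply: And5.
  - exact: And4 cA cB cD cE.
  - exact: And3 cA' cB' cE'.
  - exact: And3 nA' nB' nE'.
  - rewrite -[ld / lB']mul1r -[luy * luy / lE']mul1r.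
    by apply: sum_to4 W1 W4 W3 W2 => n; rewrite !mul1r ratio_plusE.
  rewrite -[- (ld / lB')]mulN1r -[- (luy * luy / lE')]mulN1r.
  by apply: sum_to4 W1 W4 W3 W2 => n; rewrite !mulN1r ratio_minusE.
move=> u_lt A A' B B'.
have u1 : absc u < 1 by rewrite -real_complex_lt -normE rmorph1.
have [lu hu] := geoprod_cvg q_mod4 u.
have [lux hux] := geoprod_cvg q_mod4 (u * q^-1 ^+ 2).
have [la ha] := altprod_cvg q_mod4 (- (u * q^-1)).
have [lA' hA'] := geoprod_cvg q_mod4 (- (u * u)).
have [lB' hB'] := geoprod_cvg q_mod4 (u * u * q^-1).
have [cA eA] : infprod_cvg A /\ infprod A = lux * lux.
  by apply: infprod_sqr hux => i; rewrite /A exprz_2 // -(addn2 i.*2) addnC exprD mulrA.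
have [cA' eA'] : infprod_cvg A' /\ infprod A' = lA'.
  by apply: infprod_geo hA' => i; rewrite /A' exprz_2m2 // /q; ring.
have [cB eB] : infprod_cvg B /\ infprod B = la.
  by apply: infprod_alt ha => i; rewrite /B -!exprnP -exprVn !exprS /q; ring.
have [cB' eB'] : infprod_cvg B' /\ infprod B' = lB'.
  by apply: infprod_geo hB' => i; rewrite /B' exprz_2m1 // (exprS q^-1) /q; ring.
have nA' := geoprod_unit_neq0 q_mod4 u1 hA'.
have nB' := geoprod_unit_neq0' q_mod4 u1 hB'.
have W1 := wsum_uQ_uV q_mod4 u1 hu hux hA' nA'.
have W2 := wsum_Nu_uV q_mod4 u1 ha hB' nB'.
rewrite eA eB eA' eB'; apply: And4 nA' nB' _; first exact: And4 cA cB cA' cB'.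
have -> : (1 + u) * (lux * lux) = lu * lux by rewrite (geoprod_shift hu hux) mulrA.
have W0 : tends (fun n => \sum_(i < n) (0 : R[i])) 0.
  by apply: tends_ext (@tends_cst R 0) => n; rewrite big1.
have -> : lu * lux / lA' + la / lB' = lu * lux / lA' + la / lB' + 0 * 0 + 0 * 0.
  by rewrite mul0r !addr0.
apply: (sum_to4 (w3 := fun=> 0) (w4 := fun=> 0) _ W1 W2 W0 W0) => n.
by rewrite !mul0r !addr0 ratio_oddE.
Qed.
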